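(* Let $a\in(0,1/14)$ and $c>1$. For $y\in[0,1]$, consider the sequence $$\{a_1(y)<a_2(y)<\cdots\}=\left\{n\in\mathbb{N}:\ 0<2^{\lfloor n^c\rfloor}y \bmod 1<n^{-a}\right\}.$$ Then, for $\lambda$-almost every $y\in[0,1]$, the following holds: for every probability space $(X,\mathcal{X},\mu)$, every pair of commuting measure-preserving transformations $T_1,T_2\colon X\to X$, and every $f_1,f_2\in L^\infty(\mu)$, $$\lim_{N\to\infty}\frac1N\sum_{n=1}^N f_1(T_1^n x)\,f_2(T_2^{a_n(y)}x)=\mathbb{E}(f_1|\mathcal{I}(T_1))(x)\,\mathbb{E}(f_2|\mathcal{I}(T_2))(x)$$ for $\mu$-almost every $x\in X$.
   Context: $\lambda$ denotes Lebesgue measure on $[0,1]$. A measure-preserving transformation of a probability space $(X,\mathcal{X},\mu)$ is a measurable map $T\colon X\to X$ with $\mu(T^{-1}A)=\mu(A)$ for all $A\in\mathcal{X}$. $\mathcal{I}(T)=\{A\in\mathcal{X}:\mu(A\,\Delta\, T^{-1}A)=0\}$, and $\mathbb{E}(f|\mathcal{I}(T))$ is the conditional expectation. (For $\lambda$-almost every $y$ the set above is infinite, so the sequence is well defined.) *)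

(* Defs.v *)
From mathcomp Require Export all_boot all_order all_algebra complex.
From mathcomp Require Export all_classical all_reals all_analysis.
Export Order.TTheory GRing.Theory Num.Theory.
Export numFieldNormedType.Exports.

Set Implicit Arguments.
Unset Strict Implicit.
Unset Printing Implicit Defensive.

Local Open Scope classical_set_scope.
Local Open Scope ring_scope.

Definition frac_part (R : realType) (x : R) : R := x - (Num.floor x)%:~R.

(* The index n ranges over the positive integers; on nonnegative reals
   Num.truncn is the floor, as a natural number. *)
Definition hitting_times (R : realType) (a c y : R) : set nat :=
  [set n | (0 < n)%N /\
           0 < frac_part (2 ^+ Num.truncn (n%:R `^ c) * y) < n%:R `^ (- a)].

(* [increasing_enum S n] is the n-th smallest element of S, counted from n = 1:
   the element k of S such that exactly n elements of S are <= k.  The default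
   value 0 is only taken when n = 0 or when S has fewer than n elements. *)
Definition increasing_enum (S : set nat) (n : nat) : nat :=
  xget 0%N [set k | S k /\ count (fun j => j \in S) (iota 0 k.+1) = n].

Section probability_space.
Context {d : measure_display} {X : measurableType d} {R : realType}.
Variable mu : probability X R.

Definition measure_preserving (T : X -> X) : Prop :=
  measurable_fun setT T /\
  forall A : set X, measurable A -> mu (T @^-1` A) = mu A.

Definition invariant_sets (T : X -> X) : set (set X) :=
  [set A | measurable A /\ mu (A `+` T @^-1` A) = 0%E].

(* g is a version of E(f|G), for a sigma-algebra G of measurable sets *)
Definition is_cond_exp (G : set (set X)) (f g : X -> R) : Prop :=
  [/\ mu.-integrable setT (EFin \o g),
      forall B : set R, measurable B -> G (g @^-1` B) &
      forall A, G A -> (\int[mu]_(x in A) (g x)%:E = \int[mu]_(x in A) (f x)%:E)%E].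

Definition real_cond_exp (f : X -> R) (G : set (set X)) : X -> R :=
  xget (cst 0) [set g | is_cond_exp G f g].

(* L^infty(mu) is taken with complex values; the library's [Lfun mu p] only has
   real-valued functions, so a complex function is handled through its real and
   imaginary parts. *)
Definition Linfty (f : X -> R[i]) : Prop :=
  (fun x => complex.Re (f x)) \in Lfun mu +oo%E /\
  (fun x => complex.Im (f x)) \in Lfun mu +oo%E.

Definition cond_exp (f : X -> R[i]) (G : set (set X)) : X -> R[i] :=
  fun x => (real_cond_exp (fun z => complex.Re (f z)) G x +i*
            real_cond_exp (fun z => complex.Im (f z)) G x)%C.

End probability_space.

(* Main.v *)
(* Let chi_k be the indicator of the hitting times, s_k = sum_(i < k) chi_i and
   sigma_k = k^-a.  The binary digits of y in the disjoint blocks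
   [k^c, (k+1)^c) are independent, and for almost every y they determine chi_k
   for all large k, because 2^-(block length) is summable.  Hence chi agrees
   eventually with a sequence of independent bits of probability about sigma_k.

   Summing over the hits, the averages become (1/W_N) sum_(k < N) chi_k
   f(T^(s_k + 1) x) g(S^k x) with W_N = sum_(k < N) sigma_k.  Two successive van
   der Corput (blockwise Cauchy-Schwarz) steps bound the L^2(mu) norm of
   sum_(k < N) (chi_k - sigma_k) f(T^(s_k) x) g(S^k x), uniformly over all systems
   and all |f|, |g| <= 1, by an explicit function of the bits.  Its expectation
   over y, computed by orthogonality of the centred bits, is at most
   W_N^2 N^-epsilon as soon as a < 1/14; along N = j^p this is summable, and the
   gaps are filled by monotonicity.  So chi_k may be replaced by sigma_k.

   If g is S-invariant, Birkhoff's theorem for T concludes.  If the ergodic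
   averages of g vanish in the limit, write g = h - h o S + q with q an ergodic
   average of g: the coboundary is summed by parts, since s_k is constant on long
   stretches, and |q| contributes a limit of small mean. *)

Require Import Defs.
From mathcomp Require Import measurable_realfun ess_sup_inf ring lra zify.

Set Implicit Arguments.
Unset Strict Implicit.
Unset Printing Implicit Defensive.

Local Open Scope classical_set_scope.
Local Open Scope ring_scope.

(** * A blockwise van der Corput inequality *)

(** The null set of [y] has to be chosen before the system, so everything random is packed into
    [good], a numerical condition on the bits alone; past it the argument is deterministic in [y].
    To reach such a condition the dynamics must disappear from the estimate, and the obstacle is
    that the exponent [s_k] of [T] depends on the bits itself. The first van der Corput step, with
    shift [m], prescribes [r = s_(k+m) - s_k], so that the [f]-factor becomes one function of
    [T^L x] common to all [k]; the second, with shift [d], prescribes [e = s_(k+d) - s_k], and the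
    [g]-factor becomes a number of modulus at most 1. What is left is a sum over [k] of products of
    four centred bits at [k], [k + m], [k + d], [k + d + m], under conditions on hit counts. The
    last bit is independent of all the rest, so these sums are martingales. Correlations are bounded
    through [2 a b <= th + b^2 / th] and not through square roots: the bound is then linear in the
    squared sums and only their expectation is needed. Balancing the block lengths against the
    weights [eta] and [th] produces the constant [14]. *)

Section BlockInequality.
Context {R : realFieldType}.
Implicit Types (v : nat -> R) (M L N : nat).

Lemma sqr_sum_le v L : (\sum_(i < L) v i) ^+ 2 <= L%:R * \sum_(i < L) v i ^+ 2.
Proof.
(* The expanded form of [\sum_i (v i - t)^2 >= 0], used with [t = v L]. *)
have aux t : 2 * t * \sum_(i < L) v i <= \sum_(i < L) v i ^+ 2 + L%:R * t ^+ 2.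
  elim: L => [|L IH]; first by rewrite !big_ord0; lra.
  have := sqr_ge0 (t - v L); rewrite !big_ord_recr /= -natr1; lra.
elim: L aux => [|L IH] aux; first by rewrite !big_ord0; lra.
have {}IH : (\sum_(i < L) v i) ^+ 2 <= L%:R * \sum_(i < L) v i ^+ 2.
  apply: IH => t; elim: {aux} L => [|L IH]; first by rewrite !big_ord0; lra.
  have := sqr_ge0 (t - v L); rewrite !big_ord_recr /= -natr1; lra.
have := aux (v L); rewrite !big_ord_recr /= -natr1; nra.
Qed.

Lemma sum_ltn_shift (F : nat -> nat -> R) M :
  \sum_(j < M) \sum_(l < M | (j < l)%N) F j l =
  \sum_(1 <= m < M) \sum_(j < M | (j + m < M)%N) F j (j + m)%N.
Proof.
under [RHS]eq_bigr do rewrite big_mkcond.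
rewrite exchange_big /=; apply: eq_bigr => j _.
rewrite big_mkcond -(big_mkord xpredT (fun l => if (j < l)%N then F j l else 0)).
have jM := ltn_ord j.
rewrite (@big_cat_nat _ _ _ j.+1) //= big_nat big1 ?add0r; last first.
  by move=> i /andP[_ ij]; rewrite ltnNge -ltnS ij.
rewrite [RHS](@big_cat_nat _ _ _ (M - j)%N) //=; [|lia|lia].
rewrite [X in _ = _ + X]big_nat [X in _ = _ + X]big1 ?addr0; last first.
  by move=> i /andP[i1 i2]; rewrite ifF //; lia.
have -> : j.+1 = (1 + j)%N by lia.
rewrite big_addn !big_nat; apply: eq_bigr => i /andP[i1 i2].
by rewrite [in RHS]addnC !ifT //; lia.
Qed.

Lemma sqr_sum_split v M : (\sum_(j < M) v j) ^+ 2 =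
  \sum_(j < M) v j ^+ 2 +
  2 * \sum_(1 <= m < M) \sum_(j < M | (j + m < M)%N) v j * v (j + m)%N.
Proof.
rewrite -(sum_ltn_shift (fun j l => v j * v l)).
elim: M => [|M IH]; first by rewrite !big_ord0; lra.
rewrite !big_ord_recr /=.
have -> : \sum_(j < M) \sum_(l < M.+1 | (j < l)%N) v j * v l =
   \sum_(j < M) \sum_(l < M | (j < l)%N) v j * v l + (\sum_(j < M) v j) * v M.
  rewrite mulr_suml -big_split; apply: eq_bigr => j _ /=.
  by rewrite big_mkcond big_ord_recr /= -big_mkcond /= ltn_ord.
rewrite [X in _ = _ + 2 * (_ + X)]big1 ?addr0; last first.
  by move=> i; rewrite ltnNge -ltnS ltn_ord.
rewrite sqrrD IH; ring.
Qed.

Lemma sum_blocks v L M :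
  \sum_(k < L * M) v k = \sum_(i < L) \sum_(j < M) v (i * M + j)%N.
Proof.
elim: L => [|L IH]; first by rewrite mul0n !big_ord0.
rewrite big_ord_recr /= -IH -!(big_mkord xpredT) /=.
rewrite -(big_mkord xpredT (fun j => v (L * M + j)%N)).
rewrite (@big_cat_nat _ _ _ (L * M)%N) //=; last by rewrite mulSn leq_addl.
congr (_ + _).
rewrite -{1}[(L * M)%N]add0n big_addn mulSn addnK.
by apply: eq_bigr => i _; rewrite addnC.
Qed.

(* A van der Corput inequality without boundary terms, obtained by applying
   Cauchy-Schwarz to the sums over consecutive blocks of length [M]. *)
Lemma block_van_der_corput v L M : (0 < M)%N ->
  (\sum_(k < L * M) v k) ^+ 2 <= L%:R * (\sum_(k < L * M) v k ^+ 2 +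
   2 * \sum_(1 <= m < M) \sum_(k < L * M | ((k + m) %/ M == k %/ M)%N)
         v k * v (k + m)%N).
Proof.
move=> M0; rewrite sum_blocks.
apply: le_trans (sqr_sum_le (fun i => \sum_(j < M) v (i * M + j)%N) L) _.
apply: ler_wpM2l => //.
under eq_bigr do rewrite (sqr_sum_split (fun j => v (_ * M + j)%N)).
rewrite big_split /= -(sum_blocks (fun k => v k ^+ 2)) lerD2l -mulr_sumr.
rewrite ler_pM2l ?ltr0n // exchange_big /=.
rewrite le_eqVlt; apply/orP; left; apply/eqP; apply: eq_bigr => m _.
rewrite [RHS]big_mkcond /= (sum_blocks (fun k => if ((k + m) %/ M == k %/ M)%N
  then v k * v (k + m)%N else 0)); apply: eq_bigr => i _.
rewrite big_mkcond /=; apply: eq_bigr => j _.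
(* With [k = i * M + j] and [j < M], lying in the same block means [j + m < M]. *)
rewrite -addnA !divnMDl // (divn_small (ltn_ord j)) addn0.
have -> : ((i + (j + m) %/ M)%N == i) = (j + m < M)%N.
  rewrite -[X in _ == X]addn0 eqn_add2l.
  by rewrite eqn0Ngt divn_gt0 // -ltnNge.
by [].
Qed.

End BlockInequality.

(** * Bounded measurable functions *)

Lemma ae_mono {d} {T : measurableType d} {R : realType}
    (mu : {measure set T -> \bar R}) (P Q : T -> Prop) :
  (forall x, P x -> Q x) -> {ae mu, forall x, P x} -> {ae mu, forall x, Q x}.
Proof. by move=> PQ; apply: filterS. Qed.

Lemma aeI {d} {T : measurableType d} {R : realType}
    (mu : {measure set T -> \bar R}) (P Q : T -> Prop) :
  {ae mu, forall x, P x} -> {ae mu, forall x, Q x} -> {ae mu, forall x, P x /\ Q x}.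
Proof. by move=> aP aQ; apply: filterS2 aP aQ => x. Qed.

(** Beppo Levi: the sum of the series has a finite integral, so it is finite almost everywhere. This
    serves as Borel-Cantelli for the random [y] and again for the points [x] of a system. *)
Lemma ae_series_bounded {d} {T : measurableType d} {R : realType}
    (mu : {measure set T -> \bar R}) (D : set T) (h : nat -> T -> R) (C : R) :
  measurable D -> (forall n, measurable_fun D (h n)) ->
  (forall n x, D x -> 0 <= h n x) ->
  (forall n, \sum_(i < n) \int[mu]_(x in D) (h i x)%:E <= C%:E)%E ->
  {ae mu, forall x, D x -> exists M : R, forall n, \sum_(i < n) h i x <= M}.
Proof.
move=> mD mh h0 hC.
pose F : T -> \bar R := fun x => (\sum_(0 <= i <oo) (h i x)%:E)%E.
have F0 x : D x -> (0 <= F x)%E.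
  by move=> Dx; apply: nneseries_ge0 => n _ _; rewrite lee_fin h0.
have mF : measurable_fun D F.
  apply: ge0_emeasurable_sum => [n x Dx _|n _].
    by rewrite lee_fin h0.
  exact/measurable_EFinP.
have iF : mu.-integrable D F.
  apply/integrableP; split => //.
  apply: (@le_lt_trans _ _ C%:E); last exact: ltry.
  under eq_integral => x /[!inE] Dx do rewrite gee0_abs ?F0//.
  rewrite integral_nneseries//.
  - apply: lime_le.
      by apply: is_cvg_ereal_nneg_natsum => n _; apply: integral_ge0 => x Dx;
        rewrite lee_fin h0.
    by near=> n; rewrite big_mkord; exact: hC.
  - by move=> n; exact/measurable_EFinP.
move: (integrable_ae mD iF); apply: filterS => x Fx Dx.
exists (fine (F x)) => n.
rewrite -lee_fin fineK; last exact: Fx.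
rewrite -sumEFin -(big_mkord xpredT (fun i => (h i x)%:E)).
by apply: nneseries_lim_ge => i _; rewrite lee_fin h0.
Unshelve. all: by end_near.
Qed.

Lemma bounded_series_cvg0 {R : realType} (u : nat -> R) (M : R) :
  (forall n, 0 <= u n) -> (forall n, \sum_(i < n) u i <= M) -> u @ \oo --> 0.
Proof.
move=> u0 uM; apply: cvg_series_cvg_0.
apply: nondecreasing_is_cvgn; first by apply: nondecreasing_series => n _ _; exact: u0.
exists M => _ [n _ <-]; rewrite /series /= big_mkord; exact: uM.
Qed.

Section BoundedMeasurable.
Context {d} {X : measurableType d} {R : realType}.
Implicit Types (h f g : X -> R) (T : X -> X).

Definition bounded_measurable h :=
  measurable_fun setT h /\ exists B : R, forall x, `|h x| <= B.

Lemma bounded_measurable_cst (c : R) : bounded_measurable (fun=> c).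
Proof. by split; [exact: measurable_cst|exists `|c|]. Qed.

Lemma bounded_measurableD f g : bounded_measurable f -> bounded_measurable g ->
  bounded_measurable (fun x => f x + g x).
Proof.
move=> [mf [B fB]] [mg [C gC]]; split; first exact: measurable_funD.
by exists (B + C) => x; rewrite (le_trans (ler_normD _ _))// lerD.
Qed.

Lemma bounded_measurableM f g : bounded_measurable f -> bounded_measurable g ->
  bounded_measurable (fun x => f x * g x).
Proof.
move=> [mf [B fB]] [mg [C gC]]; split; first exact: measurable_funM.
by exists (B * C) => x; rewrite normrM ler_pM.
Qed.

Lemma bounded_measurableZ c f : bounded_measurable f ->
  bounded_measurable (fun x => c * f x).
Proof. by apply: bounded_measurableM; exact: bounded_measurable_cst. Qed.

Lemma bounded_measurableB f g : bounded_measurable f -> bounded_measurable g ->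
  bounded_measurable (fun x => f x - g x).
Proof.
move=> bf bg; have := bounded_measurableD bf (bounded_measurableZ (-1) bg).
by under eq_fun do rewrite mulN1r.
Qed.

Lemma bounded_measurable_norm f : bounded_measurable f ->
  bounded_measurable (fun x => `|f x|).
Proof.
move=> [mf [B fB]]; split; first exact: measurableT_comp.
by exists B => x; rewrite normr_id.
Qed.

Lemma bounded_measurable_sum (I : Type) (r : seq I) (P : pred I)
    (F : I -> X -> R) : (forall i, P i -> bounded_measurable (F i)) ->
  bounded_measurable (fun x => \sum_(i <- r | P i) F i x).
Proof.
move=> bF; elim: r => [|i r IH].
  by under eq_fun do rewrite big_nil; exact: bounded_measurable_cst.
under eq_fun do rewrite big_cons.
by have [Pi|//] := boolP (P i); apply: bounded_measurableD => //; exact: bF.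
Qed.

Lemma bounded_measurable_comp f T : measurable_fun setT T ->
  bounded_measurable f -> bounded_measurable (fun x => f (T x)).
Proof.
move=> mT [mf [B fB]]; split; first exact: (measurableT_comp mf mT).
by exists B => x; exact: fB.
Qed.

Lemma bounded_measurable_indic (A : set X) : measurable A ->
  bounded_measurable (\1_A : X -> R).
Proof.
move=> mA; split; first exact: measurable_indic.
by exists 1 => x; rewrite indicE normr_nat lern1 leq_b1.
Qed.

End BoundedMeasurable.

Section Mean.
Context {d} {X : measurableType d} {R : realType} (mu : probability X R).
Implicit Types (h f g : X -> R) (T : X -> X).

Definition mean h : R := \int[mu]_x h x.

Lemma bounded_measurable_integrable h : bounded_measurable h ->
  mu.-integrable setT (EFin \o h).
Proof.
move=> [mh [B hB]]; apply: measurable_bounded_integrable => //.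
  by rewrite (@le_lt_trans _ _ 1%E) ?probability_le1 ?ltry.
exists B; split; first exact: num_real.
by move=> M BM x _ /=; rewrite (le_trans (hB x))// ltW.
Qed.
Hint Resolve bounded_measurable_integrable : core.

Lemma mean_cst (c : R) : mean (fun=> c) = c.
Proof. by rewrite /mean Rintegral_cst// [X in fine X]probability_setT mulr1. Qed.

Lemma meanD f g : bounded_measurable f -> bounded_measurable g ->
  mean (fun x => f x + g x) = mean f + mean g.
Proof. by move=> bf bg; rewrite /mean RintegralD//; auto. Qed.

Lemma meanB f g : bounded_measurable f -> bounded_measurable g ->
  mean (fun x => f x - g x) = mean f - mean g.
Proof. by move=> bf bg; rewrite /mean RintegralB//; auto. Qed.

Lemma meanZ c f : bounded_measurable f ->
  mean (fun x => c * f x) = c * mean f.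
Proof. by move=> bf; rewrite /mean RintegralZl//; auto. Qed.

Lemma mean_sum (I : Type) (r : seq I) (P : pred I) (F : I -> X -> R) :
  (forall i, P i -> bounded_measurable (F i)) ->
  mean (fun x => \sum_(i <- r | P i) F i x) = \sum_(i <- r | P i) mean (F i).
Proof.
move=> bF; elim: r => [|i r IH].
  by rewrite big_nil -[RHS](mean_cst 0); congr mean; apply/funext => x;
    rewrite big_nil.
rewrite big_cons; under eq_fun do rewrite big_cons.
have [Pi|//] := boolP (P i); rewrite -IH meanD//; first exact: bF.
exact: bounded_measurable_sum.
Qed.

Lemma mean_le f g : bounded_measurable f -> bounded_measurable g ->
  (forall x, f x <= g x) -> mean f <= mean g.
Proof. by move=> bf bg fg; apply: le_Rintegral => //; auto. Qed.

Lemma mean_ge0 f : (forall x, 0 <= f x) -> 0 <= mean f.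
Proof. by move=> f0; apply: Rintegral_ge0. Qed.

Lemma normr_mean_le f (B : R) : bounded_measurable f -> (forall x, `|f x| <= B) ->
  `|mean f| <= B.
Proof.
move=> bf fB; apply: le_trans (le_normr_Rintegral _ _) _ => //; first by auto.
rewrite -[leRHS](mean_cst B); apply: mean_le => //.
  exact: bounded_measurable_norm.
exact: bounded_measurable_cst.
Qed.

Lemma EFin_mean f : bounded_measurable f ->
  (mean f)%:E = (\int[mu]_x (f x)%:E)%E.
Proof.
by move=> bf; rewrite /mean /Rintegral fineK//; apply: integrable_fin_num => //;
  exact: bounded_measurable_integrable.
Qed.

Lemma mean_comp f T : measure_preserving mu T -> bounded_measurable f ->
  mean (fun x => f (T x)) = mean f.
Proof.
move=> [mT pT] bf; rewrite /mean /Rintegral; congr fine.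
rewrite [RHS](@eq_measure_integral _ _ _ _ (pushforward mu T)); last first.
  by move=> A mA _; exact/esym/pT.
rewrite integral_pushforward//.
  by apply/measurable_EFinP; case: bf.
have := bounded_measurable_integrable (bounded_measurable_comp mT bf).
by rewrite preimage_setT.
Qed.

Lemma mean_cvg (h_ : nat -> X -> R) h (B : R) : (forall n, bounded_measurable (h_ n)) ->
  bounded_measurable h -> (forall n x, `|h_ n x| <= B) ->
  {ae mu, forall x, h_ ^~ x @ \oo --> h x} ->
  (fun n => mean (h_ n)) @ \oo --> mean h.
Proof.
move=> bh_ bh hB cvh.
have m_ n : measurable_fun setT (EFin \o h_ n).
  by apply/measurable_EFinP; case: (bh_ n).
have m : measurable_fun setT (EFin \o h) by apply/measurable_EFinP; case: bh.
have cv : {ae mu, forall x, setT x -> (EFin \o h_ n) x @[n --> \oo] --> (EFin \o h) x}.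
  by move: cvh; apply: filterS => x cx _; apply/cvg_EFin => //; exact: nearW.
have dom : {ae mu, forall x n, setT x -> (`|(EFin \o h_ n) x| <= (cst B%:E) x)%E}.
  by apply: aeW => x n _; rewrite /= lee_fin.
have iB := bounded_measurable_integrable (bounded_measurable_cst B).
have [_ _] := dominated_convergence measurableT m_ m cv iB dom.
rewrite /= -EFin_mean// => /fine_cvg /=.
by under eq_fun do rewrite -EFin_mean//.
Qed.

Lemma iter_measure_preserving T n : measure_preserving mu T ->
  measure_preserving mu (iter n T).
Proof.
move=> [mT pT]; elim: n => [|n [mTn pTn]].
  by split => //; exact: measurable_id.
split; first exact: (measurableT_comp mT mTn).
move=> A mA; have mTA : measurable (T @^-1` A).
  by rewrite -[_ @^-1` _]setTI; exact: mT.
exact: etrans (pTn _ mTA) (pT _ mA).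
Qed.

Lemma ae_comp T (P : X -> Prop) : measure_preserving mu T ->
  {ae mu, forall x, P x} -> {ae mu, forall x, P (T x)}.
Proof.
move=> [mT pT] [N [mN N0 PN]]; exists (T @^-1` N); split.
- by rewrite -[_ @^-1` _]setTI; exact: mT.
- by have := pT N mN; rewrite N0.
- by move=> x /= Px; apply: PN.
Qed.

Lemma ae_iter T (P : X -> Prop) : measure_preserving mu T ->
  {ae mu, forall x, P x} -> {ae mu, forall x n, P (iter n T x)}.
Proof.
move=> mT aP; apply: ae_foralln => n.
by apply: ae_comp => //; exact: iter_measure_preserving.
Qed.

End Mean.

(** * The pathwise L2 bound *)

(** [hits w 0 k] is [s_k]. General windows appear because van der Corput only sees differences
    [s_(k+m) - s_k], which depend on the bits of the window alone. *)
Definition hits (w : nat -> bool) (k m : nat) : nat := \sum_(k <= i < k + m) w i.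

Lemma hitsD w k m n : hits w k (m + n) = (hits w k m + hits w (k + m) n)%N.
Proof. by rewrite /hits addnA (@big_cat_nat _ _ _ (k + m)) ?leq_addr. Qed.

Lemma hits_le w k m : (hits w k m <= m)%N.
Proof.
rewrite /hits -{2}[m](@addnK k) addnC -[leqRHS]muln1 -sum_nat_const_nat.
by apply: leq_sum => i _; exact: leq_b1.
Qed.

Lemma eq_hits w w' k m : (forall i, (k <= i < k + m)%N -> w i = w' i) ->
  hits w k m = hits w' k m.
Proof. by move=> ww'; apply: eq_big_nat => i /ww' ->. Qed.

Section Correlations.
Context {R : realFieldType}.
Implicit Types (y : nat -> R) (w : nat -> bool).

(** What the first step leaves at shift [m] once the number [r] of hits in the window is prescribed;
    [pair_correlation] is the same operation applied to these weights, with shift [d] and [e] hits,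
    and summed over [k]. *)
Definition pair_weight y w M m r k : R :=
  if ((k + m) %/ M == k %/ M)%N && (hits w k m == r) then y k * y (k + m)%N else 0.

Definition pair_correlation (c : nat -> R) w N D d e : R :=
  \sum_(k < N | ((k + d) %/ D == k %/ D)%N && (hits w k d == e))
    c k * c (k + d)%N.

Definition inner_bound (c : nat -> R) w D L2 (th : R) : R :=
  L2%:R * (\sum_(k < L2 * D) c k ^+ 2 + \sum_(1 <= d < D) \sum_(e < D)
     (th + th^-1 * pair_correlation c w (L2 * D) D d e ^+ 2)).

Definition outer_bound y w M L1 D L2 (eta th : R) : R :=
  L1%:R * (\sum_(k < L1 * M) y k ^+ 2 + \sum_(1 <= m < M) \sum_(r < M)
     (eta + eta^-1 * inner_bound (pair_weight y w M m r) w D L2 th)).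

End Correlations.

Lemma sqrM_le {R : realFieldType} (a b : R) : `|b| <= 1 -> (a * b) ^+ 2 <= a ^+ 2.
Proof.
by move=> b1; rewrite exprMn ler_piMr ?sqr_ge0// -real_normK ?num_real// expr_le1.
Qed.

(** AM-GM with a free weight. Trading [b] for [b ^+ 2] lets the bound be averaged over the bits
    without square roots; the weights are chosen in [normalized_bound]. *)
Lemma mul2_le_weighted {R : realFieldType} (th a b : R) : 0 < th -> `|a| <= 1 ->
  2 * (a * b) <= th + th^-1 * b ^+ 2.
Proof.
move=> th0; rewrite ler_norml => /andP[a1 a2].
have -> : th + th^-1 * b ^+ 2 = th^-1 * (th ^+ 2 + b ^+ 2).
  by field; rewrite gt_eqF.
rewrite mulrC -ler_pdivrMl ?invr_gt0// invrK.
have : 0 <= (th - a * b) ^+ 2 by exact: sqr_ge0.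
have : (a * b) ^+ 2 <= b ^+ 2 by rewrite mulrC sqrM_le// ler_norml a1.
by lra.
Qed.

Lemma mean_block_van_der_corput {d} {X : measurableType d} {R : realType}
    (mu : probability X R) (v : nat -> X -> R) L M : (0 < M)%N ->
  (forall k, bounded_measurable (v k)) ->
  mean mu (fun x => (\sum_(k < L * M) v k x) ^+ 2) <=
  L%:R * (\sum_(k < L * M) mean mu (fun x => v k x ^+ 2) +
   2 * \sum_(1 <= m < M) \sum_(k < L * M | ((k + m) %/ M == k %/ M)%N)
         mean mu (fun x => v k x * v (k + m)%N x)).
Proof.
move=> M0 bv.
have bvv k l : bounded_measurable (fun x => v k x * v l x).
  exact: bounded_measurableM.
have bv2 k : bounded_measurable (fun x => v k x ^+ 2).
  by under eq_fun do rewrite expr2.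
have bsum : bounded_measurable (fun x => \sum_(k < L * M) v k x ^+ 2).
  exact: bounded_measurable_sum.
have bsum2 : bounded_measurable (fun x => \sum_(1 <= m < M)
    \sum_(k < L * M | ((k + m) %/ M == k %/ M)%N) v k x * v (k + m)%N x).
  by apply: bounded_measurable_sum => m _; exact: bounded_measurable_sum.
rewrite -mean_sum//.
under eq_bigr do rewrite -mean_sum//.
rewrite -mean_sum; last by move=> m _; exact: bounded_measurable_sum.
rewrite -meanZ// -meanD//; last exact: bounded_measurableZ.
rewrite -meanZ; last by apply: bounded_measurableD => //; exact: bounded_measurableZ.
apply: mean_le.
- under eq_fun do rewrite expr2.
  by apply: bounded_measurableM; exact: bounded_measurable_sum.
- apply: bounded_measurableZ; apply: bounded_measurableD => //.
  exact: bounded_measurableZ.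
- by move=> x; exact: (block_van_der_corput (fun k => v k x)).
Qed.

Section L2Bound.
Context {d} {X : measurableType d} {R : realType} (mu : probability X R).
Variables (T S : X -> X).
Hypotheses (mpT : measure_preserving mu T) (mpS : measure_preserving mu S).
Hypothesis TS : forall x, T (S x) = S (T x).

Let iterTS p k x : iter p T (iter k S x) = iter k S (iter p T x).
Proof.
elim: k => [//|k IH] /=; rewrite -IH.
by elim: p {IH} => [//|p /= ->].
Qed.

Let bm_iter (U : X -> X) (h : X -> R) n : measure_preserving mu U ->
  bounded_measurable h -> bounded_measurable (fun x => h (iter n U x)).
Proof.
by move=> mpU bh; apply: bounded_measurable_comp bh; case: (iter_measure_preserving n mpU).
Qed.

Lemma bounded_measurable_iter2 (h : X -> R) p k : bounded_measurable h ->
  bounded_measurable (fun x => h (iter p T (iter k S x))).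
Proof. by move=> bh; exact: (bm_iter k mpS (bm_iter p mpT bh)). Qed.

Lemma mean_iter2 (h : X -> R) p k : bounded_measurable h ->
  mean mu (fun x => h (iter p T (iter k S x))) = mean mu h.
Proof.
move=> bh; rewrite (mean_comp (iter_measure_preserving k mpS) (bm_iter p mpT bh)).
exact: mean_comp (iter_measure_preserving p mpT) bh.
Qed.

(* Composing with [T^(L - s_k)] instead of [T^(- s_k)] avoids inverting [T]. *)
Lemma inner_bound_mean (G : X -> R) (c : nat -> R) w D L2 (th : R) L :
  bounded_measurable G -> (forall x, `|G x| <= 1) ->
  (0 < D)%N -> 0 < th -> (L2 * D + D <= L)%N ->
  mean mu (fun x => (\sum_(k < L2 * D)
      c k * G (iter (L - hits w 0 k) T (iter k S x))) ^+ 2) <=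
  inner_bound c w D L2 th.
Proof.
move=> bG G1 D0 th0 DL.
set v := fun k x => c k * G (iter (L - hits w 0 k) T (iter k S x)).
have bv k : bounded_measurable (v k).
  by apply: bounded_measurableZ; exact: bounded_measurable_iter2.
have bvv k l : bounded_measurable (fun x => v k x * v l x).
  exact: bounded_measurableM.
(* By invariance a correlation depends on [k] only through the number of hits in the window, so it
   is one of the numbers [Gam], of modulus at most 1. *)
pose Gam dd e := mean mu (fun x => G (iter e T x) * G (iter dd S x)).
have bGG e dd : bounded_measurable (fun x => G (iter e T x) * G (iter dd S x)).
  by apply: bounded_measurableM; exact: bm_iter.
have Gam1 dd e : `|Gam dd e| <= 1.
  by apply: normr_mean_le => // x; rewrite normrM mulr_ile1.
have mvv (k : 'I_(L2 * D)) dd : (dd < D)%N ->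
    mean mu (fun x => v k x * v (k + dd)%N x) =
    c k * c (k + dd)%N * Gam dd (hits w 0 (k + dd) - hits w 0 k)%N.
  move=> ddD; rewrite hitsD add0n addKn.
  rewrite /Gam -(@mean_iter2 (fun x => G (iter (hits w k dd) T x) * G (iter dd S x))
    (L - hits w 0 (k + dd)) k)// -meanZ; last first.
    exact: (@bounded_measurable_iter2
      (fun x => G (iter (hits w k dd) T x) * G (iter dd S x))).
  congr mean; apply/funext => x; rewrite /v.
  rewrite -iterD.
  (* [hits w 0 (k + dd) <= k + dd < L], so the truncated subtractions are exact. *)
  have -> : (hits w k dd + (L - hits w 0 (k + dd)) = L - hits w 0 k)%N.
    have := hits_le w 0 (k + dd); have := ltn_ord k.
    by rewrite hitsD add0n; lia.
  rewrite -[iter dd S (iter _ T _)]iterTS -(iterD dd k S) (addnC dd k).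
  by ring.
apply: (@le_trans _ _ (L2%:R * (\sum_(k < L2 * D) mean mu (fun x => v k x ^+ 2) +
   2 * \sum_(1 <= m < D) \sum_(k < L2 * D | ((k + m) %/ D == k %/ D)%N)
         mean mu (fun x => v k x * v (k + m)%N x)))).
  exact: mean_block_van_der_corput.
rewrite /inner_bound ler_wpM2l//; apply: lerD.
  apply: ler_sum => k _; rewrite -[leRHS](mean_cst mu).
  apply: mean_le.
  - by under eq_fun do rewrite expr2; exact: bounded_measurableM.
  - exact: bounded_measurable_cst.
  - by move=> x; exact: sqrM_le.
rewrite mulr_sumr !big_nat; apply: ler_sum => m /andP[m1 mD].
have -> : \sum_(k < L2 * D | ((k + m) %/ D == k %/ D)%N)
    mean mu (fun x => v k x * v (k + m)%N x) =
  \sum_(e < D) Gam m e * pair_correlation c w (L2 * D) D m e.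
  under [RHS]eq_bigr do rewrite /pair_correlation big_mkcondr /= mulr_sumr.
  rewrite exchange_big /=; apply: eq_bigr => k _.
  rewrite mvv// hitsD add0n addKn.
  (* Each [k] falls under exactly one [e], and [hits w k m <= m < D]. *)
  have hD : (hits w k m < D)%N by rewrite (leq_ltn_trans (hits_le _ _ _)).
  rewrite (bigD1 (Ordinal hD))//= eqxx big1 ?addr0; first by rewrite mulrC.
  move=> i; rewrite -val_eqE /= eq_sym => /negbTE ->; exact: mulr0.
rewrite mulr_sumr; apply: ler_sum => e _.
exact: mul2_le_weighted.
Qed.


(** Invariance under [T^(L - s_k)] turns [F r (T^(s_k) x)] into [F r (T^L x)], which does not depend
    on [k]. For fixed [m] and [r] it leaves the sum over [k]; the other factor [Psi m r] no longer
    contains [f] and is estimated by [inner_bound_mean]. *)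
Lemma outer_bound_mean (f g : X -> R) (y : nat -> R) w M L1 D L2 (eta th : R) :
  bounded_measurable f -> (forall x, `|f x| <= 1) ->
  bounded_measurable g -> (forall x, `|g x| <= 1) ->
  (0 < M)%N -> (0 < D)%N -> 0 < eta -> 0 < th -> (L1 * M = L2 * D)%N ->
  mean mu (fun x => (\sum_(k < L1 * M)
      y k * (f (iter (hits w 0 k) T x) * g (iter k S x))) ^+ 2) <=
  outer_bound y w M L1 D L2 eta th.
Proof.
move=> bf f1 bg g1 M0 D0 eta0 th0 NE.
set v := fun k x => y k * (f (iter (hits w 0 k) T x) * g (iter k S x)).
have bv k : bounded_measurable (v k).
  by apply: bounded_measurableZ; apply: bounded_measurableM; exact: bm_iter.
have bvv k l : bounded_measurable (fun x => v k x * v l x).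
  exact: bounded_measurableM.
pose F r x := f x * f (iter r T x).
pose G m x := g x * g (iter m S x).
have bF r : bounded_measurable (F r) by apply: bounded_measurableM => //; exact: bm_iter.
have bG r : bounded_measurable (G r) by apply: bounded_measurableM => //; exact: bm_iter.
have F1 r x : `|F r x| <= 1 by rewrite normrM mulr_ile1.
have G1 r x : `|G r x| <= 1 by rewrite normrM mulr_ile1.
pose L := (L2 * D + D)%N.
have sL k : (k < L1 * M)%N -> (hits w 0 k <= L)%N.
  by move=> kN; apply: leq_trans (hits_le _ _ _) _; rewrite /L -NE; lia.
pose Psi m r x := \sum_(k < L1 * M)
  pair_weight y w M m r k * G m (iter (L - hits w 0 k) T (iter k S x)).
have bPsi m r : bounded_measurable (Psi m r).
  apply: bounded_measurable_sum => k _; apply: bounded_measurableZ.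
  exact: bounded_measurable_iter2.
have mPsi m r : mean mu (fun x => Psi m r x ^+ 2) <=
    inner_bound (pair_weight y w M m r) w D L2 th.
  by rewrite /Psi NE; apply: inner_bound_mean.
have mvv (k : 'I_(L1 * M)) m : mean mu (fun x => v k x * v (k + m)%N x) =
    y k * y (k + m)%N * mean mu (fun x => F (hits w k m) (iter L T x) *
      G m (iter (L - hits w 0 k) T (iter k S x))).
  have b1 : bounded_measurable (fun x => F (hits w k m) (iter (hits w 0 k) T x) *
      G m (iter k S x)).
    by apply: bounded_measurableM; exact: bm_iter.
  rewrite [X in _ * X](_ : _ = mean mu (fun x => F (hits w k m) (iter (hits w 0 k) T x) *
      G m (iter k S x))); last first.
    rewrite -[RHS](mean_comp (iter_measure_preserving (L - hits w 0 k) mpT))//.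
    congr mean; apply/funext => x; rewrite -iterD subnKC ?sL//.
    by rewrite iterTS.
  rewrite -meanZ//; congr mean; apply/funext => x; rewrite /v /F /G.
  by rewrite hitsD add0n [in iter (_ + _) _ _]addnC iterD [in iter (k + m) _ _]addnC iterD; ring.
apply: (@le_trans _ _ (L1%:R * (\sum_(k < L1 * M) mean mu (fun x => v k x ^+ 2) +
   2 * \sum_(1 <= m < M) \sum_(k < L1 * M | ((k + m) %/ M == k %/ M)%N)
         mean mu (fun x => v k x * v (k + m)%N x)))).
  exact: mean_block_van_der_corput.
rewrite /outer_bound ler_wpM2l//; apply: lerD.
  apply: ler_sum => k _; rewrite -[leRHS](mean_cst mu).
  apply: mean_le.
  - by under eq_fun do rewrite expr2; exact: bounded_measurableM.
  - exact: bounded_measurable_cst.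
  - by move=> x; apply: sqrM_le; rewrite normrM mulr_ile1.
rewrite mulr_sumr !big_nat; apply: ler_sum => m /andP[m1 mM].
have -> : \sum_(k < L1 * M | ((k + m) %/ M == k %/ M)%N)
    mean mu (fun x => v k x * v (k + m)%N x) =
  \sum_(r < M) mean mu (fun x => F r (iter L T x) * Psi m r x).
  under [RHS]eq_bigr => r _.
    under eq_fun do rewrite /Psi mulr_sumr.
    rewrite mean_sum; last first.
      move=> k _; apply: bounded_measurableM; first exact: bm_iter.
      by apply: bounded_measurableZ; exact: bounded_measurable_iter2.
    over.
  rewrite exchange_big /= big_mkcond /=; apply: eq_bigr => k _.
  have hM : (hits w k m < M)%N by rewrite (leq_ltn_trans (hits_le _ _ _)).
  have aux (r : 'I_M) (a : R) : mean mu (fun x => F r (iter L T x) *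
      (a * G m (iter (L - hits w 0 k) T (iter k S x)))) =
      a * mean mu (fun x => F r (iter L T x) *
      G m (iter (L - hits w 0 k) T (iter k S x))).
    rewrite -meanZ; last first.
      by apply: bounded_measurableM; [exact: bm_iter|exact: bounded_measurable_iter2].
    by congr mean; apply/funext => x; ring.
  under eq_bigr do rewrite aux /pair_weight.
  rewrite (bigD1 (Ordinal hM))//= eqxx andbT big1 ?addr0.
    by case: ifPn => [_|]; rewrite ?mul0r// mvv.
  by move=> i; rewrite -val_eqE /= eq_sym => /negbTE ->; rewrite andbF mul0r.
rewrite mulr_sumr; apply: ler_sum => r _.
apply: (@le_trans _ _ (eta + eta^-1 * mean mu (fun x => Psi m r x ^+ 2))); last first.
  by rewrite lerD2l ler_wpM2l// invr_ge0 ltW.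
have bP2 : bounded_measurable (fun x => Psi m r x ^+ 2).
  by under eq_fun do rewrite expr2; exact: bounded_measurableM.
have bFP : bounded_measurable (fun x => F r (iter L T x) * Psi m r x).
  by apply: bounded_measurableM => //; exact: bm_iter.
rewrite -[X in X + _](mean_cst mu) -!meanZ// -meanD//; last first.
- exact: bounded_measurableZ.
- exact: bounded_measurable_cst.
apply: mean_le.
- exact: bounded_measurableZ.
- by apply: bounded_measurableD; [exact: bounded_measurable_cst|exact: bounded_measurableZ].
by move=> x; apply: mul2_le_weighted; rewrite ?F1.
Qed.

End L2Bound.

(** * Expectation of the bound over independent bits *)

Lemma sum_delta_le {R : realFieldType} n (P : 'I_n -> bool) (h : nat) (a : R) :
  0 <= a -> (forall i, P i -> h = i) -> \sum_(i < n) (if P i then a else 0) <= a.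
Proof.
move=> a0 Ph; have [hn|hn] := ltnP h n.
  rewrite (bigD1 (Ordinal hn))//= big1 ?addr0; first by case: ifP.
  by move=> i /eqP iN; case: ifP => // /Ph hi; case: iN; apply/val_inj.
rewrite big1// => i _; case: ifP => // /Ph hi.
by have := ltn_ord i; rewrite -hi ltnNge hn.
Qed.

Section OuterBoundSplit.
Context {R : realFieldType}.
Implicit Types (y : nat -> R) (w : nat -> bool).

Definition correlation_energy y w M N D : R :=
  \sum_(1 <= m < M) \sum_(r < M) \sum_(1 <= d < D) \sum_(e < D)
    pair_correlation (pair_weight y w M m r) w N D d e ^+ 2.

Lemma pair_weight_sqr_le y w M m r k : (forall i, `|y i| <= 1) ->
  pair_weight y w M m r k ^+ 2 <= (if hits w k m == r then y k ^+ 2 else 0).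
Proof.
move=> y1; rewrite /pair_weight; case: (hits w k m == r); rewrite ?andbF ?expr0n//.
by rewrite andbT; case: ifP => _; [exact: sqrM_le|rewrite expr0n sqr_ge0].
Qed.

(** Only [correlation_energy] needs cancellation. In the diagonal terms the sum over [r] is free,
    since for each [k] just [r = hits w k m] contributes. The factors [M ^+ 2] and [D ^+ 2] count
    the pairs [(m, r)] and [(d, e)]. *)
Lemma outer_bound_le y w M L1 D L2 (eta th : R) : (forall i, `|y i| <= 1) ->
  0 < eta -> 0 < th -> (L1 * M = L2 * D)%N ->
  outer_bound y w M L1 D L2 eta th <=
  L1%:R * (\sum_(k < L1 * M) y k ^+ 2 + M%:R ^+ 2 * eta + eta^-1 * (L2%:R *
    (M%:R * \sum_(k < L1 * M) y k ^+ 2 + M%:R ^+ 2 * D%:R ^+ 2 * th +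
     th^-1 * correlation_energy y w M (L1 * M) D))).
Proof.
move=> y1 eta0 th0 NE; rewrite /outer_bound ler_wpM2l// -addrA lerD2l.
have sum_le (a : R) n : 0 <= a -> \sum_(1 <= m < n) \sum_(r < n) a <= n%:R ^+ 2 * a.
  move=> a0; rewrite sumr_const_nat sumr_const card_ord -mulrnA -[leLHS]mulr_natl.
  apply: ler_wpM2r => //; rewrite -natrX ler_nat; nia.
under eq_bigr do rewrite big_split /= -mulr_sumr.
rewrite big_split /= -mulr_sumr lerD ?sum_le ?(ltW eta0)//.
rewrite ler_pM2l ?invr_gt0// /inner_bound.
under [leLHS]eq_bigr do rewrite -mulr_sumr.
rewrite -mulr_sumr ler_wpM2l//.
under [leLHS]eq_bigr do rewrite big_split /=.
rewrite big_split /= -!addrA lerD//.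
  apply: (@le_trans _ _ (\sum_(1 <= m < M) \sum_(k < L1 * M) y k ^+ 2)).
    apply: ler_sum => m _; rewrite NE exchange_big /=.
    apply: ler_sum => k _.
    apply: (@le_trans _ _ (\sum_(i < M) (if hits w k m == i then y k ^+ 2 else 0))).
      by apply: ler_sum => i _; exact: pair_weight_sqr_le.
    by apply: (@sum_delta_le _ _ _ (hits w k m)); rewrite ?sqr_ge0// => i /eqP.
  rewrite sumr_const_nat -[leLHS]mulr_natl; apply: ler_wpM2r; rewrite ?ler_nat ?leq_subr//.
  by apply: sumr_ge0 => k _; exact: sqr_ge0.
under [leLHS]eq_bigr => m _.
  under eq_bigr => r _.
    under eq_bigr => d _ do rewrite big_split /= -mulr_sumr.
    rewrite big_split /= -mulr_sumr; over.
  rewrite big_split /= -mulr_sumr; over.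
rewrite big_split /= -mulr_sumr lerD//; last by rewrite -NE.
rewrite -mulrA.
apply: le_trans (sum_le _ M _).
  apply: ler_sum => m _; apply: ler_sum => r _; apply: sum_le; exact: ltW.
by rewrite mulr_ge0// ?sqr_ge0// ltW.
Qed.

End OuterBoundSplit.

(** The cut-off [K] removes the initial indices, at which the hitting times and the digit bits may
    disagree. *)
Definition centered_bit {R : pzRingType} (p : nat -> R) (K : nat) (w : nat -> bool)
    k : R :=
  if (K <= k)%N then (w k)%:R - p k else 0.

Section RandomBits.
Context {R : realFieldType}.
Variables (V : nat) (bits : nat -> nat -> bool) (p : nat -> R) (H K : nat).

(** Expectation for a uniform [v]; in the application [V] is a power [2^M] and [v] is the integer
    formed by the first [M] binary digits of [y]. *)
Definition average (F : nat -> R) : R := V%:R^-1 * \sum_(v < V) F v.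

Let Y v k : R := (bits v k)%:R - p k.

(** Measurability with respect to the first [l] bits, the filtration of the martingale argument. *)
Definition adapted l (Z : nat -> R) :=
  forall v v', (forall i, (i < l)%N -> bits v i = bits v' i) -> Z v = Z v'.

Hypothesis p01 : forall k, 0 <= p k <= 1.
Hypothesis orthogonal_bits : forall l Z, (l < H)%N -> adapted l Z ->
  average (fun v => Y v l * Z v) = 0.
Hypothesis variance_bits : forall k, (k < H)%N ->
  average (fun v => Y v k ^+ 2) <= p k.

Lemma averageD F G : average (fun v => F v + G v) = average F + average G.
Proof. by rewrite /average big_split mulrDr. Qed.

Lemma averageZ c F : average (fun v => c * F v) = c * average F.
Proof. by rewrite /average -mulr_sumr mulrCA. Qed.

Lemma average_sum (I : Type) (r : seq I) (P : pred I) (F : I -> nat -> R) :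
  average (fun v => \sum_(i <- r | P i) F i v) = \sum_(i <- r | P i) average (F i).
Proof. by rewrite /average exchange_big mulr_sumr. Qed.

Lemma average_le F G : (forall v, F v <= G v) -> average F <= average G.
Proof. by move=> FG; rewrite ler_wpM2l ?invr_ge0//; apply: ler_sum. Qed.

Lemma average_cst_le (c : R) : 0 <= c -> average (fun=> c) <= c.
Proof.
move=> c0; rewrite /average sumr_const card_ord -[c *+ _]mulr_natl mulrA ler_piMl//.
by have [->|V0] := posnP V; [rewrite invr0 mul0r|rewrite mulVf// pnatr_eq0 -lt0n].
Qed.

Let normY v k : `|Y v k| <= 1.
Proof.
have := p01 k; rewrite /Y ler_norml; case: (bits v k) => /=; lra.
Qed.

Let normy v k : `|centered_bit p K (bits v) k| <= 1.
Proof. by rewrite /centered_bit; case: ifP => _; [exact: normY | rewrite normr0]. Qed.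

(** The centred bits are martingale differences: a cross term is [Y v (n + q)] times a quantity
    determined by earlier bits, so its average is 0. *)
Lemma average_sqr_martingale q (Z : nat -> nat -> R) n : (n + q <= H)%N ->
  (forall k, adapted (k + q) (Z k)) ->
  average (fun v => (\sum_(k < n) Y v (k + q) * Z k v) ^+ 2) =
  \sum_(k < n) average (fun v => (Y v (k + q) * Z k v) ^+ 2).
Proof.
move=> nH aZ; elim: n nH => [|n IH] nH.
  by rewrite big_ord0; under eq_fun do rewrite big_ord0 expr0n;
    rewrite /average big1 ?mulr0.
rewrite big_ord_recr /= -IH; last by rewrite (leq_trans _ nH)// leq_add2r.
have E : average (fun v => Y v (n + q) *
    (2 * Z n v * \sum_(k < n) Y v (k + q) * Z k v)) = 0.
  apply: orthogonal_bits => //.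
  move=> v v' vv'; congr (_ * _ * _); first exact: aZ.
  apply: eq_bigr => k _; have kn : (k + q < n + q)%N by rewrite ltn_add2r.
  rewrite /Y vv'//; congr (_ * _); apply: aZ => i ik; apply: vv'.
  exact: ltn_trans ik kn.
rewrite -[X in _ = X]addr0 -[X in _ = _ + X]E -!averageD; congr (average _).
apply/funext => v; rewrite big_ord_recr /=; ring.
Qed.

(** For fixed [(m, r, d, e)] the correlation is a sum of [Y v (k + (d + m)) * Z k v] where [Z k] is
    determined by earlier bits, as [m] and [d] are positive; orthogonality leaves the diagonal.
    There each [k] meets at most one pair [(r, e)], so each [(m, d)] contributes at most the sum of
    the variances, and there are at most [M * D] such pairs. *)
Lemma average_correlation_energy_le M D N : (N + M + D <= H)%N ->
  average (fun v => correlation_energy (centered_bit p K (bits v)) (bits v) M N D) <=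
  M%:R * D%:R * \sum_(k < N) p k.
Proof.
move=> NH; pose c v := centered_bit p K (bits v).
have cadapt l k v v' : (forall i, (i < l)%N -> bits v i = bits v' i) ->
    (k < l)%N -> c v k = c v' k.
  by move=> vv' kl; rewrite /c /centered_bit /Y vv'.
(* The last factor is written as the uncut [Y], so its cut-off [K <= k + d + m] joins the
   conditions. *)
pose Z m d r e k v : R :=
  if [&& ((k + d) %/ D == k %/ D)%N, hits (bits v) k d == e,
     ((k + m) %/ M == k %/ M)%N, hits (bits v) k m == r,
     ((k + d + m) %/ M == (k + d) %/ M)%N, hits (bits v) (k + d) m == r &
     (K <= k + d + m)%N]
  then c v k * c v (k + m)%N * c v (k + d)%N else 0.
have ZE m d r e v : pair_correlation (pair_weight (c v) (bits v) M m r) (bits v) N D d e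
    = \sum_(k < N) Y v (k + (d + m)) * Z m d r e k v.
  rewrite /pair_correlation big_mkcond /=; apply: eq_bigr => k _.
  rewrite /Z /pair_weight addnA.
  case: (_ == _) => /=; last by rewrite mulr0.
  case: (_ == _) => /=; last by rewrite mulr0.
  case: (_ == _) => /=; last by rewrite mulr0 mul0r.
  case: (_ == _) => /=; last by rewrite mulr0 mul0r.
  case: (_ == _) => /=; last by rewrite !mulr0.
  case: (_ == _) => /=; last by rewrite !mulr0.
  rewrite [c v (k + d + m)%N]/c /centered_bit; case: ifP => _; last by rewrite !mulr0.
  by rewrite -/(Y _ _); ring.
have Zadapt m d r e k : (0 < m)%N -> (0 < d)%N -> adapted (k + (d + m)) (Z m d r e k).
  move=> m0 d0 v v' vv'; rewrite /Z.
  have hE a b : (a + b <= k + (d + m))%N -> hits (bits v) a b = hits (bits v') a b.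
    move=> ab; apply: eq_hits => i /andP[_ ib]; apply: vv'.
    exact: leq_trans ib ab.
  rewrite !hE ?(cadapt _ _ v v' vv') //; lia.
(* Three of the four factors are bounded by 1 and only [c v k] survives; the two hit counts are
   retained so that the sums over [r] and [e] collapse. *)
have Z2 m d r e k v : (Y v (k + (d + m)) * Z m d r e k v) ^+ 2 <=
    (if (hits (bits v) k m == r) && (hits (bits v) k d == e) then c v k ^+ 2 else 0).
  rewrite mulrC; apply: le_trans (sqrM_le _ (normY _ _)) _; rewrite /Z.
  case: (_ == e); rewrite ?andbF /= ?expr0n//.
  case: (_ == r); rewrite ?andbF /= ?expr0n//.
  case: ifP => _; last by rewrite expr0n sqr_ge0.
  by apply: le_trans (sqrM_le _ (normy _ _)) _; exact: sqrM_le (normy _ _).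
rewrite /correlation_energy average_sum -mulrA mulr_natl.
apply: (@le_trans _ _ (\sum_(1 <= m < M) D%:R * \sum_(k < N) p k)); last first.
  rewrite sumr_const_nat; apply: ler_wpMn2l; last exact: leq_subr.
  apply: mulr_ge0 => //; by apply: sumr_ge0 => k _; case/andP: (p01 k).
rewrite !big_nat; apply: ler_sum => m /andP[m0 mM].
under eq_fun do rewrite exchange_big /=.
rewrite average_sum mulr_natl.
apply: (@le_trans _ _ (\sum_(1 <= d < D) \sum_(k < N) p k)); last first.
  rewrite sumr_const_nat; apply: ler_wpMn2l; last exact: leq_subr.
  by apply: sumr_ge0 => k _; case/andP: (p01 k).
rewrite !big_nat; apply: ler_sum => d /andP[d0 dD].
rewrite average_sum.
under eq_bigr => r _.
  rewrite average_sum.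
  under eq_bigr => e _.
    under eq_fun do rewrite -/(c _) ZE.
    rewrite average_sqr_martingale; [|lia|by move=> k; exact: Zadapt].
    over.
  rewrite exchange_big /=; over.
rewrite exchange_big /=; apply: ler_sum => k _.
apply: (@le_trans _ _ (average (fun v => Y v k ^+ 2))); last first.
  by apply: variance_bits; have := ltn_ord k; lia.
under eq_bigr do rewrite -average_sum.
rewrite -average_sum; apply: average_le => v.
apply: (@le_trans _ _ (\sum_(r < M) \sum_(e < D)
    (if (hits (bits v) k m == r) && (hits (bits v) k d == e) then c v k ^+ 2 else 0))).
  by apply: ler_sum => r _; apply: ler_sum => e _; exact: Z2.
apply: (@le_trans _ _ (\sum_(r < M) (if hits (bits v) k m == r then c v k ^+ 2 else 0))).
  apply: ler_sum => r _; case: ifP => /= _; last by rewrite big1.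
  by apply: (@sum_delta_le _ _ _ (hits (bits v) k d)); rewrite ?sqr_ge0// => i /eqP.
apply: (@le_trans _ _ (c v k ^+ 2)).
  by apply: (@sum_delta_le _ _ _ (hits (bits v) k m)); rewrite ?sqr_ge0// => i /eqP.
by rewrite /c /centered_bit; case: ifP => // _; rewrite expr0n sqr_ge0.
Qed.

Lemma average_outer_bound_le M L1 D L2 (eta th W : R) :
  0 < eta -> 0 < th -> (L1 * M = L2 * D)%N -> (L1 * M + M + D <= H)%N ->
  \sum_(k < L1 * M) p k <= W ->
  average (fun v => outer_bound (centered_bit p K (bits v)) (bits v) M L1 D L2 eta th) <=
  L1%:R * (W + M%:R ^+ 2 * eta + eta^-1 * (L2%:R *
    (M%:R * W + M%:R ^+ 2 * D%:R ^+ 2 * th + th^-1 * (M%:R * D%:R * W)))).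
Proof.
move=> eta0 th0 NE NH pW.
pose A v := \sum_(k < L1 * M) centered_bit p K (bits v) k ^+ 2.
have AW : average A <= W.
  apply: le_trans pW; rewrite /A average_sum; apply: ler_sum => k _.
  apply: le_trans (variance_bits _); last by have := ltn_ord k; lia.
  apply: average_le => v; rewrite /centered_bit; case: ifP => // _.
  by rewrite expr0n sqr_ge0.
apply: le_trans (average_le (fun v => outer_bound_le _ (normy v) eta0 th0 NE)) _.
rewrite averageZ ler_wpM2l// averageD lerD//.
  by rewrite averageD lerD// average_cst_le// mulr_ge0// ?sqr_ge0// ltW.
rewrite averageZ ler_wpM2l ?invr_ge0 ?(ltW eta0)// averageZ ler_wpM2l//.
rewrite averageD lerD//.
  rewrite averageD lerD//; first by rewrite averageZ ler_wpM2l.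
  by rewrite average_cst_le// mulr_ge0// ?mulr_ge0 ?sqr_ge0// ltW.
rewrite averageZ ler_wpM2l ?invr_ge0 ?(ltW th0)//.
apply: le_trans (average_correlation_energy_le NH) _.
by rewrite -mulrA -mulrA !ler_wpM2l.
Qed.

End RandomBits.

(** * Binary digits *)

Section DyadicExpansion.
Context {R : realType}.

Lemma truncn_dyadic (y : R) m n : 0 <= y -> (m <= n)%N ->
  (Num.truncn (2 ^+ n * y) %/ 2 ^ (n - m))%N = Num.truncn (2 ^+ m * y).
Proof.
move=> y0 mn; set B := (2 ^ (n - m))%N.
have B0 : (0 < B)%N by rewrite expn_gt0.
have BR : 2 ^+ n * y = B%:R * (2 ^+ m * y).
  by rewrite /B natrX mulrA -exprD subnK.
have z0 : 0 <= 2 ^+ m * y by rewrite mulr_ge0// exprn_ge0.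
have Bz0 : 0 <= B%:R * (2 ^+ m * y) by rewrite mulr_ge0.
rewrite BR; apply/esym/truncn_def.
set z := _ * y in z0 Bz0 *.
have /andP[t1 t2] := truncn_itv Bz0; set t := Num.truncn _ in t1 t2 *.
have BR0 : 0 < B%:R :> R by rewrite ltr0n.
apply/andP; split.
  rewrite -(ler_pM2l BR0); apply: le_trans t1.
  by rewrite -natrM ler_nat mulnC leq_divM.
rewrite -(ltr_pM2l BR0); apply: lt_le_trans t2 _.
by rewrite -natrM ler_nat mulnC ltn_ceil.
Qed.

Lemma truncn_dyadic_lt (y : R) n : 0 <= y < 1 ->
  (Num.truncn (2 ^+ n * y) < 2 ^ n)%N.
Proof.
move=> /andP[y0 y1]; rewrite truncn_lt_nat ?mulr_ge0 ?exprn_ge0//.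
by rewrite natrX gtr_pMr ?exprn_gt0.
Qed.

Let dyadic_itv n v : set R := `[v%:R / 2 ^+ n, v.+1%:R / 2 ^+ n[.

Let truncn_dyadic_sum n (F : nat -> R) (y : R) : 0 <= y < 1 ->
  F (Num.truncn (2 ^+ n * y)) = \sum_(v < 2 ^ n) F v * \1_(dyadic_itv n v) y.
Proof.
move=> y01; rewrite (bigD1 (Ordinal (truncn_dyadic_lt n y01)))//=.
have p2 : 0 < 2 ^+ n :> R by rewrite exprn_gt0.
have /andP[y0 _] := y01.
have E v : (y \in dyadic_itv n v) = (Num.truncn (2 ^+ n * y) == v).
  rewrite truncn_eq ?mulr_ge0 ?exprn_ge0// mem_setE /= in_itv /=.
  by rewrite ler_pdivrMr// ltr_pdivlMr// mulrC.
rewrite indicE E eqxx mulr1 big1 ?addr0// => v; rewrite -val_eqE /= eq_sym.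
by rewrite indicE E => /negbTE ->; rewrite mulr0.
Qed.

Let sub_dyadic_itv n v : (v < 2 ^ n)%N -> dyadic_itv n v `<=` `[0, 1[.
Proof.
move=> vn y; rewrite /dyadic_itv /= !in_itv /= => /andP[y1 y2].
rewrite (le_trans _ y1) ?divr_ge0 ?exprn_ge0//= (lt_le_trans y2)//.
by rewrite ler_pdivrMr ?exprn_gt0// mul1r -natrX ler_nat.
Qed.

Lemma measurable_truncn_dyadic n (F : nat -> R) :
  measurable_fun (`[0%R, 1%R[ : set R) (fun y : R => F (Num.truncn (2 ^+ n * y))).
Proof.
apply: (eq_measurable_fun (fun y : R => \sum_(v < 2 ^ n) F v * \1_(dyadic_itv n v) y)).
  by move=> y; rewrite mem_setE /= in_itv /= => y01; rewrite -truncn_dyadic_sum.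
apply: measurable_sum => v; apply: measurable_funM => //.
by apply: measurable_indic; exact: measurable_itv.
Qed.

(** The integer formed by the first [n] digits is uniformly distributed, which turns integrals over
    [y] into finite averages. *)
Lemma integral_truncn_dyadic n (F : nat -> R) : (forall v, 0 <= F v) ->
  (\int[lebesgue_measure]_(y in (`[0%R, 1%R[ : set R)) (F (Num.truncn (2 ^+ n * y)))%:E)%E =
  (average (2 ^ n) F)%:E.
Proof.
move=> F0.
have mI : measurable (`[0%R, 1%R[ : set R) by exact: measurable_itv.
have mD v : measurable (dyadic_itv n v) by exact: measurable_itv.
transitivity (\int[lebesgue_measure]_(y in (`[0%R, 1%R[ : set R))
    \sum_(v < 2 ^ n) ((F v)%:E * (\1_(dyadic_itv n v) y)%:E))%E.
  apply: eq_integral => y; rewrite mem_setE /= in_itv /= => y01.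
  by rewrite truncn_dyadic_sum// -sumEFin.
rewrite ge0_integral_sum//; last 2 first.
- move=> v; apply/measurable_EFinP; apply: measurable_funM => //.
  apply: measurable_indic; exact: mD.
- by move=> v y _; rewrite -EFinM lee_fin mulr_ge0.
rewrite /average mulr_sumr -sumEFin; apply: eq_bigr => v _.
rewrite ge0_integralZl_EFin//; last first.
  by apply/measurable_EFinP; apply: measurable_indic; exact: mD.
rewrite integral_indic; [|exact: mI|exact: mD].
rewrite setIidl; last exact: sub_dyadic_itv.
rewrite [X in (_ * X)%E](lebesgue_measure_itv `[v%:R / 2 ^+ n, v.+1%:R / 2 ^+ n[) /= lte_fin.
rewrite ltr_pM2r ?invr_gt0 ?exprn_gt0// ltr_nat ltnSn.
rewrite -EFinB -EFinM; congr (_%:E).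
by rewrite -mulrBl -natrB ?subSnn// mul1r natrX mulrC.
Qed.

End DyadicExpansion.

Section DigitBlocks.
Context {R : realType}.
Variables (m q : nat -> nat) (M H : nat).
Hypothesis m_nd : {homo m : i j / (i <= j)%N}.
Hypothesis q_le : forall k, (q k <= 2 ^ (m k.+1 - m k))%N.
Hypothesis mH : (m H <= M)%N.

(** Places are counted from the most significant digit of the [M]-digit integer [v]: block [k]
    starts at place [m k] and ends before [m k.+1]. *)
Definition block_digit v k := ((v %/ 2 ^ (M - m k.+1)) %% 2 ^ (m k.+1 - m k))%N.

Definition block_bit v k := (block_digit v k < q k)%N.

Definition block_prob k : R := (q k)%:R / (2 ^ (m k.+1 - m k))%:R.

Lemma block_prob01 k : 0 <= block_prob k <= 1.
Proof.
rewrite divr_ge0//= ler_pdivrMr ?ltr0n ?expn_gt0// mul1r ler_nat.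
exact: q_le.
Qed.

Let mS k : (m k <= m k.+1)%N. Proof. exact: m_nd. Qed.

(** In [v = (h * G + u) * B + b], [h] holds the digits before block [l], [u] the block itself and
    [b] the digits after it. *)
Lemma sum_block l (F : nat -> R) : (l < H)%N ->
  let G := (2 ^ (m l.+1 - m l))%N in let B := (2 ^ (M - m l.+1))%N in
  \sum_(v < 2 ^ M) F v =
  \sum_(h < 2 ^ m l) \sum_(u < G) \sum_(b < B) F ((h * G + u) * B + b)%N.
Proof.
move=> lH G B.
have mM : (m l.+1 <= M)%N by apply: leq_trans mH; exact: m_nd.
have E : (2 ^ M = (2 ^ m l * G) * B)%N.
  by rewrite -!expnD subnKC// subnKC.
rewrite -(big_mkord xpredT F) E big_mkord sum_blocks (sum_blocks (fun i => \sum_(b < B) F (i * B + b)%N)).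
by [].
Qed.

Lemma block_digitE l h u b : (l < H)%N ->
  let G := (2 ^ (m l.+1 - m l))%N in let B := (2 ^ (M - m l.+1))%N in
  (u < G)%N -> (b < B)%N -> block_digit ((h * G + u) * B + b) l = u.
Proof.
move=> lH G B uG bB; rewrite /block_digit -/B -/G.
rewrite divnMDl; last by rewrite expn_gt0.
by rewrite (divn_small bB) addn0 modnMDl modn_small.
Qed.

Lemma block_digit_lt l h u b i : (l < H)%N -> (i < l)%N ->
  let G := (2 ^ (m l.+1 - m l))%N in let B := (2 ^ (M - m l.+1))%N in
  (u < G)%N -> (b < B)%N ->
  block_digit ((h * G + u) * B + b) i = block_digit (h * G * B) i.
Proof.
move=> lH il G B uG bB; rewrite /block_digit.
have il1 : (m i.+1 <= m l)%N by exact: m_nd.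
have mM : (m l.+1 <= M)%N by apply: leq_trans mH; exact: m_nd.
have -> : (2 ^ (M - m i.+1) = B * (G * 2 ^ (m l - m i.+1)))%N.
  by rewrite -!expnD; congr (2 ^ _)%N; have := mS l; lia.
rewrite !divnMA.
rewrite divnMDl; last by rewrite expn_gt0.
rewrite (divn_small bB) addn0 mulnK ?expn_gt0//.
rewrite divnMDl; last by rewrite expn_gt0.
by rewrite (divn_small uG) addn0 mulnK ?expn_gt0.
Qed.

Let sum_bit l : \sum_(u < 2 ^ (m l.+1 - m l)) ((u < q l)%N%:R - block_prob l) = 0 :> R.
Proof.
rewrite sumrB sumr_const card_ord /block_prob -[X in _ - X]mulr_natr divfK ?pnatr_eq0 -?lt0n ?expn_gt0//.
rewrite -natr_sum -(big_mkord xpredT (fun u => (u < q l)%N : nat)).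
rewrite (@big_cat_nat _ _ _ (q l))//= big_nat (eq_bigr (fun=> 1%N)); last first.
  by move=> i /andP[_ ->].
rewrite -big_nat sum_nat_const_nat subn0 muln1.
rewrite big_nat big1 ?addn0 ?subrr// => i /andP[qi _].
by rewrite ltnNge qi.
Qed.

(** For fixed [h] the adapted factor [Z] is constant, being determined by the earlier blocks, while
    the centred bit sums to 0 over the values [u] of the block. *)
Lemma block_bit_orthogonal l (Z : nat -> R) : (l < H)%N -> adapted block_bit l Z ->
  average (2 ^ M) (fun v => ((block_bit v l)%:R - block_prob l) * Z v) = 0.
Proof.
move=> lH aZ; rewrite /average.
rewrite (sum_block (fun v => ((block_bit v l)%:R - block_prob l) * Z v) lH) /=.
rewrite big1 ?mulr0// => h _.
set G := (2 ^ (m l.+1 - m l))%N; set B := (2 ^ (M - m l.+1))%N.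
transitivity (\sum_(u < G) ((u < q l)%N%:R - block_prob l) * (B%:R * Z (h * G * B)%N)).
  apply: eq_bigr => u _; rewrite mulrCA mulr_natl -[X in _ *+ X]card_ord -sumr_const.
  apply: eq_bigr => b _; rewrite /block_bit block_digitE//.
  congr (_ * _); apply: aZ => i il.
  by rewrite /block_bit block_digit_lt.
by rewrite -mulr_suml sum_bit mul0r.
Qed.

Lemma block_bit_variance k : (k < H)%N ->
  average (2 ^ M) (fun v => ((block_bit v k)%:R - block_prob k) ^+ 2) <= block_prob k.
Proof.
move=> kH; set p := block_prob k; have /andP[p0 p1] := block_prob01 k.
(* A bit is its own square, so this is affine in the centred bit, whose average is 0 by
   orthogonality with [Z = 1]. *)
have -> : (fun v => ((block_bit v k)%:R - p) ^+ 2) =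
    (fun v => (1 - 2 * p) * (((block_bit v k)%:R - p) * 1) + (p - p ^+ 2)).
  by apply/funext => v; case: (block_bit v k) => /=; ring.
rewrite averageD averageZ block_bit_orthogonal// mulr0 add0r.
have pp : 0 <= p - p ^+ 2 by rewrite subr_ge0 expr2 ler_piMr.
by rewrite (le_trans (average_cst_le _ pp))// gerBl sqr_ge0.
Qed.

Lemma average_block_digit_eq k t : (k < H)%N ->
  average (2 ^ M) (fun v => (block_digit v k == t)%:R) <= (2 ^- (m k.+1 - m k) : R).
Proof.
move=> kH; rewrite /average (sum_block (fun v => (block_digit v k == t)%:R) kH) /=.
set G := (2 ^ (m k.+1 - m k))%N; set B := (2 ^ (M - m k.+1))%N.
have mM : (m k.+1 <= M)%N by apply: leq_trans mH; exact: m_nd.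
have MB : (2 ^ M = 2 ^ m k * G * B)%N by rewrite -!expnD subnKC// subnKC.
apply: (@le_trans _ _ ((2 ^ M)%:R^-1 * \sum_(h < 2 ^ m k) B%:R)).
  rewrite ler_wpM2l ?invr_ge0//; apply: ler_sum => h _.
  apply: (@le_trans _ _ (\sum_(u < G) (if (u : nat) == t then B%:R else 0))).
    apply: ler_sum => u _; under eq_bigr do rewrite block_digitE//.
    by rewrite sumr_const card_ord; case: eqP => _ //=; rewrite mul0rn.
  by apply: (@sum_delta_le _ _ _ t) => // i /eqP.
rewrite sumr_const card_ord -[B%:R *+ _]mulr_natl MB !natrM -natrX -/G.
have n0 a : (2 ^ a)%:R != 0 :> R by rewrite pnatr_eq0 -lt0n expn_gt0.
by rewrite le_eqVlt; apply/orP; left; apply/eqP; field; rewrite !n0.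
Qed.

End DigitBlocks.

(** * Densities and block lengths *)

(** Exponentials beat powers: [(g+1)^Q] is at most the falling factorial [(g + Q) ^_ Q], which is
    [Q!] times a binomial coefficient, itself at most [2^(g+Q)]. *)
Lemma expn_le_fact_exp2 Q g : (g.+1 ^ Q <= Q`! * 2 ^ (g + Q))%N.
Proof.
have bin_le n k : ('C(n, k) <= 2 ^ n)%N.
  elim: n k => [|n IH] [|k] //=; first by rewrite bin0 expn_gt0.
  by rewrite binS expnS mul2n -addnn leq_add.
have ffact_ge : (g.+1 ^ Q <= (g + Q) ^_ Q)%N.
  elim: Q => [|Q IH]; first by rewrite ffactn0 expn0.
  by rewrite addnS ffactSS expnS leq_mul// ltnS leq_addr.
by rewrite (leq_trans ffact_ge)// -bin_ffact mulnC leq_mul.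
Qed.

Lemma sum_inv_sqr_le {R : realFieldType} n :
  \sum_(k < n) (k.+1%:R ^- 2 : R) <= 2.
Proof.
case: n => [|n]; first by rewrite big_ord0.
(* Strengthened for a telescoping induction: [1 / (t + 1)^2 <= 1 / t - 1 / (t + 1)]. *)
apply: (@le_trans _ _ (2 - n.+1%:R^-1)); last by rewrite gerBl invr_ge0.
elim: n => [|n IH]; first by rewrite big_ord_recr big_ord0 /= expr1n invr1; lra.
have aux (t : R) : 0 < t -> (t + 1) ^- 2 <= t^-1 - (t + 1)^-1.
  move=> t0; rewrite -subr_ge0.
  have -> : t^-1 - (t + 1)^-1 - (t + 1) ^- 2 = t^-1 * (t + 1) ^- 2.
    by field; rewrite !gt_eqF//; lra.
  by rewrite mulr_ge0 ?invr_ge0 ?exprn_ge0//; lra.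
rewrite big_ord_recr /=; apply: le_trans (lerD IH (lexx _)) _.
have := aux n.+1%:R (ltr0Sn _ _); rewrite natr1 => h.
by rewrite -addrA lerD2l addrC lerBlDr addrC.
Qed.

Section DensityAndBlocks.
Context {R : realType}.
Variables (a c : R).
Hypotheses (a_gt0 : 0 < a) (c_gt1 : 1 < c).

(* [density 0 = 0], since [0 `^ r = 0] for [r != 0]: the index [0] never contributes. *)
Definition density (k : nat) : R := k%:R `^ (- a).
Definition position (k : nat) : nat := Num.truncn (k%:R `^ c : R).
Definition gap k := (position k.+1 - position k)%N.
Definition threshold k := Num.truncn ((2 ^ gap k)%:R * density k).

Lemma density0 : density 0 = 0.
Proof. by rewrite /density powR0// oppr_eq0 gt_eqF. Qed.

Lemma density_ge0 k : 0 <= density k.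
Proof. exact: powR_ge0. Qed.

Lemma density_gt0 k : (0 < k)%N -> 0 < density k.
Proof. by move=> k0; rewrite powR_gt0// ltr0n. Qed.

Lemma density_le j k : (0 < j)%N -> (j <= k)%N -> density k <= density j.
Proof.
move=> j0 jk; have k0 : (0 < k)%N := leq_trans j0 jk.
rewrite /density !powRN lef_pV2 ?posrE ?powR_gt0 ?ltr0n//.
by rewrite ge0_ler_powR ?nnegrE ?ler_nat// ltW.
Qed.

Lemma density_le1 k : density k <= 1.
Proof.
case: k => [|k]; first by rewrite density0.
by apply: le_trans (density_le (ltn0Sn 0) (ltn0Sn k)) _; rewrite /density powR1.
Qed.

Lemma position_homo : {homo position : i j / (i <= j)%N}.
Proof.
move=> i j ij; apply: le_truncn.
by rewrite ge0_ler_powR ?nnegrE ?ler_nat// ltW// (lt_trans ltr01).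
Qed.

(** Writing [n^c = n * n^(c-1)] gives [(k+1)^c - k^c >= k^(c-1)]; the two floors lose less than 1,
    whence [(gap k).+1]. *)
Lemma gap_ge k : (0 < k)%N -> k%:R `^ (c - 1) <= (gap k).+1%:R.
Proof.
move=> k0; have kR : 0 < k%:R :> R by rewrite ltr0n.
have step : k%:R `^ c + k%:R `^ (c - 1) <= k.+1%:R `^ c.
  have E (n : nat) : (0 < n)%N -> n%:R `^ c = n%:R * n%:R `^ (c - 1) :> R.
    move=> n0; rewrite -[X in X * _]powRr1// -powRD ?subrKC//.
    by rewrite pnatr_eq0 -lt0n n0 implybT.
  rewrite !E// -[k.+1%:R in X in _ <= X * _]natr1 mulrDl mul1r.
  have : k%:R `^ (c - 1) <= k.+1%:R `^ (c - 1) :> R.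
    by rewrite ge0_ler_powR ?nnegrE ?ler_nat// subr_ge0 ltW.
  by move=> h; rewrite lerD// ler_wpM2l.
have mono : (position k <= position k.+1)%N by exact: position_homo.
have /andP[l1 u1] := truncn_itv (powR_ge0 (k%:R : R) c).
have /andP[l2 u2] := truncn_itv (powR_ge0 (k.+1%:R : R) c).
rewrite /gap -natr1 natrB// -/(position _).
rewrite -/(position _) in l1 u1; rewrite -/(position _) in l2 u2.
rewrite -[X in _ < X]natr1 in u2; move: step l1 u2.
move: (k.+1%:R `^ c) (k%:R `^ c) (k%:R `^ (c - 1)) => u v w; lra.
Qed.

(** The gaps grow at least like a positive power of [k], so [2^-gap] lies below a multiple of
    [k^-2]. *)
Lemma sum_gap_bounded : exists C : R, forall n, \sum_(k < n) 2 ^- gap k <= C.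
Proof.
(* [Q >= 2 / (c - 1)] makes [(k^(c-1))^Q >= k^2]. *)
pose Q := (Num.truncn (2 / (c - 1))).+1.
have c1 : 0 < c - 1 by rewrite subr_gt0.
have QE : 2 <= (c - 1) * Q%:R.
  rewrite mulrC -ler_pdivrMr//; apply/ltW; exact: truncnS_gt.
pose C0 : R := (Q`! * 2 ^ Q)%:R.
have bound k : 2 ^- gap k.+1 <= C0 * k.+1%:R ^- 2.
  have k0 : 0 < k.+1%:R :> R by rewrite ltr0n.
  rewrite ler_pdivlMr ?exprn_gt0// ler_pdivrMl ?exprn_gt0//.
  apply: (@le_trans _ _ ((gap k.+1).+1 ^ Q)%:R); last first.
    rewrite -natrX -natrM ler_nat; apply: leq_trans (expn_le_fact_exp2 _ _) _.
    by rewrite expnD mulnCA mulnC.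
  rewrite natrX; apply: (@le_trans _ _ ((k.+1%:R `^ (c - 1)) ^+ Q)); last first.
    by rewrite lerXn2r ?nnegrE ?powR_ge0 ?gap_ge.
  rewrite -powR_mulrn ?powR_ge0// -powRrM -powR_mulrn//.
  by rewrite ler_powR// ler1n.
exists (1 + C0 * 2) => -[|n]; first by rewrite big_ord0 addr_ge0// mulr_ge0.
rewrite big_ord_recl /= lerD//.
  by rewrite invf_le1 ?exprn_gt0// exprn_ege1// ler1n.
apply: (@le_trans _ _ (\sum_(k < n) C0 * k.+1%:R ^- 2)).
  by apply: ler_sum => k _; exact: bound.
by rewrite -mulr_sumr ler_wpM2l// sum_inv_sqr_le.
Qed.

Lemma threshold_le k : (threshold k <= 2 ^ gap k)%N.
Proof.
rewrite -(ler_nat R); apply: (@le_trans _ _ ((2 ^ gap k)%:R * density k)).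
  by rewrite truncn_le mulr_ge0// density_ge0.
by rewrite ler_piMr// density_le1.
Qed.

Definition bit_prob : nat -> R := block_prob position threshold.

Lemma bit_prob_le k : bit_prob k <= density k.
Proof.
rewrite /bit_prob /block_prob ler_pdivrMr ?ltr0n ?expn_gt0// mulrC.
by rewrite truncn_le mulr_ge0// density_ge0.
Qed.

Lemma bit_prob_ge k : density k - bit_prob k <= 2 ^- gap k.
Proof.
rewrite lerBlDr /bit_prob /block_prob -/(gap k) -natrX -{1}[_^-1]mul1r -mulrDl.
rewrite ler_pdivlMr ?ltr0n ?expn_gt0// mulrC addrC natr1.
exact/ltW/truncnS_gt.
Qed.

Definition mass (N : nat) : R := \sum_(k < N) density k.

Lemma mass_ge N : (0 < N)%N -> N.-1%:R * density N <= mass N.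
Proof.
case: N => [//|n] _ /=; rewrite /mass big_ord_recl density0 add0r.
rewrite mulr_natl -[X in _ *+ X]card_ord -sumr_const.
apply: ler_sum => i _; apply: density_le => //=.
by rewrite /bump leq0n add1n ltnS ltnW.
Qed.

End DensityAndBlocks.

(** * Almost every y is good *)

Section Truncation.
Context {R : realFieldType}.
Variables (p : nat -> R) (K : nat).

(** The bound reads only indices below [L1 * M + M + D]. The weights vanish for [k < K], and hits
    are counted from [k] on rather than from 0, so a disagreement before [K] is invisible. *)
Lemma outer_bound_congr w w' M L1 D L2 (eta th : R) : (L1 * M = L2 * D)%N ->
  (forall k, (K <= k < L1 * M + M + D)%N -> w k = w' k) ->
  outer_bound (centered_bit p K w) w M L1 D L2 eta th =
  outer_bound (centered_bit p K w') w' M L1 D L2 eta th.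
Proof.
move=> NE ww'.
have yE k : (k < L1 * M + M + D)%N -> centered_bit p K w k = centered_bit p K w' k.
  by move=> kN; rewrite /centered_bit; case: ifP => // Kk; rewrite ww'// Kk.
have y0 k : (k < K)%N -> centered_bit p K w' k = 0.
  by rewrite /centered_bit ltnNge => /negbTE ->.
have hE k n : (K <= k)%N -> (k + n <= L1 * M + M + D)%N -> hits w k n = hits w' k n.
  move=> Kk kn; apply: eq_hits => i /andP[ki ikn]; apply: ww'.
  by rewrite (leq_trans Kk ki) (leq_trans ikn).
have wE m r k : (m <= M)%N -> (k < L1 * M + D)%N ->
    pair_weight (centered_bit p K w) w M m r k =
    pair_weight (centered_bit p K w') w' M m r k.
  move=> mM kN; rewrite /pair_weight !yE; [|lia|lia].
  have [kK|Kk] := ltnP k K; first by rewrite y0// mul0r !if_same.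
  by rewrite hE//; lia.
have w0 m r k : (k < K)%N -> pair_weight (centered_bit p K w') w' M m r k = 0.
  by move=> kK; rewrite /pair_weight y0// mul0r if_same.
rewrite /outer_bound; congr (_ * (_ + _)).
  by apply: eq_bigr => k _; rewrite yE//; have := ltn_ord k; lia.
rewrite !big_nat; apply: eq_bigr => m /andP[m1 mM]; apply: eq_bigr => r _.
congr (_ + _ * _); rewrite /inner_bound; congr (_ * (_ + _)).
  apply: eq_bigr => k _; rewrite wE//; first exact: ltnW.
  by have := ltn_ord k; lia.
rewrite !big_nat; apply: eq_bigr => d /andP[d1 dD]; apply: eq_bigr => e _.
congr (_ + _ * _ ^+ 2); rewrite /pair_correlation big_mkcond [RHS]big_mkcond /=.
apply: eq_bigr => k _; have kN := ltn_ord k.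
rewrite !wE; [|lia|lia|lia|lia].
have [kK|Kk] := ltnP k K; first by rewrite w0// mul0r !if_same.
by rewrite hE//; lia.
Qed.

End Truncation.

Section ParameterChoice.
Context {R : realType}.

(** The constants solve a system. Let [N = J^p], [W] about [J^(p - A)], [L1 = N / M], [L2 = N / D],
    and ask each of the five terms to be at most about [W^2 / J^2]. The first gives [M = J^(A+2)],
    the second [eta = J^(p-3A-4)], the third [D = J^(4A+6)], the fourth [th = J^(p-10A-14)], and the
    fifth asks [th >= J^(4A+6)]. So [p = 14A + 20] is the least exponent allowed by these choices;
    then three terms equal [u * W] and two equal [(u * J)^2]. *)
Lemma parameter_bound (J W : R) (A : nat) : 0 < J ->
  J ^+ (13 * A + 20) / 2 <= W ->
  J ^+ (13 * A + 18) * (W + J ^+ (A + 2) ^+ 2 * J ^+ (11 * A + 16) +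
    (J ^+ (11 * A + 16))^-1 * (J ^+ (10 * A + 14) *
    (J ^+ (A + 2) * W + J ^+ (A + 2) ^+ 2 * J ^+ (4 * A + 6) ^+ 2 * J ^+ (4 * A + 6) +
     (J ^+ (4 * A + 6))^-1 * (J ^+ (A + 2) * J ^+ (4 * A + 6) * W)))) <=
  14 * (W ^+ 2 * J ^- 2).
Proof.
move=> J0; set u := J ^+ (13 * A + 18).
have -> : J ^+ (13 * A + 20) = u * J ^+ 2.
  by rewrite -exprD -addnA.
set x := J ^+ A; have x0 : 0 < x by rewrite exprn_gt0.
have E n b : J ^+ (n * A + b) = x ^+ n * J ^+ b by rewrite exprD mulnC exprM.
have -> : J ^+ (A + 2) = x * J ^+ 2 by rewrite exprD.
have u0 : 0 < u by rewrite exprn_gt0.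
move=> uW.
have uE : u = x ^+ 13 * J ^+ 18 by exact: E.
have -> : u * (W + (x * J ^+ 2) ^+ 2 * J ^+ (11 * A + 16) +
    (J ^+ (11 * A + 16))^-1 * (J ^+ (10 * A + 14) *
    (x * J ^+ 2 * W + (x * J ^+ 2) ^+ 2 * J ^+ (4 * A + 6) ^+ 2 * J ^+ (4 * A + 6) +
     (J ^+ (4 * A + 6))^-1 * (x * J ^+ 2 * J ^+ (4 * A + 6) * W)))) =
  3 * u * W + 2 * (u * J) ^+ 2.
  rewrite !E uE; field; rewrite !gt_eqF//.
have -> : 14 * (W ^+ 2 * J ^- 2) =
    3 * (2 * W * J ^- 2) * W + 2 * (2 * W * J ^- 2 * J) ^+ 2.
  by field; rewrite gt_eqF.
have uW' : u <= 2 * W * J ^- 2.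
  by rewrite ler_pdivlMr ?exprn_gt0//; lra.
have W0 : 0 <= W by apply: le_trans uW; rewrite divr_ge0// mulr_ge0 ?exprn_ge0 ?ltW.
apply: lerD.
  by rewrite ler_wpM2r// ler_wpM2l.
rewrite ler_wpM2l// lerXn2r ?nnegrE ?mulr_ge0 ?(ltW u0) ?(ltW J0) ?invr_ge0 ?exprn_ge0 ?(ltW J0)//.
by rewrite ler_wpM2r// ltW.
Qed.

Variables (a : R) (A : nat).
Hypotheses (a_gt0 : 0 < a) (aA : a * (14 * A + 20)%:R <= A%:R).

(** The hypothesis [aA] says [N^a <= J^A], hence [density a N >= J^-A]; the factor 1/2 absorbs the
    [N.-1] of [mass_ge]. *)
Lemma mass_power_ge (J : nat) : (2 <= J)%N ->
  J%:R ^+ (13 * A + 20) / 2 <= mass a (J ^ (14 * A + 20)).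
Proof.
move=> J2; set p := (14 * A + 20)%N; set N := (J ^ p)%N.
have J0 : (0 < J)%N by apply: leq_trans J2.
have JR : 0 < J%:R :> R by rewrite ltr0n.
have N2 : (2 <= N)%N.
  by apply: leq_trans J2 _; rewrite -{1}[J]expn1 leq_pexp2l// /p addnS.
have N0 : (0 < N)%N by apply: leq_trans N2.
apply: le_trans (mass_ge a_gt0 N0).
have dN : (J%:R ^+ A)^-1 <= density a N.
  rewrite /density powRN lef_pV2 ?posrE ?exprn_gt0 ?powR_gt0 ?ltr0n//.
  rewrite /N natrX -!powR_mulrn ?(ltW JR)// -powRrM mulrC.
  by rewrite ler_powR ?ler1n.
apply: (@le_trans _ _ (N%:R / 2 * (J%:R ^+ A)^-1)); last first.
  apply: ler_pM; [by rewrite divr_ge0|by rewrite invr_ge0 exprn_ge0| |exact: dN].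
  rewrite -subn1 natrB//; have : 2 <= N%:R :> R by rewrite ler_nat.
  by lra.
rewrite /N natrX mulrAC ler_wpM2r// ler_pdivlMr ?exprn_gt0// -exprD.
by rewrite le_eqVlt; apply/orP; left; apply/eqP; congr (_ ^+ _); rewrite /p; lia.
Qed.

End ParameterChoice.

Section GoodParameters.
Context {R : realType}.
Variables (a c : R).
Hypotheses (a_gt0 : 0 < a) (c_gt1 : 1 < c).

(** Read off [y] itself, so that the bits do not depend on a scale; [threshold_digitE] recovers the
    same block from any sufficiently long truncation of [y]. *)
Definition threshold_digit (y : R) k : nat :=
  (Num.truncn (2 ^+ position c k.+1 * y) %% 2 ^ gap c k)%N.

Definition threshold_bit (y : R) k : bool := (threshold_digit y k < threshold a c k)%N.

Lemma threshold_digitE (y : R) k M : 0 <= y -> (position c k.+1 <= M)%N ->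
  threshold_digit y k = block_digit (position c) M (Num.truncn (2 ^+ M * y)) k.
Proof. by move=> y0 kM; rewrite /block_digit truncn_dyadic. Qed.

Lemma frac_part_dyadic (y : R) k : 0 <= y ->
  frac_part (2 ^+ position c k * y) * (2 ^ gap c k)%:R =
  2 ^+ position c k.+1 * y -
    (Num.truncn (2 ^+ position c k * y))%:R * (2 ^ gap c k)%:R.
Proof.
move=> y0; have z0 : 0 <= 2 ^+ position c k * y by rewrite mulr_ge0// exprn_ge0.
have fl : (Num.floor (2 ^+ position c k * y))%:~R =
    (Num.truncn (2 ^+ position c k * y))%:R :> R.
  by rewrite truncn_floor z0 natr_absz ger0_norm ?floor_ge0.
rewrite /frac_part fl mulrBl; congr (_ - _).
by rewrite natrX mulrAC -exprD subnKC//; exact: position_homo.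
Qed.

(** With [z] the fractional part, [G = 2 ^ gap] and [u] the digit block, [u <= z G < u + 1] while
    [threshold <= G * density < threshold + 1]. Hence [u] decides whether [z < density] unless it
    equals the threshold, and [u != 0] forces [z > 0]. *)
Lemma mem_hitting_times (y : R) k : 0 <= y -> threshold_digit y k != 0%N ->
  threshold_digit y k != threshold a c k ->
  (k \in hitting_times a c y) = threshold_bit y k.
Proof.
have aux (q' u' t' Y : R) : t' = q' + u' -> t' <= Y -> Y < t' + 1 ->
    u' <= Y - q' < u' + 1 by move=> *; lra.
move=> y0 d0 dt; case: k d0 dt => [|k] d0 dt.
  (* At [k = 0] both sides are false: 0 is not a hitting time and [density 0 = 0]. *)
  rewrite /threshold_bit /threshold density0// mulr0 truncn0 ltn0.
  by apply/negbTE/negP; rewrite inE => -[].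
set n := k.+1 in d0 dt *.
have z0 j : 0 <= 2 ^+ j * y :> R by rewrite mulr_ge0// exprn_ge0.
have mono : (position c n <= position c n.+1)%N by exact: position_homo.
have := truncn_dyadic y0 mono; rewrite -/(gap c n) => E.
have := frac_part_dyadic n y0; rewrite -E => F.
set G := (2 ^ gap c n)%N in E F; set t := Num.truncn _ in F E.
have G0 : 0 < G%:R :> R by rewrite ltr0n expn_gt0.
have /andP[t1 t2] := truncn_itv (z0 (position c n.+1)); rewrite -/t in t1 t2.
have tE : t%:R = (t %/ G)%:R * G%:R + (threshold_digit y n)%:R :> R.
  by rewrite /threshold_digit -/t -/G -natrM -natrD -divn_eq.
set u := threshold_digit y n in d0 dt tE *.
set z := frac_part _ in F.
have uz : u%:R <= z * G%:R < u.+1%:R.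
  rewrite F -[u.+1%:R]natr1; move: tE t1 t2; rewrite -[t.+1%:R]natr1.
  exact: aux.
have z_gt0 : 0 < z.
  rewrite -(pmulr_lgt0 _ G0); case/andP: uz => + _; apply: lt_le_trans.
  by rewrite ltr0n lt0n.
have thr := truncn_itv (mulr_ge0 (ler0n R G) (density_ge0 a n)).
rewrite -/(threshold a c n) in thr.
have zd : (z < density a n) = (u < threshold a c n)%N.
  move: uz thr => /andP[uz1 uz2] /andP[th1 th2].
  rewrite -(ltr_pM2r G0) [density a n * _]mulrC.
  apply/idP/idP => [zG|ut].
    have : u%:R < (threshold a c n).+1%:R :> R.
      exact: le_lt_trans uz1 (lt_trans zG th2).
    by rewrite ltr_nat ltnS leq_eqVlt (negbTE dt).
  apply: lt_le_trans uz2 _; apply: le_trans th1; by rewrite ler_nat.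
rewrite /threshold_bit -/u -zd.
apply/idP/idP; first by rewrite inE => -[_ /andP[]].
by move=> h; rewrite inE; split => //; rewrite -/z z_gt0.
Qed.

Let unit_itv : set R := `[0%R, 1%R[.

(** Borel-Cantelli: each of the two ambiguous values of block [k], 0 and the threshold, has
    probability at most [2^-gap], which is summable. *)
Lemma ae_threshold_bit : {ae lebesgue_measure, forall y : R, unit_itv y ->
  exists K, forall k, (K <= k)%N -> (k \in hitting_times a c y) = threshold_bit y k}.
Proof.
pose F k v : R := (block_digit (position c) (position c k.+1) v k == threshold a c k)%:R +
  (block_digit (position c) (position c k.+1) v k == 0)%:R.
have F0 k v : 0 <= F k v by rewrite addr_ge0.
have [C hC] := sum_gap_bounded c_gt1.
have := @ae_series_bounded _ _ R lebesgue_measure unit_itv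
  (fun k y => F k (Num.truncn (2 ^+ position c k.+1 * y))) (2 * C)
  (measurable_itv _) (fun k => measurable_truncn_dyadic _ _)
  (fun k y _ => F0 k _).
case=> [n|].
  rewrite (eq_bigr (fun k : 'I_n => (average (2 ^ position c k.+1) (F k))%:E)); last first.
    by move=> k _; exact: integral_truncn_dyadic.
  rewrite sumEFin lee_fin; apply: le_trans (ler_wpM2l _ (hC n)) => //.
  rewrite mulr_sumr; apply: ler_sum => k _.
  rewrite /F averageD mulr_natl mulr2n.
  by apply: lerD; exact: (average_block_digit_eq (position_homo c_gt1) (leqnn _) _ (ltnSn k)).
move=> N hN; exists N; move: hN => [mN N0 hN]; split => // y yN; apply: hN => /= h.
apply: yN => yI; have [M hM] := h yI.
have /andP[y0 y1] : 0 <= y < 1 by move: yI; rewrite /unit_itv /= in_itv.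
have := bounded_series_cvg0
  (fun k => F0 k (Num.truncn (2 ^+ position c k.+1 * y))) hM.
move=> /cvgrPdist_lt/(_ 1 ltr01)[K _ hK]; exists K => k Kk.
(* [F] is a sum of two indicators; once it is below 1, both vanish. *)
have := hK k Kk; rewrite /= sub0r normrN ger0_norm// /F -threshold_digitE//.
rewrite -natrD -[1]/(1%:R) ltr_nat ltnS leqn0 addn_eq0 !eqb0 => /andP[d1 d2].
exact: mem_hitting_times.
Qed.

(* With [J = j + 2] and [N = J ^ (14 A + 20)] each of the five terms of
   [average_outer_bound_le] is at most [O(mass a N ^ 2 / J ^ 2)], as soon as
   [mass a N >= J ^ (13 A + 20) / 2], i.e. [N ^ a <= J ^ A]; for large [A] this is
   possible exactly when [a < 1 / 14]. *)
Definition normalized_bound A p K (w : nat -> bool) (j : nat) : R :=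
  mass a (j.+2 ^ (14 * A + 20)) ^- 2 *
  outer_bound (centered_bit p K w) w (j.+2 ^ (A + 2)) (j.+2 ^ (13 * A + 18))
    (j.+2 ^ (4 * A + 6)) (j.+2 ^ (10 * A + 14))
    (j.+2%:R ^+ (11 * A + 16)) (j.+2%:R ^+ (4 * A + 6)).

End GoodParameters.

Lemma outer_bound_ge0 {R : realFieldType} (y : nat -> R) w M L1 D L2 (eta th : R) :
  0 <= eta -> 0 <= th -> 0 <= outer_bound y w M L1 D L2 eta th.
Proof.
move=> eta0 th0; apply: mulr_ge0 => //; apply: addr_ge0.
  by apply: sumr_ge0 => k _; exact: sqr_ge0.
apply: sumr_ge0 => m _; apply: sumr_ge0 => r _.
apply: addr_ge0 => //; apply: mulr_ge0; rewrite ?invr_ge0//.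
apply: mulr_ge0 => //; apply: addr_ge0.
  by apply: sumr_ge0 => k _; exact: sqr_ge0.
apply: sumr_ge0 => d _; apply: sumr_ge0 => e _.
by rewrite addr_ge0// mulr_ge0 ?invr_ge0 ?sqr_ge0.
Qed.

Section Good.
Context {R : realType}.
Variables (a c : R).
Hypotheses (a_gt0 : 0 < a) (c_gt1 : 1 < c).

(** The whole condition on [y]. No dynamical system occurs in it, so a single null set serves all
    systems; [A] will come from [a], while [K] and [C] depend on [y]. *)
Definition good (w : nat -> bool) := exists A K (C : R),
  a * (14 * A + 20)%:R <= A%:R /\
  forall n, \sum_(j < n) normalized_bound a A (bit_prob a c) K w j <= C.

Let unit_itv : set R := `[0%R, 1%R[.

(** All [K] are treated at once because the [K] of [ae_threshold_bit] depends on [y]; each costs one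
    null set. For fixed [K] the expectations are at most [14 / (j + 1)^2], hence summable. *)
Lemma ae_normalized_bound A : a * (14 * A + 20)%:R <= A%:R ->
  {ae lebesgue_measure, forall y : R, unit_itv y -> forall K, exists C : R, forall n,
    \sum_(j < n) normalized_bound a A (bit_prob a c) K (threshold_bit a c y) j <= C}.
Proof.
move=> aA.
suff: {ae lebesgue_measure, forall (y : R) K, unit_itv y -> exists C : R, forall n,
    \sum_(j < n) normalized_bound a A (bit_prob a c) K (threshold_bit a c y) j <= C}.
  by apply: ae_mono => y h yI K; exact: h.
apply: ae_foralln => K.
pose Nn j := (j.+2 ^ (13 * A + 18) * j.+2 ^ (A + 2))%N.
(* [H j] bounds the indices of the bits read at scale [j], and [Mj j] is a number of binary digits
   of [y] that determines them. *)
pose H j := (Nn j + j.+2 ^ (A + 2) + j.+2 ^ (4 * A + 6))%N.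
pose Mj j := position c (H j).
pose bits j := block_bit (position c) (threshold a c) (Mj j).
have NE j : Nn j = (j.+2 ^ (10 * A + 14) * j.+2 ^ (4 * A + 6))%N.
  by rewrite /Nn -!expnD; congr (_ ^ _)%N; lia.
have Np j : Nn j = (j.+2 ^ (14 * A + 20))%N.
  by rewrite /Nn -!expnD; congr (_ ^ _)%N; lia.
pose F j v : R := normalized_bound a A (bit_prob a c) K (bits j v) j.
have F0 j v : 0 <= F j v.
  by rewrite mulr_ge0 ?invr_ge0 ?sqr_ge0// outer_bound_ge0 ?exprn_ge0.
have mono := position_homo c_gt1.
have avgF j : average (2 ^ Mj j) (F j) <= 14 * j.+1%:R ^- 2.
  have W1 := mass_power_ge a_gt0 aA (isT : (2 <= j.+2)%N).
  set W := mass _ _ in W1.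
  have J0 : 0 < j.+2%:R :> R by rewrite ltr0n.
  have W0 : 0 < W by apply: lt_le_trans W1; rewrite divr_gt0// exprn_gt0.
  rewrite averageZ -/W.
  have bound := @average_outer_bound_le R (2 ^ Mj j) (bits j) (bit_prob a c) (H j) K
    (block_prob01 (threshold_le c a_gt0)) _ _
    (j.+2 ^ (A + 2)) (j.+2 ^ (13 * A + 18)) (j.+2 ^ (4 * A + 6)) (j.+2 ^ (10 * A + 14))
    (j.+2%:R ^+ (11 * A + 16)) (j.+2%:R ^+ (4 * A + 6)) W.
  have {}bound := bound
    (fun l Z lH aZ => block_bit_orthogonal mono (threshold_le c a_gt0) (leqnn _) lH aZ)
    (fun k kH => block_bit_variance mono (threshold_le c a_gt0) (leqnn _) kH)
    (exprn_gt0 _ J0) (exprn_gt0 _ J0) (NE j) (leqnn _).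
  have {}bound := le_trans (bound _) _.
  apply: (@le_trans _ _ (W ^- 2 * (14 * (W ^+ 2 * j.+2%:R ^- 2)))).
    rewrite ler_wpM2l ?invr_ge0 ?sqr_ge0//; apply: bound.
      by rewrite /W -Np; apply: ler_sum => k _; exact: bit_prob_le.
    by rewrite !natrX; exact: parameter_bound.
  rewrite [leLHS](_ : _ = 14 * j.+2%:R ^- 2); last by field; rewrite !gt_eqF.
  by rewrite ler_wpM2l// lef_pV2 ?posrE ?exprn_gt0 ?ltr0n// lerXn2r ?nnegrE ?ler_nat.
have := @ae_series_bounded _ _ R lebesgue_measure unit_itv
  (fun j y => F j (Num.truncn (2 ^+ Mj j * y))) 28
  (measurable_itv _) (fun k => measurable_truncn_dyadic _ _)
  (fun k y _ => F0 k _).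
case=> [n|].
  rewrite (eq_bigr (fun j : 'I_n => (average (2 ^ Mj j) (F j))%:E)); last first.
    by move=> k _; exact: integral_truncn_dyadic.
  rewrite sumEFin lee_fin; apply: (@le_trans _ _ (\sum_(j < n) 14 * j.+1%:R ^- 2)).
    by apply: ler_sum => j _; exact: avgF.
  by rewrite -mulr_sumr; have := @sum_inv_sqr_le R n; lra.
move=> N hN; exists N; move: hN => [mN N0 hN]; split => // y yN; apply: hN => /= h.
apply: yN => yI; have [C hC] := h yI; exists C => n; apply: le_trans (hC n).
have /andP[y0 y1] : 0 <= y < 1 by move: yI; rewrite /unit_itv /= in_itv.
rewrite le_eqVlt; apply/orP; left; apply/eqP; apply: eq_bigr => j _.
rewrite /F /normalized_bound; congr (_ * _).
apply: outer_bound_congr => [|k /andP[_ kH]]; first exact: NE.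
rewrite /bits /threshold_bit /block_bit -threshold_digitE//.
exact: mono.
Qed.

Lemma ae_good : a < 1 / 14 -> {ae lebesgue_measure, forall y : R, y \in `[0, 1] ->
  good (fun k => k \in hitting_times a c y)}.
Proof.
move=> a14.
(* [a * (14 A + 20) <= A] amounts to [A >= 20 a / (1 - 14 a)], solvable because [a < 1 / 14]. *)
pose A := (Num.truncn (20 * a / (1 - 14 * a))).+1.
have aA : a * (14 * A + 20)%:R <= A%:R.
  have d0 : 0 < 1 - 14 * a by lra.
  have : 20 * a / (1 - 14 * a) <= A%:R by apply/ltW/truncnS_gt.
  by rewrite ler_pdivrMr// natrD natrM; lra.
(* Digits are read on [[0, 1[], where [n] of them form an integer below [2^n]; the endpoint 1 is
   discarded as a null set. *)
have ne1 : {ae lebesgue_measure, forall y : R, y != 1}.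
  exists [set 1]; split => //; first exact: lebesgue_measure_set1.
  by move=> y /= /negP; rewrite negbK => /eqP.
move: ne1 (ae_threshold_bit a_gt0 c_gt1) (ae_normalized_bound aA).
move=> h1 h2 h3; apply: ae_mono (aeI h1 (aeI h2 h3)) => y [y1 [hbit hbound]]; rewrite in_itv /= => /andP[y0 yle].
have yI : unit_itv y by rewrite /unit_itv /= in_itv /= y0 lt_neqAle y1.
have [K hK] := hbit yI; have [C hC] := hbound yI K.
exists A, K, C; split => // n; apply: le_trans (hC n).
rewrite le_eqVlt; apply/orP; left; apply/eqP; apply: eq_bigr => j _.
rewrite /normalized_bound; congr (_ * _); apply: outer_bound_congr.
  by rewrite -!expnD; congr (_ ^ _)%N; lia.
by move=> k /andP[Kk _]; exact: hK.
Qed.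

End Good.

(** * Birkhoff's theorem *)

Lemma eq_mean_ae {d} {X : measurableType d} {R : realType} (mu : probability X R)
    (f g : X -> R) : bounded_measurable f -> bounded_measurable g ->
  {ae mu, forall x, f x = g x} -> mean mu f = mean mu g.
Proof.
move=> bf bg fg; have [_ [B fB]] := bf.
have cv : (fun _ : nat => mean mu f) @ \oo --> mean mu g.
  apply: (@mean_cvg _ _ _ mu (fun=> f) g B) => //.
  by apply: ae_mono fg => x ->; exact: cvg_cst.
by rewrite -(cvg_lim _ cv)// lim_cst.
Qed.

Section Birkhoff.
Context {d} {X : measurableType d} {R : realType} (mu : probability X R).
Variable (T : X -> X).
Hypothesis mpT : measure_preserving mu T.
Implicit Types f g : X -> R.

Let mT : measurable_fun setT T. Proof. by case: mpT. Qed.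

Definition birkhoff_sum f n x : R := \sum_(i < n) f (iter i T x).

(** The maximum of [birkhoff_sum f i x] over [i <= n], defined by the recursion along [T] that
    Garsia's argument exploits. *)
Fixpoint max_birkhoff_sum f n x : R :=
  if n is n'.+1 then Num.max 0 (f x + max_birkhoff_sum f n' (T x)) else 0.

Lemma birkhoff_sumS f n x : birkhoff_sum f n.+1 x = f x + birkhoff_sum f n (T x).
Proof.
rewrite /birkhoff_sum big_ord_recl /=; congr (_ + _).
by apply: eq_bigr => i _; rewrite -iterSr.
Qed.

Lemma bounded_measurable_birkhoff_sum f n : bounded_measurable f ->
  bounded_measurable (birkhoff_sum f n).
Proof.
move=> bf; apply: bounded_measurable_sum => i _.
by apply: bounded_measurable_comp bf; case: (iter_measure_preserving i mpT).
Qed.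

Lemma normr_birkhoff_sum_le f (B : R) n x : (forall x, `|f x| <= B) ->
  `|birkhoff_sum f n x| <= n%:R * B.
Proof.
move=> fB; apply: le_trans (ler_norm_sum _ _ _) _.
rewrite mulr_natl -[X in _ *+ X]card_ord -sumr_const.
by apply: ler_sum => i _.
Qed.

Lemma max_birkhoff_sum_ge0 f n x : 0 <= max_birkhoff_sum f n x.
Proof. by case: n => //= n; rewrite le_max lexx. Qed.

Lemma birkhoff_sum_le_max f n i x : (i <= n)%N ->
  birkhoff_sum f i x <= max_birkhoff_sum f n x.
Proof.
elim: n i x => [|n IH] [|i] x //=; try by rewrite /birkhoff_sum big_ord0.
- by move=> _; rewrite /birkhoff_sum big_ord0 le_max lexx.
- by move=> i_n; rewrite birkhoff_sumS le_max lerD2l IH ?orbT.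
Qed.

Lemma max_birkhoff_sum_leS f n x :
  max_birkhoff_sum f n x <= max_birkhoff_sum f n.+1 x.
Proof.
elim: n x => [|n IH] x; first by rewrite [leLHS]/=; exact: max_birkhoff_sum_ge0.
rewrite [leLHS]/= ge_max max_birkhoff_sum_ge0 /= le_max; apply/orP; right.
by rewrite lerD2l; exact: IH.
Qed.

Lemma bounded_measurable_max_birkhoff_sum f n : bounded_measurable f ->
  bounded_measurable (max_birkhoff_sum f n).
Proof.
move=> bf; elim: n => [|n [mn [B hB]]]; first exact: bounded_measurable_cst.
have [mf [C fC]] := bf; split => /=.
  apply: measurable_maxr => //; apply: measurable_funD => //.
  exact: measurableT_comp.
exists (C + B) => x; have := fC x; have := hB (T x).
set u := max_birkhoff_sum _ _ _; set v := f x => uB vC.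
have := ler_normD v u; have : 0 <= `|v| by [].
have : 0 <= `|u| by [].
by rewrite /Num.max; case: ifP => _; rewrite ?normr0; lra.
Qed.

(* Garsia's maximal inequality: on the set where the maximal sum is positive,
   [f] dominates the coboundary of the maximal sum. *)
Lemma maximal_ergodic f n : bounded_measurable f ->
  0 <= mean mu (fun x => f x * \1_[set x | 0 < max_birkhoff_sum f n x] x).
Proof.
move=> bf; set P := [set x | _].
have bM := bounded_measurable_max_birkhoff_sum n bf.
have mP : measurable P.
  rewrite -[P]setTI; have -> : P = max_birkhoff_sum f n @^-1` `]0, +oo[.
    by apply/seteqP; split => x; rewrite /P /= in_itv /= andbT.
  by case: bM => mM _; apply: mM => //; exact: measurable_itv.
(* The maximal sum and its composition with [T] have the same mean, so a pointwise comparison with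
   their difference suffices. *)
rewrite -(subrr (mean mu (max_birkhoff_sum f n))).
rewrite -[X in _ - X](mean_comp mpT bM) -meanB//; last exact: bounded_measurable_comp.
apply: mean_le.
- by apply: bounded_measurableB => //; exact: bounded_measurable_comp.
- by apply: bounded_measurableM => //; exact: bounded_measurable_indic.
move=> x; have Mge := max_birkhoff_sum_ge0 f n (T x).
have [M0|M0] := ltP 0 (max_birkhoff_sum f n x); last first.
  rewrite indicE memNset ?mulr0; first by rewrite subr_le0 (le_trans M0).
  by rewrite /P /=; apply/negP; rewrite -leNgt.
rewrite indicE mem_set// mulr1; case: n M0 Mge {P bM mP} => [|k] M0 _.
  by rewrite /= ltxx in M0.
(* With [M_n] the maximal sum, [M_(k+1) x = f x + M_k (T x) <= f x + M_(k+1) (T x)] where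
   [M_(k+1) x > 0]. *)
have := max_birkhoff_sum_leS f k (T x); move: M0.
by rewrite [max_birkhoff_sum f k.+1 x]/= lt_max ltxx /= => h1 h2; rewrite max_r ?(ltW h1)// lerBlDr lerD2l.
Qed.

(** The maximal inequality for [f * \1_E]: as [E] is invariant, the Birkhoff sums of this product
    are those of [f] on [E] and 0 elsewhere, so the sets [P n] increase to [E] and dominated
    convergence concludes. *)
Lemma mean_invariant_ge0 f (E : set X) : bounded_measurable f -> measurable E ->
  (forall x, E (T x) <-> E x) -> (forall x, E x -> exists n, 0 < birkhoff_sum f n x) ->
  0 <= mean mu (fun x => f x * \1_E x).
Proof.
move=> bf mE iE hE; pose g x := f x * \1_E x.
have bg : bounded_measurable g.
  by apply: bounded_measurableM => //; exact: bounded_measurable_indic.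
have indT x : \1_E (T x) = \1_E x :> R.
  rewrite !indicE; congr (_%:R); congr (nat_of_bool _).
  by apply/idP/idP; rewrite !inE => /iE.
have gE n x : birkhoff_sum g n x = birkhoff_sum f n x * \1_E x.
  rewrite /birkhoff_sum mulr_suml; apply: eq_bigr => i _; rewrite /g; congr (_ * _).
  by elim: (nat_of_ord i) => [//|k IH]; rewrite iterS indT.
pose P n := [set x | 0 < max_birkhoff_sum g n x].
have bgP n : bounded_measurable (fun x => g x * \1_(P n) x).
  apply: bounded_measurableM => //; apply: bounded_measurable_indic.
  rewrite -[P n]setTI; have -> : P n = max_birkhoff_sum g n @^-1` `]0, +oo[.
    by apply/seteqP; split => x; rewrite /P /= in_itv /= andbT.
  have [mM _] := bounded_measurable_max_birkhoff_sum n bg.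
  by apply: mM => //; exact: measurable_itv.
have [_ [B gB]] := bg.
have cv : (fun n => mean mu (fun x => g x * \1_(P n) x)) @ \oo --> mean mu g.
  apply: (@mean_cvg _ _ _ mu _ _ B) => // [n x|].
    rewrite normrM indicE; apply: le_trans (gB x).
    by case: (_ \in _); rewrite ?normr1 ?mulr1// normr0 mulr0.
  apply: aeW => x; have [Ex|nEx] := pselect (E x); last first.
    rewrite [X in _ --> X](_ : _ = 0); last by rewrite /g indicE memNset// mulr0.
    under eq_fun do rewrite /g [\1_E _]indicE memNset// mulr0 mul0r.
    exact: cvg_cst.
  have [n n0] := hE x Ex; apply: cvg_near_cst; exists n => // k /= nk.
  rewrite [\1_(P k) _]indicE mem_set ?mulr1// /P /=.
  apply: lt_le_trans (birkhoff_sum_le_max g x nk).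
  by rewrite gE indicE mem_set// mulr1.
rewrite -[leRHS](cvg_lim _ cv)//; apply: limr_ge; first exact: cvgP cv.
by apply: nearW => n; exact: maximal_ergodic.
Qed.

End Birkhoff.

Section Oscillation.
Context {R : realType}.
Implicit Types u v : nat -> R.

(** This is [limsup u > al], written with countable quantifiers for measurability; the margin
    [1 / (q + 1)] can be halved, which makes it stable under null perturbations. *)
Definition recurrently_above u (al : R) :=
  exists q : nat, forall n, exists2 i, (n <= i)%N & al + q.+1%:R^-1 <= u i.

Lemma inv_succ_lt (e : R) : 0 < e -> exists q : nat, q.+1%:R^-1 < e.
Proof.
move=> e0; exists (Num.truncn e^-1).
rewrite -[ltRHS]invrK ltf_pV2 ?posrE ?invr_gt0//; exact: truncnS_gt.
Qed.

Lemma recurrently_above_perturb u v al : (fun n => u n - v n) @ \oo --> 0 ->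
  recurrently_above u al -> recurrently_above v al.
Proof.
move=> uv [q hq]; have q0 : 0 < q.+1%:R^-1 :> R by rewrite invr_gt0 ltr0n.
have half : q.*2.+2%:R^-1 = q.+1%:R^-1 / 2 :> R.
  by rewrite -doubleS -muln2 natrM invfM.
move: uv => /cvgrPdist_lt/(_ (q.+1%:R^-1 / 2)); rewrite divr_gt0// => /(_ isT)[k _ hk].
exists q.*2.+1 => n; have [i ni hi] := hq (maxn n k).
exists i; first by rewrite (leq_trans (leq_maxl _ _) ni).
have := hk i (leq_trans (leq_maxr _ _) ni); rewrite /= sub0r normrN => /ltr_normlW.
by rewrite half; move: hi; move: (q.+1%:R^-1) => t; lra.
Qed.

(** The limit is the upper limit, obtained as the supremum of the levels exceeded infinitely often.
    If [u] also fell below [sup A - e] infinitely often, two rationals in between would be crossed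
    forever. *)
Lemma cvg_no_oscillation u (B : R) : (forall n, `|u n| <= B) ->
  (forall r s : rat, r < s -> recurrently_above u (ratr s) ->
     recurrently_above (fun n => - u n) (- ratr r) -> False) -> cvgn u.
Proof.
move=> uB osc.
pose A := [set t : R | forall n, exists2 i, (n <= i)%N & t <= u i].
have supA : has_sup A.
  split; first by exists (- B) => n; exists n => //; have := uB n; rewrite ler_norml => /andP[].
  exists B => t At; have [i _ ti] := At 0%N; apply: le_trans ti _.
  by have := uB i; rewrite ler_norml => /andP[].
suff cv : u @ \oo --> sup A by exact: (cvgP _ cv).
apply/cvgrPdist_le => e e0.
have e8 : 0 < e / 8 by rewrite divr_gt0.
have [t At tl] := sup_adherent e8 supA.
have above : \forall n \near \oo, u n <= sup A + e.
  apply: contrapT => h; have : A (sup A + e).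
    move=> n; apply: contrapT => hn; apply: h; exists n => // i /= ni.
    rewrite leNgt; apply/negP => hi; apply: hn; exists i => //; exact: ltW.
  by move=> /(ub_le_sup supA.2); rewrite gerDl leNgt e0.
have below : \forall n \near \oo, sup A - e <= u n.
  apply: contrapT => h.
  have hA n : exists2 i, (n <= i)%N & u i <= sup A - e.
    apply: contrapT => hn; apply: h; exists n => // i /= ni.
    rewrite leNgt; apply/negP => hi; apply: hn; exists i => //; exact: ltW.
  (* The levels [r < s] lie well inside the gap, so that at least [e / 8] remains on each side for
     the margin [1 / (q + 1)]. *)
  have [s] := rat_in_itvoo (ltac:(lra) : sup A - e / 2 < sup A - e / 4).
  rewrite in_itv /= => /andP[s1 s2].
  have [r] := rat_in_itvoo (ltac:(lra) : sup A - e * 3 / 4 < sup A - e / 2).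
  rewrite in_itv /= => /andP[r1 r2].
  have [q hq] := inv_succ_lt e8.
  apply: (osc r s); first by rewrite -(ltr_rat R); apply: lt_trans r2 s1.
    exists q => n; have [i ni ti] := At n; exists i => //; apply: le_trans ti.
    by move: hq; move: (q.+1%:R^-1) => dl hq; lra.
  by exists q => n; have [i ni ti] := hA n; exists i => //;
    move: hq; move: (q.+1%:R^-1) => dl hq; lra.
near=> n; rewrite ler_distlC; apply/andP; split; near: n => //.
Unshelve. all: by end_near.
Qed.

End Oscillation.

Section BirkhoffTheorem.
Context {d} {X : measurableType d} {R : realType} (mu : probability X R).
Variable (T : X -> X).
Hypothesis mpT : measure_preserving mu T.
Implicit Types f g : X -> R.

Let mT : measurable_fun setT T. Proof. by case: mpT. Qed.

Definition birkhoff_average f n x : R := n%:R^-1 * birkhoff_sum T f n x.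

Lemma bounded_measurable_birkhoff_average f n : bounded_measurable f ->
  bounded_measurable (birkhoff_average f n).
Proof. by move=> bf; apply: bounded_measurableZ; exact: (bounded_measurable_birkhoff_sum mpT). Qed.

Lemma normr_birkhoff_average_le f (B : R) n x : (forall x, `|f x| <= B) ->
  `|birkhoff_average f n x| <= B.
Proof.
move=> fB; have B0 : 0 <= B := le_trans (normr_ge0 _) (fB x).
rewrite normrM normfV normr_nat; case: n => [|n]; first by rewrite invr0 mul0r.
by rewrite ler_pdivrMl ?ltr0n// normr_birkhoff_sum_le.
Qed.

Lemma birkhoff_averageT_cvg f x : bounded_measurable f ->
  (fun n => birkhoff_average f n (T x) - birkhoff_average f n x) @ \oo --> 0.
Proof.
move=> [_ [B fB]]; have B0 : 0 <= B := le_trans (normr_ge0 _) (fB x).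
apply/cvgrPdist_le => e e0; near=> n.
rewrite sub0r normrN -mulrBr.
have n0 : (0 < n)%N by near: n; exact: nbhs_infty_gt.
have -> : birkhoff_sum T f n (T x) - birkhoff_sum T f n x = f (iter n T x) - f x.
  have := birkhoff_sumS T f n x; rewrite {1}/birkhoff_sum big_ord_recr /=.
  by rewrite -/(birkhoff_sum T f n x); lra.
rewrite normrM normfV normr_nat ler_pdivrMl ?ltr0n//.
apply: (@le_trans _ _ (B + B)); first by rewrite (le_trans (ler_normB _ _))// lerD.
rewrite -ler_pdivrMr//; apply: ltW; near: n; exact: nbhs_infty_gtr.
Unshelve. all: by end_near.
Qed.

Definition upper_set f (al : R) : set X :=
  [set x | recurrently_above (fun n => birkhoff_average f n x) al].

Lemma measurable_upper_set f al : bounded_measurable f -> measurable (upper_set f al).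
Proof.
move=> bf.
rewrite [upper_set f al](_ : _ = \bigcup_q \bigcap_n \bigcup_(i in [set i | (n <= i)%N])
   [set x | al + q.+1%:R^-1 <= birkhoff_average f i x]).
  apply: bigcup_measurable => q _; apply: bigcap_measurable => // n _.
  apply: bigcup_measurable => i _.
  rewrite -[X in measurable X]setTI.
  rewrite [X in _ `&` X](_ : _ = birkhoff_average f i @^-1` `[al + q.+1%:R^-1, +oo[).
    have [mf _] := bounded_measurable_birkhoff_average i bf.
    by apply: mf => //; exact: measurable_itv.
  by apply/seteqP; split => x /=; rewrite in_itv /= andbT.
apply/seteqP; split => x /=.
  by move=> [q hq]; exists q => // n _; have [i ni hi] := hq n; exists i.
by move=> [q _ hq]; exists q => n; have [i ni hi] := hq n I; exists i.
Qed.

(** Shifting the orbit changes the averages by a null sequence, so invariance holds at every point,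
    the form in which [mean_invariant_ge0] takes it. *)
Lemma upper_setT f al x : bounded_measurable f ->
  upper_set f al (T x) <-> upper_set f al x.
Proof.
move=> bf; have h := birkhoff_averageT_cvg x bf; split.
  exact: recurrently_above_perturb.
apply: recurrently_above_perturb; rewrite -oppr0.
by under eq_fun do rewrite -opprB; exact: cvgN.
Qed.

Lemma mean_upper_set_ge0 f al (E : set X) : bounded_measurable f -> measurable E ->
  (forall x, E (T x) <-> E x) -> E `<=` upper_set f al ->
  0 <= mean mu (fun x => (f x - al) * \1_E x).
Proof.
move=> bf mE iE EU; apply: (mean_invariant_ge0 mpT) => //.
  by apply: bounded_measurableB => //; exact: bounded_measurable_cst.
(* Asking for an index [i >= 1] excludes the empty average. *)
move=> x /EU[q /(_ 1%N)[i i1 hi]]; exists i.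
have i0 : 0 < i%:R :> R by rewrite ltr0n.
rewrite /birkhoff_sum sumrB sumr_const card_ord subr_gt0 -[al *+ _]mulr_natl.
move: hi; rewrite /birkhoff_average ler_pdivlMl// => hi.
by apply: lt_le_trans hi; rewrite ltr_pM2l// ltrDl invr_gt0 ltr0n.
Qed.

(** On the invariant set where the averages oscillate across [r < s], both [f - s] and [r - f] have
    nonnegative mean; adding them shows that [r - s] times its measure is nonnegative, so the set is
    null. *)
Lemma birkhoff_cvg f : bounded_measurable f ->
  {ae mu, forall x, cvgn (fun n => birkhoff_average f n x)}.
Proof.
move=> bf; have bNf : bounded_measurable (fun x => - f x).
  by have := bounded_measurableZ (-1) bf; under eq_fun do rewrite mulN1r.
have [_ [B fB]] := bf.
pose osc r s : set X := upper_set f (ratr s) `&` upper_set (fun x => - f x) (- ratr r).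
have osc0 r s : r < s -> mu (osc r s) = 0%E.
  move=> rs; set E := osc r s.
  have mE : measurable E by apply: measurableI; exact: measurable_upper_set.
  have iE x : E (T x) <-> E x by rewrite /E /osc /setI /= !upper_setT.
  have h1 := mean_upper_set_ge0 bf mE iE (@subIsetl _ _ _).
  have h2 := mean_upper_set_ge0 bNf mE iE (@subIsetr _ _ _).
  have bE : bounded_measurable (\1_E : X -> R) by exact: bounded_measurable_indic.
  have : 0 <= (ratr r - ratr s) * mean mu (\1_E : X -> R).
    rewrite -meanZ//; apply: le_trans (addr_ge0 h1 h2) _.
    rewrite -meanD; last 2 first.
    - by apply: bounded_measurableM => //; apply: bounded_measurableB => //;
        exact: bounded_measurable_cst.
    - by apply: bounded_measurableM => //; apply: bounded_measurableB => //;
        exact: bounded_measurable_cst.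
    rewrite le_eqVlt; apply/orP; left; apply/eqP; congr mean; apply/funext => x; ring.
  have rs' : ratr r - ratr s < 0 :> R by rewrite subr_lt0 ltr_rat.
  rewrite nmulr_rge0// => h; have mE0 : mean mu (\1_E : X -> R) = 0.
    by apply/eqP; rewrite eq_le h mean_ge0// => x; rewrite indicE.
  have := EFin_mean mu bE; by rewrite mE0 integral_indic// setIT => <-.
have : {ae mu, forall x (n : nat), if (unpickle n : option (rat * rat)) is Some (r, s) then
    r < s -> osc r s x -> False else True}.
  apply: ae_foralln => n; case: (unpickle n) => [[r s]|]; last exact: aeW.
  have [rs|nrs] := boolP (r < s); last by apply: aeW.
  exists (osc r s); split; [|exact: osc0|].
    by apply: measurableI; exact: measurable_upper_set.
  by move=> x /= h; apply: contrapT => nE; apply: h.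
apply: ae_mono => x hx; apply: (@cvg_no_oscillation _ _ B).
  by move=> n; exact: normr_birkhoff_average_le.
move=> r s rs ab be; have := hx (pickle (r, s)); rewrite pickleK; apply => //.
split => //; rewrite /upper_set /=.
rewrite [X in recurrently_above X](_ : _ = (fun n => - birkhoff_average f n x))//.
apply/funext => n; rewrite /birkhoff_average /birkhoff_sum sumrN mulrN.
by [].
Qed.

Lemma birkhoff f : bounded_measurable f -> exists g,
  [/\ bounded_measurable g,
      {ae mu, forall x, (fun n => birkhoff_average f n x) @ \oo --> g x},
      {ae mu, forall x, g (T x) = g x} &
      forall A, invariant_sets mu T A ->
        mean mu (fun x => f x * \1_A x) = mean mu (fun x => g x * \1_A x)].
Proof.
move=> bf; have [_ [B fB]] := bf.
have uB n x := normr_birkhoff_average_le n x fB.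
have mu_ n := (bounded_measurable_birkhoff_average n bf).1.
(* Clamping makes [g] visibly bounded at every point and changes nothing where the averages
   converge. *)
pose g x := Num.max (- B) (Num.min B (limn_sup (fun n => birkhoff_average f n x))).
have bg : bounded_measurable g.
  split.
    apply: measurable_maxr => //; apply: measurable_minr => //.
    apply: measurable_fun_limn_sup => // x _.
      by exists B => _ [n _ <-]; have := uB n x; rewrite ler_norml => /andP[].
    by exists (- B) => _ [n _ <-]; have := uB n x; rewrite ler_norml => /andP[].
  have [B0|B0] := leP 0 B.
    exists B => x; rewrite ler_norml /g le_max lexx /= ge_max ge_min lexx /=.
    by rewrite andbT; lra.
  by exists B => x; have := le_trans (normr_ge0 _) (fB x); rewrite leNgt B0.
have cvg_g : {ae mu, forall x, (fun n => birkhoff_average f n x) @ \oo --> g x}.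
  apply: ae_mono (birkhoff_cvg bf) => x cx.
  have := cx; set l := lim _ => cl.
  have lB : `|l| <= B.
    rewrite ler_norml; apply/andP; split.
      by apply: limr_ge => //; apply: nearW => n; have := uB n x; rewrite ler_norml => /andP[].
    by apply: limr_le => //; apply: nearW => n; have := uB n x; rewrite ler_norml => /andP[].
  rewrite [X in _ --> X](_ : _ = l)// /g (cvg_limn_inf_sup cl).2.
  move: lB; rewrite ler_norml => /andP[l1 l2].
  by rewrite min_r// max_r.
have gT : {ae mu, forall x, g (T x) = g x}.
  apply: ae_mono (aeI cvg_g (ae_comp mpT cvg_g)) => x [c1 c2].
  have c3 : (fun n => birkhoff_average f n (T x) - birkhoff_average f n x +
      birkhoff_average f n x) @ \oo --> 0 + g x.
    by apply: cvgD => //; exact: birkhoff_averageT_cvg.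
  rewrite add0r in c3; rewrite -(cvg_lim _ c2)// -(cvg_lim _ c3)//.
  by congr (lim (_ @ \oo)); apply/funext => n; rewrite subrK.
exists g; split => // A [mA A0].
have bA : bounded_measurable (\1_A : X -> R) by exact: bounded_measurable_indic.
have AT : {ae mu, forall x, \1_A (T x) = \1_A x :> R}.
  exists (A `+` T @^-1` A); split => //.
    have mTA : measurable (T @^-1` A) by rewrite -[_ @^-1` _]setTI; exact: mT.
    by apply: measurableU; exact: measurableD.
  move=> x /= h; have [Ax|nAx] := pselect (A x); have [Tx|nTx] := pselect (A (T x)).
  - by exfalso; apply: h; rewrite !indicE !mem_set.
  - by left.
  - by right.
  - by exfalso; apply: h; rewrite !indicE !memNset.
have ATn := ae_iter mpT AT.
have bfi i : bounded_measurable (fun x => f (iter i T x)).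
  by apply: bounded_measurable_comp bf; case: (iter_measure_preserving i mpT).
have inv i : mean mu (fun x => f (iter i T x) * \1_A x) = mean mu (fun x => f x * \1_A x).
  rewrite -[RHS](mean_comp (iter_measure_preserving i mpT)); last exact: bounded_measurableM.
  apply: eq_mean_ae.
  - exact: bounded_measurableM.
  - apply: bounded_measurableM => //; apply: bounded_measurable_comp bA.
    by case: (iter_measure_preserving i mpT).
  - apply: ae_mono ATn => x hx; congr (_ * _).
    by elim: i => [//|i IH]; rewrite iterS hx.
(* Averaging along the orbit does not change the mean against an invariant set; [n.+1] avoids the
   empty average. *)
have avg n : mean mu (fun x => birkhoff_average f n.+1 x * \1_A x) =
    mean mu (fun x => f x * \1_A x).
  have -> : (fun x => birkhoff_average f n.+1 x * \1_A x) =
      (fun x => n.+1%:R^-1 * \sum_(i < n.+1) f (iter i T x) * \1_A x).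
    by apply/funext => x; rewrite -mulrA mulr_suml.
  rewrite meanZ; last by apply: bounded_measurable_sum => i _; exact: bounded_measurableM.
  rewrite mean_sum; last by move=> i _; exact: bounded_measurableM.
  under eq_bigr do rewrite inv.
  by rewrite sumr_const card_ord -[X in _ * X]mulr_natl mulKf// pnatr_eq0.
have cv : (fun n => mean mu (fun x => birkhoff_average f n.+1 x * \1_A x)) @ \oo -->
    mean mu (fun x => g x * \1_A x).
  apply: (@mean_cvg _ _ _ mu _ _ B).
  - move=> n; apply: bounded_measurableM => //; exact: bounded_measurable_birkhoff_average.
  - exact: bounded_measurableM.
  - move=> n x; rewrite normrM indicE; apply: le_trans (uB n.+1 x).
    by case: (_ \in _); rewrite ?normr1 ?mulr1// normr0 mulr0.
  - apply: ae_mono cvg_g => x cx; apply: cvgMl.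
    by have := cx; rewrite -cvg_shiftS.
by move: cv; rewrite (funext avg) => cv; rewrite -(cvg_lim _ cv)// lim_cst.
Qed.

End BirkhoffTheorem.

(** * Conditional expectations *)

Section ConditionalExpectation.
Context {d} {X : measurableType d} {R : realType} (mu : probability X R).
Implicit Types f g : X -> R.

(** The estimates use bounds valid at every point; clamping at the essential bound alters [f] only
    on a null set. *)
Lemma Linfty_bounded_version f : f \in Lfun mu +oo%E -> exists2 f',
  bounded_measurable f' & {ae mu, forall x, f x = f' x}.
Proof.
move=> /andP[+ +]; rewrite !inE => mf; rewrite /= /finite_norm unlock /Lnorm /=.
rewrite ifT; last by rewrite [X in (_ < X)%E]probability_setT lte01.
move=> /ess_supr_bounded[M hM].
exists (fun x => Num.max (- M) (Num.min M (f x))).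
  split.
    by apply: measurable_maxr => //; exact: measurable_minr.
  exists `|M| => x; rewrite ler_norml; apply/andP; split.
    by rewrite le_max lerN2 ler_norm.
  rewrite ge_max ge_min ler_norm /= andbT.
  by rewrite -normrN ler_norm.
apply: ae_mono hM => x; rewrite /= ler_norml => /andP[M1 M2].
by rewrite min_r// max_r.
Qed.

Variable T : X -> X.
Hypothesis mpT : measure_preserving mu T.

Let mT : measurable_fun setT T. Proof. by case: mpT. Qed.

Lemma invariant_sets_ae (A : set X) : measurable A ->
  {ae mu, forall x, A (T x) <-> A x} -> invariant_sets mu T A.
Proof.
move=> mA [N [mN N0 hN]]; split => //.
have mTA : measurable (T @^-1` A) by rewrite -[_ @^-1` _]setTI; exact: mT.
apply: (subset_measure0 _ _ _ N0) => //.
  by apply: measurableU; exact: measurableD.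
move=> x hx; apply: hN => /= h; case: hx => -[] /= Ax.
  by apply; apply/h.
by apply; apply/h.
Qed.

(** Different values of [g x] and [g (T x)] would be separated by a rational [q], against the almost
    sure invariance of the set where [g < q]. *)
Lemma ae_invariant_fun g : measurable_fun setT g ->
  (forall B : set R, measurable B -> invariant_sets mu T (g @^-1` B)) ->
  {ae mu, forall x, g (T x) = g x}.
Proof.
move=> mg ig.
pose E (q : rat) := g @^-1` `]-oo, (ratr q : R)[.
have iE q : invariant_sets mu T (E q) by apply: ig; exact: measurable_itv.
have aE q : {ae mu, forall x, E q (T x) <-> E q x}.
  have [mE E0] := iE q; exists (E q `+` T @^-1` E q); split => //.
    have mTE : measurable (T @^-1` E q) by rewrite -[_ @^-1` _]setTI; exact: mT.
    by apply: measurableU; exact: measurableD.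
  move=> x /= h; have [Ex|nEx] := pselect (E q x).
    by left; split => // ETx; apply: h.
  have [ETx|nETx] := pselect (E q (T x)); first by right.
  by exfalso; apply: h; split.
have : {ae mu, forall x n, if (unpickle n : option rat) is Some q
    then E q (T x) <-> E q x else True}.
  by apply: ae_foralln => n; case: (unpickle n) => [q|]; [exact: aE|exact: aeW].
apply: ae_mono => x hx.
have hq q : (g (T x) < ratr q) = (g x < ratr q).
  have := hx (pickle q); rewrite pickleK /E /= !in_itv /= => h.
  by apply/idP/idP => /h.
apply/eqP; rewrite eq_le; apply/andP; split; rewrite leNgt; apply/negP => lt.
  have [q] := rat_in_itvoo lt; rewrite in_itv /= => /andP[q1 q2].
  by move: q1; rewrite -hq ltNge (ltW q2).
have [q] := rat_in_itvoo lt; rewrite in_itv /= => /andP[q1 q2].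
by move: q1; rewrite hq ltNge (ltW q2).
Qed.

(** The set [A] where [g < g'] is itself invariant, so both functions have the integral of [f] over
    it; as [g' - g] is positive on [A] with integral 0, [A] is null. *)
Lemma is_cond_exp_le f g g' : is_cond_exp mu (invariant_sets mu T) f g ->
  is_cond_exp mu (invariant_sets mu T) f g' -> {ae mu, forall x, g' x <= g x}.
Proof.
move=> [ig iB gA] [ig' iB' gA'].
have mg : measurable_fun setT g by apply/measurable_EFinP; case/integrableP: ig.
have mg' : measurable_fun setT g' by apply/measurable_EFinP; case/integrableP: ig'.
pose h x := g' x - g x.
have mh : measurable_fun setT h by exact: measurable_funB.
pose A := [set x | g x < g' x].
have mA : measurable A.
  rewrite -[A]setTI [X in _ `&` X](_ : _ = h @^-1` `]0, +oo[).
    by apply: mh => //; exact: measurable_itv.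
  by apply/seteqP; split => x; rewrite /A /h /= in_itv /= andbT subr_gt0.
have iA : invariant_sets mu T A.
  apply: invariant_sets_ae => //.
  apply: ae_mono (aeI (ae_invariant_fun mg iB) (ae_invariant_fun mg' iB')).
  by move=> x [h1 h2]; rewrite /A /= h1 h2.
have igA := integrableS measurableT mA (@subsetT _ A) ig.
have igA' := integrableS measurableT mA (@subsetT _ A) ig'.
have : (\int[mu]_(x in A) `|(h x)%:E|)%E = 0%E.
  transitivity (\int[mu]_(x in A) ((g' x)%:E - (g x)%:E))%E.
    apply: eq_integral => x; rewrite inE => Ax.
    by rewrite gee0_abs// lee_fin subr_ge0 ltW.
  rewrite integralB_EFin// gA// gA'// subee//.
  by rewrite -gA//; exact: integrable_fin_num.
have mhA : measurable_fun A (fun x => (h x)%:E).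
  by apply/measurable_EFinP; exact: measurable_funTS.
move=> /(ae_eq_integral_abs mu mA mhA); apply: ae_mono => x hx.
rewrite leNgt; apply/negP => Ax; have := hx Ax.
by case=> /eqP; rewrite /h subr_eq0 gt_eqF.
Qed.

Lemma is_cond_exp_unique f g g' : is_cond_exp mu (invariant_sets mu T) f g ->
  is_cond_exp mu (invariant_sets mu T) f g' -> {ae mu, forall x, g' x = g x}.
Proof.
move=> hg hg'; apply: ae_mono (aeI (is_cond_exp_le hg hg') (is_cond_exp_le hg' hg)).
by move=> x [h1 h2]; apply/eqP; rewrite eq_le h1.
Qed.

Lemma integral_mean_indic f (A : set X) : bounded_measurable f -> measurable A ->
  (\int[mu]_(x in A) (f x)%:E)%E = (mean mu (fun x => f x * \1_A x))%:E.
Proof.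
move=> bf mA; rewrite EFin_mean; last first.
  by apply: bounded_measurableM => //; exact: bounded_measurable_indic.
rewrite integral_mkcond; apply: eq_integral => x _; rewrite patchE indicE.
by case: ifP; rewrite ?mulr1 ?mulr0.
Qed.

(** [real_cond_exp] selects an unspecified version. Since [g] is a version, the selected function is
    one too, and versions agree almost everywhere. *)
Lemma real_cond_exp_ae f f' g : measurable_fun setT f ->
  bounded_measurable f' -> {ae mu, forall x, f x = f' x} ->
  bounded_measurable g -> {ae mu, forall x, g (T x) = g x} ->
  (forall A, invariant_sets mu T A ->
     mean mu (fun x => f' x * \1_A x) = mean mu (fun x => g x * \1_A x)) ->
  {ae mu, forall x, real_cond_exp mu f (invariant_sets mu T) x = g x}.
Proof.
move=> mf bf' ff' bg gT gA.
have hg : is_cond_exp mu (invariant_sets mu T) f g.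
  split.
  - exact: bounded_measurable_integrable.
  - move=> B mB; apply: invariant_sets_ae.
      by rewrite -[_ @^-1` _]setTI; case: bg => mg _; exact: mg.
    by apply: ae_mono gT => x /= ->.
  - move=> A iA; have [mA _] := iA; rewrite integral_mean_indic// -gA//.
    rewrite -integral_mean_indic//; apply: ae_eq_integral => //.
    + by apply/measurable_EFinP; apply: measurable_funTS; case: bf'.
    + by apply/measurable_EFinP; exact: measurable_funTS.
    + by apply: ae_mono ff' => x -> _.
apply: (is_cond_exp_unique hg).
exact: (xgetPex (cst 0) (ex_intro _ g hg)).
Qed.

End ConditionalExpectation.

(** * Discrepancy of the hits *)

(** For [N] between [n_ j] and [n_ j.+1] the extra terms are at most the sum of [m] over the whole
    gap, and dividing by [W N] instead of [W (n_ j)] only helps. *)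
Lemma cvg_interpolation {R : realType} (n_ : nat -> nat) (W b m : nat -> R) :
  (forall j, (j <= n_ j)%N) -> (forall j, 0 < W (n_ j)) ->
  {homo W : i j / (i <= j)%N >-> i <= j} ->
  (forall k, `|b k| <= m k) ->
  (fun j => (W (n_ j))^-1 * \sum_(k < n_ j) b k) @ \oo --> 0 ->
  (fun j => (W (n_ j))^-1 * \sum_(n_ j <= k < n_ j.+1) m k) @ \oo --> 0 ->
  (fun N => (W N)^-1 * \sum_(k < N) b k) @ \oo --> 0.
Proof.
move=> jn W0 Wnd bm /cvgrPdist_le hb /cvgrPdist_le hm.
apply/cvgrPdist_le => e e0; have e2 : 0 < e / 2 by rewrite divr_gt0.
have [J1 _ h1] := hb _ e2; have [J2 _ h2] := hm _ e2.
pose J := maxn J1 J2; exists (n_ J) => // N /= JN.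
(* The least such [j] also satisfies [n_ j <= N], by minimality or, if [j = J], by the choice of
   [N]. *)
have exj : exists j, (J <= j)%N && (N < n_ j.+1)%N.
  exists (maxn J N); rewrite leq_maxl /=.
  by apply: leq_trans (jn _); rewrite ltnS leq_maxr.
case: (ex_minnP exj) => j /andP[Jj Nj] jmin.
have nj : (n_ j <= N)%N.
  move: Jj; rewrite leq_eqVlt => /predU1P[<-//|Jj].
  have j0 : (0 < j)%N by exact: leq_ltn_trans Jj.
  rewrite leqNgt; apply/negP => Nnj; have := jmin j.-1.
  have Jj1 : (J <= j.-1)%N by lia.
  by rewrite prednK// Jj1 Nnj => /(_ isT); lia.
have := h1 j (leq_trans (leq_maxl _ _) Jj).
have := h2 j (leq_trans (leq_maxr _ _) Jj).
have m0 k : 0 <= m k by exact: le_trans (bm k).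
rewrite !sub0r !normrN !normrM !normfV !(gtr0_norm (W0 j)).
rewrite (ger0_norm (sumr_ge0 _ _)) => // H2 H1.
have WN : W (n_ j) <= W N by exact: Wnd.
have WN0 : 0 < W N by exact: lt_le_trans (W0 j) WN.
rewrite (gtr0_norm WN0) ler_pdivrMl//.
apply: (@le_trans _ _ (W (n_ j) * e)); last by rewrite ler_wpM2r// ltW.
rewrite ler_pdivrMl// in H1; rewrite ler_pdivrMl// in H2.
rewrite [e in leRHS]splitr mulrDr; apply: le_trans (lerD H1 H2).
rewrite -(big_mkord xpredT b) (@big_cat_nat _ _ _ (n_ j))//= big_mkord.
apply: le_trans (ler_normD _ _) _; rewrite lerD2l.
apply: le_trans (ler_norm_sum _ _ _) _.
rewrite [leRHS](@big_cat_nat _ _ _ N) //=; last exact: ltnW.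
rewrite ler_wpDr ?sumr_ge0//.
by apply: ler_sum => k _.
Qed.

Section Mass.
Context {R : realType}.
Variable a : R.
Hypothesis a_gt0 : 0 < a.

Lemma mass_homo : {homo mass a : i j / (i <= j)%N >-> i <= j}.
Proof.
move=> i j ij; rewrite /mass -!(big_mkord xpredT) (@big_cat_nat _ _ _ i 0 j)//=.
by rewrite ler_wpDr// sumr_ge0// => k _; exact: density_ge0.
Qed.

Variable A : nat.
Hypothesis aA : a * (14 * A + 20)%:R <= A%:R.

Let n_ j := (j.+2 ^ (14 * A + 20))%N.

Lemma mass_power_gt0 j : 0 < mass a (n_ j).
Proof.
apply: lt_le_trans (mass_power_ge a_gt0 aA (isT : (2 <= j.+2)%N)).
by rewrite divr_gt0// exprn_gt0// ltr0n.
Qed.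

Lemma mass_cvgy : mass a @ \oo --> +oo.
Proof.
apply/cvgryPge => M; pose j := (Num.truncn (M * 2)).+1.
have jM : M <= j%:R / 2 by rewrite ler_pdivlMr//; exact/ltW/truncnS_gt.
exists (n_ j) => // N /= jN; apply: le_trans (mass_homo jN); apply: le_trans jM _.
apply: le_trans (mass_power_ge a_gt0 aA (isT : (2 <= j.+2)%N)).
rewrite ler_pM2r ?invr_gt0//; apply: (@le_trans _ _ j.+2%:R); first by rewrite ler_nat ltnW.
by rewrite -[leLHS]expr1 ler_weXn2l ?ler1n// addnS.
Qed.

(** Convexity: on [[0, 1]] the graph of [(1 + t)^q] lies below its chord. *)
Lemma power_ratio_bound (t : R) q : 0 <= t <= 1 -> (1 + t) ^+ q <= 1 + (2 ^+ q - 1) * t.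
Proof.
move=> /andP[t0 t1]; elim: q => [|q IH]; first by rewrite !expr0 subrr mul0r addr0.
have c0 : 1 <= 2 ^+ q :> R by rewrite exprn_ege1// ler1n.
rewrite !exprSr; apply: (@le_trans _ _ ((1 + (2 ^+ q - 1) * t) * (1 + t))).
  by rewrite ler_wpM2r// addr_ge0.
move: (2 ^+ q) c0 => u u1; rewrite -subr_ge0.
have -> : 1 + (u * 2 - 1) * t - (1 + (u - 1) * t) * (1 + t) = (u - 1) * (t * (1 - t)).
  by ring.
by rewrite !mulr_ge0 ?subr_ge0.
Qed.

(** The increment is at most [(n_ j.+1 - n_ j) * density a (n_ j)] and the mass at least half of
    [n_ j * density a (n_ j)]; polynomial growth of [n_] makes the ratio [O(1 / j)]. *)
Lemma mass_increment_cvg0 :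
  (fun j => (mass a (n_ j))^-1 * (mass a (n_ j.+1) - mass a (n_ j))) @ \oo --> 0.
Proof.
pose p := (14 * A + 20)%N; pose C : R := 2 * (2 ^+ p - 1).
apply: (@squeeze_cvgr _ _ _ _ (cst 0) (fun j => C * j.+1%:R^-1)).
- near=> j; have W0 := mass_power_gt0 j.
  have nn : (n_ j <= n_ j.+1)%N by rewrite leq_exp2r// addnS.
  have n2 : (2 <= n_ j)%N.
    by apply: (@leq_trans j.+2) => //; rewrite -{1}[j.+2]expn1 leq_pexp2l// addnS.
  have n0 : (0 < n_ j)%N by apply: leq_trans n2.
  rewrite mulr_ge0 ?invr_ge0 ?(ltW W0) ?subr_ge0 ?mass_homo//=.
  rewrite ler_pdivrMl//.
  have d0 : 0 < density a (n_ j) by exact: density_gt0.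
  apply: (@le_trans _ _ ((n_ j.+1 - n_ j)%:R * density a (n_ j))).
    rewrite /mass -!(big_mkord xpredT) (@big_cat_nat _ _ _ (n_ j) 0 (n_ j.+1))//= addrAC subrr add0r.
    rewrite mulr_natl -sumr_const_nat !big_nat; apply: ler_sum => k /andP[k1 _].
    exact: density_le.
  apply: (@le_trans _ _ ((n_ j)%:R / 2 * density a (n_ j) * (C * j.+1%:R^-1))); last first.
    rewrite ler_wpM2r ?mulr_ge0 ?invr_ge0// ?subr_ge0 ?exprn_ege1 ?ler1n//.
    apply: le_trans (mass_ge a_gt0 n0); rewrite ler_pM2r// -subn1 natrB//.
    have : 2 <= (n_ j)%:R :> R by rewrite ler_nat.
    by move: (n_ j)%:R => u u2; lra.
  rewrite mulrAC ler_pM2r// natrB// /C.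
  have J0 : 0 < j.+2%:R :> R by rewrite ltr0n.
  have -> : (n_ j.+1)%:R = (n_ j)%:R * (1 + j.+2%:R^-1) ^+ p :> R.
    rewrite /n_ !natrX -exprMn mulrDr mulr1 divff ?gt_eqF//.
    by rewrite natr1.
  have h := @power_ratio_bound j.+2%:R^-1 p.
  have {}h : (1 + j.+2%:R^-1) ^+ p <= 1 + (2 ^+ p - 1) * j.+2%:R^-1 :> R.
    by apply: h; rewrite invr_ge0 ltW//= invf_le1// ler1n.
  have nR : 0 < (n_ j)%:R :> R by rewrite ltr0n.
  apply: (@le_trans _ _ ((n_ j)%:R * ((2 ^+ p - 1) * j.+1%:R^-1))); last first.
    by rewrite le_eqVlt; apply/orP; left; apply/eqP; field; rewrite gt_eqF.
  rewrite -[X in _ - X]mulr1 -mulrBr ler_pM2l// lerBlDl; apply: le_trans h _.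
  rewrite lerD2l ler_wpM2l ?subr_ge0 ?exprn_ege1 ?ler1n//.
  by rewrite lef_pV2 ?posrE ?ltr0n// ler_nat.
- exact: cvg_cst.
- rewrite -(mulr0 C); apply: cvgMr; exact: cvg_harmonic.
Unshelve. all: by end_near.
Qed.

End Mass.

Section Discrepancy.
Context {R : realType}.
Variables (a c : R).
Hypotheses (a_gt0 : 0 < a) (c_gt1 : 1 < c).
Variables (w : nat -> bool) (A K : nat).
Hypothesis aA : a * (14 * A + 20)%:R <= A%:R.

Let n_ j := (j.+2 ^ (14 * A + 20))%N.
Let y := centered_bit (bit_prob a c) K w.

Let n_ge j : (j <= n_ j)%N.
Proof. by apply: ltnW; apply: ltnW; rewrite -{1}[j.+2]expn1 leq_pexp2l// addnS. Qed.

Let invmass_cvg0 : (fun j => (mass a (n_ j))^-1) @ \oo --> 0.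
Proof.
apply: (@squeeze_cvgr _ _ _ _ (cst 0) (fun j => 2 * j.+1%:R^-1)).
- near=> j; have J0 : 0 < j.+2%:R :> R by rewrite ltr0n.
  have W0 := mass_power_gt0 a_gt0 aA j; rewrite invr_ge0 ltW//=.
  have h := mass_power_ge a_gt0 aA (isT : (2 <= j.+2)%N).
  have h1 : j.+1%:R / 2 <= mass a (n_ j).
    apply: le_trans h; rewrite ler_pM2r ?invr_gt0//.
    apply: (@le_trans _ _ j.+2%:R); first by rewrite ler_nat.
    by rewrite -[leLHS]expr1 ler_weXn2l ?ler1n// addnS.
  by rewrite -[X in X * _]invrK -invfM lef_pV2 ?posrE ?mulr_gt0 ?invr_gt0 ?ltr0n// mulrC.
- exact: cvg_cst.
- rewrite -(mulr0 2); apply: cvgMr; exact: cvg_harmonic.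
Unshelve. all: by end_near.
Qed.

(** Passing from [bit_prob] to [density] and removing the cut-off [K] changes the sum by at most
    [C + K], whatever [phi] is, and the mass tends to infinity. *)
Lemma discrepancy_subsequence (phi : nat -> R) : (forall k, `|phi k| <= 1) ->
  (fun j => (mass a (n_ j))^-1 * \sum_(k < n_ j) y k * phi k) @ \oo --> 0 ->
  (fun j => (mass a (n_ j))^-1 *
     \sum_(k < n_ j) ((w k)%:R - density a k) * phi k) @ \oo --> 0.
Proof.
move=> phi1 cy; have [C hC] := sum_gap_bounded c_gt1.
have term k : `|((w k)%:R - density a k) - y k| <= 2 ^- gap c k + (k < K)%N%:R.
  have := bit_prob_le a c k; have := bit_prob_ge a c k.
  have := density_ge0 a k; have := density_le1 a_gt0 k.
  have g0 : 0 <= 2 ^- gap c k :> R by rewrite invr_ge0 exprn_ge0.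
  move: (2 ^- gap c k) g0 => u u0.
  rewrite /y /centered_bit; have [kK|Kk] := ltnP k K.
    rewrite /= subr0 => d1 d0 _ _; rewrite ler_norml.
    by case: (w k) => /=; lra.
  rewrite /= addr0 => _ _ h1 h2; rewrite ler_norml.
  by move: h1 h2; move: (density a k) (bit_prob a c k) => v t *; lra.
have diff n : `|\sum_(k < n) ((w k)%:R - density a k) * phi k - \sum_(k < n) y k * phi k|
    <= C + K%:R.
  rewrite -sumrB; apply: le_trans (ler_norm_sum _ _ _) _.
  apply: (@le_trans _ _ (\sum_(k < n) (2 ^- gap c k + (k < K)%N%:R))).
    apply: ler_sum => k _; rewrite -mulrBl normrM.
    by apply: le_trans (term k); rewrite ler_piMr.
  rewrite big_split /=; apply: lerD; first exact: hC.
  rewrite -natr_sum ler_nat -(big_mkord xpredT (fun k => (k < K)%N : nat)).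
  have [nK|Kn] := leqP n K.
    apply: leq_trans nK; rewrite -[leqRHS]muln1 -[n in leqRHS]subn0 -sum_nat_const_nat.
    by apply: leq_sum => k _; exact: leq_b1.
  rewrite (@big_cat_nat _ _ _ K)//=; last exact: ltnW.
  rewrite [X in (_ + X)%N]big_nat [X in (_ + X)%N]big1 ?addn0; last first.
    by move=> k /andP[Kk _]; rewrite ltnNge Kk.
  rewrite -[leqRHS]muln1 -[K in leqRHS]subn0 -sum_nat_const_nat.
  by apply: leq_sum => k _; exact: leq_b1.
have cK : (fun j => (mass a (n_ j))^-1 * (C + K%:R)) @ \oo --> 0 * (C + K%:R).
  exact: cvgMl invmass_cvg0.
rewrite mul0r in cK.
have cN : (fun j => - ((mass a (n_ j))^-1 * (C + K%:R))) @ \oo --> - (0 : R).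
  exact: cvgN.
rewrite oppr0 in cN.
have cd : (fun j => (mass a (n_ j))^-1 *
    (\sum_(k < n_ j) ((w k)%:R - density a k) * phi k - \sum_(k < n_ j) y k * phi k))
    @ \oo --> 0.
  apply: (@squeeze_cvgr _ _ _ _ (fun j => - ((mass a (n_ j))^-1 * (C + K%:R)))
    (fun j => (mass a (n_ j))^-1 * (C + K%:R))).
  - near=> j; have W0 : 0 <= (mass a (n_ j))^-1.
      by rewrite invr_ge0 ltW// mass_power_gt0.
    have := diff (n_ j); rewrite ler_norml => /andP[h1 h2].
    by rewrite -mulrN !ler_wpM2l.
  - exact: cN.
  - exact: cK.
rewrite -[X in _ --> X]addr0; apply: cvg_trans (cvgD cd cy); apply: near_eq_cvg.
by near=> j; rewrite /= -mulrDr subrK.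
Unshelve. all: by end_near.
Qed.

(** Interpolation with the majorant [w + density]. Between [n_ j] and [n_ j.+1] it sums to an
    increment of the discrepancy for [phi = 1] plus twice an increment of [mass], both
    negligible. *)
Lemma discrepancy_sequence (phi : nat -> R) : (forall k, `|phi k| <= 1) ->
  (fun j => (mass a (n_ j))^-1 * \sum_(k < n_ j) y k * phi k) @ \oo --> 0 ->
  (fun j => (mass a (n_ j))^-1 * \sum_(k < n_ j) y k) @ \oo --> 0 ->
  (fun N => (mass a N)^-1 *
     \sum_(k < N) ((w k)%:R - density a k) * phi k) @ \oo --> 0.
Proof.
move=> phi1 cphi c1.
have W0 := mass_power_gt0 a_gt0 aA.
apply: (@cvg_interpolation R n_ (mass a)
  (fun k => ((w k)%:R - density a k) * phi k) (fun k => (w k)%:R + density a k)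
  n_ge W0) => //.
- exact: mass_homo.
- move=> k; rewrite normrM; apply: (@le_trans _ _ (`|(w k)%:R - density a k| * 1)).
    by rewrite ler_wpM2l.
  rewrite mulr1 (le_trans (ler_normB _ _))// (ger0_norm (density_ge0 a k)).
  by rewrite ger0_norm.
- exact: discrepancy_subsequence.
have cE : (fun j => (mass a (n_ j))^-1 *
    \sum_(k < n_ j) ((w k)%:R - density a k)) @ \oo --> 0.
  have sum1 (h : nat -> R) n : \sum_(k < n) h k * 1 = \sum_(k < n) h k.
    by apply: eq_bigr => k _; rewrite mulr1.
  have one1 (k : nat) : `|1 : R| <= 1 by rewrite normr1.
  have := @discrepancy_subsequence (fun=> 1) one1.
  under eq_fun do rewrite sum1.
  move=> /(_ c1); apply: cvg_trans; apply: near_eq_cvg; near=> j.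
  by rewrite (sum1 (fun k => (w k)%:R - density a k)).
set E := fun j => \sum_(k < n_ j) ((w k)%:R - density a k) in cE *.
have cI := mass_increment_cvg0 a_gt0 aA.
have cE1 : (fun j => (mass a (n_ j.+1))^-1 * E j.+1) @ \oo --> 0.
  by have := cE; rewrite -cvg_shiftS.
have lim0 : (fun j => ((mass a (n_ j))^-1 * (mass a (n_ j.+1) - mass a (n_ j)) + 1) *
    ((mass a (n_ j.+1))^-1 * E j.+1) - (mass a (n_ j))^-1 * E j +
    2 * ((mass a (n_ j))^-1 * (mass a (n_ j.+1) - mass a (n_ j)))) @ \oo -->
    (0 + 1) * 0 - 0 + 2 * (0 : R).
  apply: cvgD; last by apply: cvgMr.
  apply: cvgB => //; apply: cvgM => //; apply: cvgD => //; exact: cvg_cst.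
rewrite !mulr0 subrr addr0 in lim0.
move: lim0; apply: cvg_trans; apply: near_eq_cvg; near=> j.
have nn : (n_ j <= n_ j.+1)%N by rewrite leq_exp2r// addnS.
have sE : \sum_(n_ j <= k < n_ j.+1) ((w k)%:R + density a k) =
    E j.+1 - E j + 2 * (mass a (n_ j.+1) - mass a (n_ j)).
  rewrite /E /mass -!(big_mkord xpredT).
  rewrite -(big_mkord xpredT (fun k => (w k)%:R - density a k)).
  rewrite -(big_mkord xpredT (fun k => (w k)%:R - density a k)).
  rewrite (@big_cat_nat _ _ _ (n_ j) 0 (n_ j.+1) xpredT (fun k => (w k)%:R - density a k))//=.
  rewrite (@big_cat_nat _ _ _ (n_ j) 0 (n_ j.+1) xpredT (fun k => density a k))//=.
  rewrite (addrC _ (\sum_(n_ j <= i < n_ j.+1) ((w i)%:R - density a i))) addrK.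
  rewrite (addrC _ (\sum_(n_ j <= i < n_ j.+1) density a i)) addrK.
  by rewrite mulr_sumr -big_split; apply: eq_bigr => k _ /=; ring.
rewrite sE; have := W0 j; have := W0 j.+1; rewrite -/(n_ j) -/(n_ j.+1).
move: (mass a (n_ j)) (mass a (n_ j.+1)) (E j) (E j.+1) => u v s t v0 u0.
by field; rewrite !gt_eqF.
Unshelve. all: by end_near.
Qed.

Context {d} {X : measurableType d} (mu : probability X R).
Variables (T S : X -> X).
Hypotheses (mpT : measure_preserving mu T) (mpS : measure_preserving mu S).
Hypothesis TS : forall x, T (S x) = S (T x).
Variable C : R.
Hypothesis hC : forall n, \sum_(j < n) normalized_bound a A (bit_prob a c) K w j <= C.

(** The second moments are dominated by [normalized_bound], whose sum is finite, so the sum of the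
    squares is finite almost everywhere. *)
Lemma ae_subsequence (f g : X -> R) :
  bounded_measurable f -> (forall x, `|f x| <= 1) ->
  bounded_measurable g -> (forall x, `|g x| <= 1) ->
  {ae mu, forall x, (fun j => (mass a (n_ j))^-1 * \sum_(k < n_ j)
     y k * (f (iter (hits w 0 k) T x) * g (iter k S x))) @ \oo --> 0}.
Proof.
move=> bf f1 bg g1.
pose D j x : R := (mass a (n_ j))^-1 * \sum_(k < n_ j)
     y k * (f (iter (hits w 0 k) T x) * g (iter k S x)).
have bsum j : bounded_measurable (fun x => \sum_(k < n_ j)
     y k * (f (iter (hits w 0 k) T x) * g (iter k S x))).
  apply: bounded_measurable_sum => k _; apply: bounded_measurableZ.
  apply: bounded_measurableM; apply: bounded_measurable_comp => //.
    by case: (iter_measure_preserving (hits w 0 k) mpT).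
  by case: (iter_measure_preserving k mpS).
have bD j : bounded_measurable (D j) by exact: bounded_measurableZ.
have bD2 j : bounded_measurable (fun x => D j x ^+ 2).
  by under eq_fun do rewrite expr2; exact: bounded_measurableM.
have mD j : mean mu (fun x => D j x ^+ 2) <=
    normalized_bound a A (bit_prob a c) K w j.
  under eq_fun do rewrite exprMn; rewrite meanZ; last first.
    by under eq_fun do rewrite expr2; exact: bounded_measurableM.
  rewrite /normalized_bound exprVn ler_wpM2l ?invr_ge0 ?sqr_ge0//.
  have nE : n_ j = (j.+2 ^ (13 * A + 18) * j.+2 ^ (A + 2))%N.
    by rewrite /n_ -expnD; congr (_ ^ _)%N; lia.
  rewrite nE; apply: (outer_bound_mean mpT mpS TS) => //; rewrite ?expn_gt0 ?exprn_gt0 ?ltr0n//.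
  by rewrite -!expnD; congr (_ ^ _)%N; lia.
have := @ae_series_bounded _ _ R mu setT (fun j x => D j x ^+ 2) C measurableT
  (fun j => (bD2 j).1) (fun j x _ => sqr_ge0 _).
have hsum n : (\sum_(i < n) \int[mu]_x (D i x ^+ 2)%:E <= C%:E)%E.
  rewrite (eq_bigr (fun i : 'I_n => (mean mu (fun x => D i x ^+ 2))%:E)); last first.
    by move=> i _; rewrite EFin_mean.
  by rewrite sumEFin lee_fin; apply: le_trans (hC n); apply: ler_sum => i _.
move=> /(_ hsum); apply: ae_mono => x /(_ I)[M hM].
have /cvgrPdist_lt h := bounded_series_cvg0 (fun j => sqr_ge0 (D j x)) hM.
apply/cvgrPdist_lt => e e0; have [k _ hk] := h (e ^+ 2) (exprn_gt0 _ e0).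
exists k => // j /hk; rewrite /= !sub0r !normrN => hj.
rewrite -/(D j x) -(@ltr_pXn2r _ 2)// ?nnegrE ?(ltW e0)//.
by rewrite -normrX.
Qed.

Lemma ae_discrepancy (f g : X -> R) :
  bounded_measurable f -> (forall x, `|f x| <= 1) ->
  bounded_measurable g -> (forall x, `|g x| <= 1) ->
  {ae mu, forall x, (fun N => (mass a N)^-1 * \sum_(k < N)
     ((w k)%:R - density a k) * (f (iter (hits w 0 k) T x) * g (iter k S x)))
     @ \oo --> 0}.
Proof.
move=> bf f1 bg g1.
have b1 := @bounded_measurable_cst _ X R 1.
have n1 (x : X) : `|1 : R| <= 1 by rewrite normr1.
(* The constants 1 supply the last hypothesis of [discrepancy_sequence], which controls the number
   of hits between consecutive [n_ j]. *)
apply: ae_mono (aeI (ae_subsequence bf f1 bg g1) (ae_subsequence b1 n1 b1 n1)).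
move=> x [h1 h2].
apply: (@discrepancy_sequence (fun k => f (iter (hits w 0 k) T x) * g (iter k S x))) => //.
  by move=> k; rewrite normrM mulr_ile1.
have E n : \sum_(k < n) y k * (1 * 1) = \sum_(k < n) y k.
  by apply: eq_bigr => k _; rewrite !mulr1.
by move: h2; under eq_fun do rewrite E.
Qed.

End Discrepancy.

(** * Weighted averages *)

Lemma normr_abel_le {R : realFieldType} (c h : nat -> R) (B : R) N :
  (forall k, `|h k| <= B) ->
  `|\sum_(k < N) c k * (h k - h k.+1)| <=
  B * (`|c 0%N| + `|c N| + \sum_(k < N) `|c k.+1 - c k|).
Proof.
move=> hB.
have -> : \sum_(k < N) c k * (h k - h k.+1) =
    c 0%N * h 0%N - c N * h N + \sum_(k < N) (c k.+1 - c k) * h k.+1.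
  elim: N => [|N IH]; first by rewrite !big_ord0; ring.
  by rewrite !big_ord_recr /= IH; ring.
rewrite !mulrDr mulr_sumr; apply: le_trans (ler_normD _ _) _; apply: lerD.
  apply: le_trans (ler_normB _ _) _; rewrite !normrM.
  by rewrite lerD// mulrC ler_wpM2r.
apply: le_trans (ler_norm_sum _ _ _) _; apply: ler_sum => k _.
by rewrite normrM mulrC ler_wpM2r.
Qed.

Section WeightedAverages.
Context {R : realType}.
Variable a : R.
Hypothesis a_gt0 : 0 < a.
Hypothesis mass_y : mass a @ \oo --> +oo.

(** Abel summation: a Cesaro bound passes to weighted sums, as the weights decrease from index 1
    on. *)
Lemma sum_density_le (u : nat -> R) (e C : R) : (forall k, 0 <= u k) -> 0 <= e -> 0 <= C ->
  (forall N, \sum_(k < N) u k <= e * N%:R + C) ->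
  forall N, \sum_(k < N) density a k * u k <= e * mass a N + (C + e).
Proof.
move=> u0 e0 C0 hU N.
(* The boundary term is kept exactly, the drops of [density] are charged at rate [C] and telescope,
   and the final [e] pays for the start, where [density 0 = 0]. *)
have inv n : \sum_(k < n.+1) density a k * u k - e * mass a n.+1 <=
    density a n.+1 * (\sum_(k < n.+1) u k - e * n.+1%:R) +
    C * (density a 1 - density a n.+1) + e.
  elim: n => [|n IH].
    rewrite /mass !big_ord_recr !big_ord0 /= !add0r density0//.
    have d1 := density_le1 a_gt0 1; have d0 := density_ge0 a 1.
    have := u0 0%N; nra.
  rewrite big_ord_recr /= [mass _ _]big_ord_recr /= -/(mass a n.+1).
  rewrite [X in density a n.+2 * (X - _)]big_ord_recr /=.
  have dle : density a n.+2 <= density a n.+1 by exact: density_le.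
  have := hU n.+2; rewrite big_ord_recr /= -[n.+2%:R]natr1.
  move: IH dle.
  move: (density a n.+1) (density a n.+2) (density a 1) (mass a n.+1) (u n.+1)
    (\sum_(k < n.+1) u k) (\sum_(k < n.+1) density a k * u k) (n.+1%:R : R).
  move=> s s' s1 W v U V n' IH dle hV.
  have : (s - s') * (U + v - e * (n' + 1)) <= (s - s') * C.
    by rewrite ler_wpM2l ?subr_ge0//; lra.
  lra.
case: N => [|N]; first by rewrite /mass !big_ord0 mulr0 add0r addr_ge0.
have := inv N; have := hU N.+1.
have := density_ge0 a N.+1; have := density_le1 a_gt0 1.
move: (density a N.+1) (density a 1) (mass a N.+1) (\sum_(k < N.+1) u k)
  (\sum_(k < N.+1) density a k * u k) (N.+1%:R : R) => s s1 W U V n s11 s0 hn h.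
have h1 : s * (U - e * n) <= s * C by rewrite ler_wpM2l//; lra.
have h2 : C * s1 <= C * 1 by rewrite ler_wpM2l.
lra.
Qed.

Lemma cvg_mass0 (C : R) : (fun N => (mass a N)^-1 * C) @ \oo --> 0.
Proof.
apply/cvgrPdist_le => e e0.
have := mass_y => /cvgryPgt/(_ (`|C| / e)); apply: filter_app; near=> N => h.
have W0 : 0 < mass a N by apply: le_lt_trans h; rewrite divr_ge0// ltW.
rewrite sub0r normrN normrM normfV (gtr0_norm W0) ler_pdivrMl//.
by rewrite -ler_pdivrMr// ltW.
Unshelve. all: by end_near.
Qed.

Variables (w : nat -> bool).
Hypothesis discr : (fun N => (mass a N)^-1 *
  \sum_(k < N) ((w k)%:R - density a k)) @ \oo --> 0.

Lemma hits_natr n : (hits w 0 n)%:R = \sum_(k < n) (w k)%:R :> R.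
Proof. by rewrite /hits add0n big_mkord natr_sum. Qed.

Lemma hitsS n : hits w 0 n.+1 = (hits w 0 n + w n)%N.
Proof. by rewrite /hits !add0n !big_mkord big_ord_recr. Qed.

Lemma hits_ratio_cvg1 : (fun N => (mass a N)^-1 * (hits w 0 N)%:R) @ \oo --> (1 : R).
Proof.
have E n : \sum_(k < n) ((w k)%:R - density a k) = (hits w 0 n)%:R - mass a n.
  by rewrite hits_natr -sumrB.
rewrite -[X in _ --> X]addr0.
apply: cvg_trans (cvgD (cvg_cst (1 : R)) discr).
apply: near_eq_cvg; near=> N.
have W0 : 0 < mass a N by near: N; move: mass_y => /cvgryPgt/(_ 0).
rewrite -[LHS]/(1 + (mass a N)^-1 * \sum_(k < N) ((w k)%:R - density a k)) E.
by rewrite mulrBr mulVf ?gt_eqF// addrC subrK.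
Unshelve. all: by end_near.
Qed.

Lemma hits_cvgy : (hits w 0) @ \oo --> \oo.
Proof.
apply/cvgnyPge => M.
have h1 := hits_ratio_cvg1; move: h1 => /cvgrPdist_lt/(_ (1/2)).
rewrite divr_gt0// => /(_ isT) h1.
have := mass_y => /cvgryPgt/(_ (2 * M%:R)) h2.
near=> N.
have h3 : `|1 - (mass a N)^-1 * (hits w 0 N)%:R| < 1 / 2 by near: N.
have h4 : 2 * M%:R < mass a N by near: N.
rewrite -(ler_nat R).
have W0 : 0 < mass a N by apply: le_lt_trans h4; rewrite mulr_ge0.
move: h3; rewrite ltr_norml => /andP[_].
have -> : 1 - (mass a N)^-1 * (hits w 0 N)%:R = (mass a N)^-1 * (mass a N - (hits w 0 N)%:R).
  by field; rewrite gt_eqF.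
rewrite ltr_pdivrMl//; move: h4; move: (mass a N) (hits w 0 N)%:R (M%:R : R) => u v t; lra.
Unshelve. all: by end_near.
Qed.

(** There are about [mass a N] hits below [N], and each carries a weight that tends to 0. *)
Lemma sum_density_hits_cvg0 :
  (fun N => (mass a N)^-1 * \sum_(k < N) density a k.+1 * (w k)%:R) @ \oo --> 0.
Proof.
apply/cvgrPdist_le => e e0; have e4 : 0 < e / 4 by rewrite divr_gt0.
have [k0 hk0] : exists k0, forall k, (k0 <= k)%N -> density a k.+1 <= e / 4.
  (* The witness solves [k^(-a) <= e / 4]. *)
  exists (Num.truncn ((e / 4) `^ (- a^-1))) => k kk.
  rewrite /density powRN -[leRHS]invrK lef_pV2 ?posrE ?powR_gt0 ?ltr0n ?invr_gt0//.
  have -> : (e / 4)^-1 = ((e / 4) `^ (- a^-1)) `^ a.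
    by rewrite -powRrM mulNr mulVf ?gt_eqF// powR_inv1// ltW.
  rewrite ge0_ler_powR ?nnegrE ?powR_ge0//; first exact: ltW.
  apply: ltW; apply: lt_le_trans (truncnS_gt _) _; by rewrite ler_nat ltnS.
have := hits_ratio_cvg1 => /cvgrPdist_le/(_ 1 ltr01) h1.
have := cvg_mass0 k0%:R => /cvgrPdist_le/(_ (e / 2)); rewrite divr_gt0// => /(_ isT) h2.
near=> N.
have W0 : 0 < mass a N by near: N; move: mass_y => /cvgryPgt/(_ 0).
have h3 : `|1 - (mass a N)^-1 * (hits w 0 N)%:R| <= 1 by near: N.
have h4 : `|0 - (mass a N)^-1 * k0%:R| <= e / 2 by near: N.
have s0 n : 0 <= \sum_(k < n) density a k.+1 * (w k)%:R.
  by apply: sumr_ge0 => k _; rewrite mulr_ge0// density_ge0.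
have bound n : \sum_(k < n) density a k.+1 * (w k)%:R <= k0%:R + e / 4 * (hits w 0 n)%:R.
  have [nk|kn] := leqP n k0.
    apply: (@le_trans _ _ n%:R); last first.
      by rewrite ler_wpDr ?ler_nat// mulr_ge0// ltW.
    rewrite -[n in leRHS]card_ord -sumr_const; apply: ler_sum => k _.
    by rewrite mulr_ile1// ?density_ge0 ?density_le1// lern1 leq_b1.
  rewrite hits_natr -!(big_mkord xpredT (fun k => (w k)%:R : R)).
  rewrite -(big_mkord xpredT (fun k => density a k.+1 * (w k)%:R)).
  rewrite !(@big_cat_nat _ _ _ k0 0 n)//= 1?ltnW// mulrDr addrA; apply: lerD.
    apply: ler_wpDr; first by apply: mulr_ge0; [exact: ltW|apply: sumr_ge0].
    rewrite -[k0 in leRHS]subn0 -[leRHS]mulr_natl mulr1 -sumr_const_nat.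
    apply: ler_sum => k _.
    by rewrite mulr_ile1// ?density_ge0 ?density_le1// lern1 leq_b1.
  rewrite mulr_sumr !big_nat; apply: ler_sum => k /andP[kk _].
  by rewrite ler_wpM2r// hk0.
rewrite sub0r normrN normrM normfV (gtr0_norm W0) (ger0_norm (s0 N)) ler_pdivrMl//.
apply: le_trans (bound N) _.
move: h4; rewrite sub0r normrN normrM normfV (gtr0_norm W0) normr_nat ler_pdivrMl// => h4.
move: h3; rewrite ler_norml => /andP[h3 _].
have h5 : (hits w 0 N)%:R <= 2 * mass a N.
  rewrite mulrC -ler_pdivrMl//; move: h3; move: (_ * _) => t; lra.
move: h5 h4; move: (hits w 0 N)%:R (mass a N) (k0%:R : R) => s W k; nra.
Unshelve. all: by end_near.
Qed.

(* [F] only changes at hits, and the total weight [\sum density (k + 1) w_k] of the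
   hits is negligible with respect to [mass]. *)
Lemma weighted_coboundary_cvg0 (F h : nat -> R) (B C : R) :
  (forall k, `|F k| <= B) -> (forall k, `|h k| <= C) ->
  (forall k, w k = false -> F k.+1 = F k) ->
  (fun N => (mass a N)^-1 * \sum_(k < N) density a k * (F k * (h k - h k.+1)))
    @ \oo --> 0.
Proof.
move=> FB hC Fw.
have B0 : 0 <= B by exact: le_trans (FB 0%N).
have C0 : 0 <= C by exact: le_trans (hC 0%N).
have step k : `|density a k.+1 * F k.+1 - density a k * F k| <=
    2 * B * (density a k.+1 * (w k)%:R) + B * `|density a k.+1 - density a k|.
  have -> : density a k.+1 * F k.+1 - density a k * F k =
     density a k.+1 * (F k.+1 - F k) + (density a k.+1 - density a k) * F k by ring.
  apply: le_trans (ler_normD _ _) _; apply: lerD; last first.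
    by rewrite normrM mulrC ler_wpM2r.
  rewrite normrM (ger0_norm (density_ge0 _ _)) mulrCA ler_wpM2l ?density_ge0//.
  case wk: (w k) => /=; last by rewrite Fw// subrr normr0 mulr0.
  by rewrite mulr1 mulr2n mulrDl mul1r (le_trans (ler_normB _ _))// lerD.
(* The density jumps from [density 0 = 0] to [density 1] and then decreases, so its variation is at
   most [2 * density 1]. *)
have tv n : \sum_(k < n) `|density a k.+1 - density a k| <= 2.
  case: n => [|n]; first by rewrite big_ord0.
  suff: \sum_(k < n.+1) `|density a k.+1 - density a k| = 2 * density a 1 - density a n.+1.
    move=> ->; have := density_le1 a_gt0 1; have := density_ge0 a n.+1.
    by move: (density a 1) (density a n.+1) => u v; lra.
  elim: n => [|n IH].
    by rewrite big_ord_recr big_ord0 /= density0// subr0 ger0_norm ?density_ge0//; ring.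
  rewrite big_ord_recr /= IH ler0_norm; first by ring.
  by rewrite subr_le0 density_le.
have bound N : `|\sum_(k < N) density a k * (F k * (h k - h k.+1))| <=
    C * (3 * B + 2 * B * \sum_(k < N) density a k.+1 * (w k)%:R) .
  under eq_bigr do rewrite mulrA.
  apply: le_trans (normr_abel_le (fun k => density a k * F k) N hC) _.
  rewrite ler_wpM2l// density0// mul0r normr0 add0r.
  have -> : 3 * B = B + B * 2 by ring.
  rewrite -addrA; apply: lerD.
    rewrite normrM (ger0_norm (density_ge0 _ _)) -[leRHS]mul1r.
    by rewrite ler_pM// ?density_ge0// density_le1.
  apply: (@le_trans _ _ (\sum_(k < N) (2 * B * (density a k.+1 * (w k)%:R) +
      B * `|density a k.+1 - density a k|))); first by apply: ler_sum => k _; exact: step.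
  by rewrite big_split /= -!mulr_sumr addrC lerD2r ler_wpM2l// tv.
pose G N := (mass a N)^-1 * (C * (3 * B)) + (C * (2 * B)) *
    ((mass a N)^-1 * \sum_(k < N) density a k.+1 * (w k)%:R).
have lim0 : G @ \oo --> 0 + (C * (2 * B)) * 0.
  apply: cvgD; first exact: cvg_mass0.
  by apply: cvgMr; exact: sum_density_hits_cvg0.
rewrite mulr0 addr0 in lim0.
have limN : (fun N => - G N) @ \oo --> - (0 : R) by exact: cvgN.
rewrite oppr0 in limN.
apply: (squeeze_cvgr _ limN lim0); near=> N.
have W0 : 0 < mass a N by near: N; move: mass_y => /cvgryPgt/(_ 0).
rewrite -ler_norml normrM normfV (gtr0_norm W0).
apply: le_trans (ler_wpM2l _ (bound N)) _; first by rewrite invr_ge0 ltW.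
by rewrite le_eqVlt; apply/orP; left; apply/eqP; rewrite /G; ring.
Unshelve. all: by end_near.
Qed.

Lemma weighted_small_limsup (F q : nat -> R) (B e : R) : 0 <= B -> 0 <= e ->
  (forall k, `|F k| <= B) ->
  (fun n => n%:R^-1 * \sum_(k < n) `|q k|) @ \oo --> e ->
  forall e', e < e' -> \forall N \near \oo,
    `|(mass a N)^-1 * \sum_(k < N) density a k * (F k * q k)| <= B * e'.
Proof.
move=> B0 e0 FB cq e' ee'.
(* The midpoint leaves room [e' - m] for the additive constant [C + m], negligible against the
   mass. *)
pose m := (e + e') / 2.
have em : e < m by rewrite /m; lra.
have me' : m < e' by rewrite /m; lra.
have m0 : 0 <= m by exact: le_trans (ltW em).
have : \forall n \near \oo, n%:R^-1 * \sum_(k < n) `|q k| <= m.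
  by apply: (cvgr_le _ cq).
move=> [n0 _ hn0].
pose C := \sum_(k < n0) `|q k|.
have C0 : 0 <= C by exact: sumr_ge0.
have hU N : \sum_(k < N) `|q k| <= m * N%:R + C.
  have [Nn|nN] := leqP N n0.
    apply: (@le_trans _ _ C); last by rewrite lerDr mulr_ge0.
    rewrite /C -!(big_mkord xpredT (fun k => `|q k|)).
    by rewrite [leRHS](@big_cat_nat _ _ _ N)//= ler_wpDr// sumr_ge0.
  rewrite ler_wpDr//; have := hn0 N (ltnW nN) => /=.
  have NR : 0 < N%:R :> R by rewrite ltr0n (leq_ltn_trans _ nN).
  by rewrite ler_pdivrMl// mulrC.
have hW := sum_density_le (fun k => normr_ge0 (q k)) m0 C0 hU.
have := cvg_mass0 (C + m) => /cvgrPdist_le/(_ (e' - m)); rewrite subr_gt0 => /(_ me') h2.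
near=> N.
have h3 : `|0 - (mass a N)^-1 * (C + m)| <= e' - m by near: N.
have W0 : 0 < mass a N by near: N; move: mass_y => /cvgryPgt/(_ 0).
rewrite normrM normfV (gtr0_norm W0) ler_pdivrMl//.
apply: le_trans (ler_norm_sum _ _ _) _.
apply: (@le_trans _ _ (B * \sum_(k < N) density a k * `|q k|)).
  rewrite mulr_sumr; apply: ler_sum => k _.
  rewrite !normrM (ger0_norm (density_ge0 _ _)) mulrCA.
  by rewrite ler_wpM2r// mulr_ge0// density_ge0.
rewrite mulrCA ler_wpM2l//; apply: le_trans (hW N) _.
move: h3; rewrite sub0r normrN normrM normfV (gtr0_norm W0).
rewrite (ger0_norm (addr_ge0 C0 m0)) ler_pdivrMl//.
move: (mass a N) => W; lra.
Unshelve. all: by end_near.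
Qed.

End WeightedAverages.

(** * Hit enumeration *)

Section Enumeration.
Variable S : set nat.
Let w k := k \in S.

Lemma count_hits k : count (fun j => j \in S) (iota 0 k) = hits w 0 k.
Proof. by rewrite /hits add0n -sum1_count big_mkcond /index_iota subn0. Qed.

Lemma hits_homo : {homo hits w 0 : i j / (i <= j)%N}.
Proof. by move=> i j /subnKC <-; rewrite hitsD leq_addr. Qed.

Lemma increasing_enum_hits k : w k -> increasing_enum S (hits w 0 k.+1) = k.
Proof.
move=> wk; rewrite /increasing_enum; set P := [set k' | _].
have Pk : P k by split; [exact/set_mem|exact: count_hits].
have uniq i j : P i -> P j -> (i < j)%N -> False.
  move=> [_ hi] [Sj hj] ij; have wj : w j by exact/mem_set.
  have := hits_homo ij; rewrite -count_hits hi -hj count_hits hitsS wj.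
  by rewrite addn1 ltnn.
have Pg : P (xget 0%N P) by exact: xgetPex (ex_intro _ k Pk).
have [lt|gt|//] := ltngtP (xget 0%N P) k; exfalso; exact: (uniq _ _ _ _ lt) || exact: (uniq _ _ _ _ gt).
Qed.

(** The [n]-th hit [k] has [n = hits w 0 k + 1], so a sum over hits becomes a sum over all [k < M]
    weighted by the hit indicator; this is where the exponent [s_k + 1] of [T] comes from. *)
Lemma sum_increasing_enum (V : zmodType) (phi : nat -> nat -> V) M :
  \sum_(1 <= n < (hits w 0 M).+1) phi n (increasing_enum S n) =
  \sum_(k < M) (if w k then phi (hits w 0 k).+1 k else 0).
Proof.
elim: M => [|M IH]; first by rewrite big_ord0 /hits big_geq// big_geq.
rewrite big_ord_recr /= -IH hitsS; case: ifP => wM; last by rewrite addn0 addr0.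
rewrite addn1 big_nat_recr//=; congr (_ + phi _ _).
by rewrite -[in RHS](increasing_enum_hits wM) hitsS wM addn1.
Qed.

End Enumeration.

Section HitsLimit.
Context {R : realType}.
Variables (a : R) (w : nat -> bool).
Hypothesis mass_y : mass a @ \oo --> +oo.
Hypothesis discr : (fun N => (mass a N)^-1 *
  \sum_(k < N) ((w k)%:R - density a k)) @ \oo --> 0.

(** [hits w 0] tends to infinity by steps 0 or 1, so every large [N] is one of its values; and it
    may replace the mass, their ratio tending to 1. *)
Lemma cvg_along_hits (Phi : nat -> R) (l : R) :
  (fun M => (mass a M)^-1 * Phi (hits w 0 M)) @ \oo --> l ->
  (fun N => N%:R^-1 * Phi N) @ \oo --> l.
Proof.
move=> cP.
have ratio := hits_ratio_cvg1 mass_y discr.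
have sy := hits_cvgy mass_y discr.
have c1 : (fun M => ((mass a M)^-1 * Phi (hits w 0 M)) *
    ((mass a M)^-1 * (hits w 0 M)%:R)^-1) @ \oo --> l * 1^-1.
  by apply: cvgM => //; apply: cvgV => //; exact: oner_neq0.
rewrite invr1 mulr1 in c1.
apply/cvgrPdist_le => e e0.
have c2 : \forall M \near \oo, `|l - (hits w 0 M)%:R^-1 * Phi (hits w 0 M)| <= e.
  have := c1 => /cvgrPdist_le/(_ e e0); apply: filter_app; near=> M.
  have W0 : 0 < mass a M by near: M; move: mass_y => /cvgryPgt/(_ 0).
  suff -> : (mass a M)^-1 * Phi (hits w 0 M) * ((mass a M)^-1 * (hits w 0 M)%:R)^-1 =
    (hits w 0 M)%:R^-1 * Phi (hits w 0 M) by [].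
  by rewrite invfM invrK mulrACA mulVf ?gt_eqF// mul1r mulrC.
have [M0 _ h0] := c2.
exists (hits w 0 M0) => // N /= MN.
have [M1 _ h1] : \forall M \near \oo, (N <= hits w 0 M)%N.
  by move: sy => /cvgnyPge/(_ N).
have : exists2 M, (M0 <= M)%N & hits w 0 M = N.
  have {}h1 := h1 (M0 + M1)%N (leq_addl _ _).
  elim: M1 h1 => [|k IH] /= h1.
    by exists M0 => //; apply/eqP; rewrite eqn_leq MN -(addn0 M0) h1.
  have [le|lt] := leqP N (hits w 0 (M0 + k)); first exact: IH.
  exists (M0 + k.+1)%N; first exact: leq_addr.
  apply/eqP; rewrite eqn_leq h1 andbT addnS hitsS.
  by apply: leq_trans lt; rewrite -addn1 leq_add2l leq_b1.
by move=> [M MM <-]; exact: h0.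
Unshelve. all: by end_near.
Qed.

End HitsLimit.

Section Coboundary.
Context {d} {X : measurableType d} {R : realType}.
Variables (S : X -> X) (g : X -> R).

(** It solves the coboundary equation up to an ergodic average: the Birkhoff sums of length [i] at
    [x] and [S x] differ by [g x - g (S^i x)], and this is averaged over [i < n]. *)
Definition transfer_fun n x : R := n%:R^-1 * \sum_(i < n) birkhoff_sum S g i x.

Lemma transfer_funE n x : (0 < n)%N ->
  g x = transfer_fun n x - transfer_fun n (S x) + birkhoff_average S g n x.
Proof.
move=> n0; rewrite /transfer_fun -mulrBr -sumrB.
have E i : birkhoff_sum S g i x - birkhoff_sum S g i (S x) = g x - g (iter i S x).
  have := birkhoff_sumS S g i x; rewrite {1}/birkhoff_sum big_ord_recr /=.
  rewrite -/(birkhoff_sum S g i x) => h; rewrite -[g x](addrK (birkhoff_sum S g i (S x))) -h.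
  by ring.
under eq_bigr do rewrite E.
rewrite sumrB sumr_const card_ord mulrBr -[X in _ * X - _]mulr_natl.
by rewrite mulKf ?pnatr_eq0 -?lt0n// subrK.
Qed.

Lemma normr_transfer_fun_le (B : R) n x : (forall x, `|g x| <= B) ->
  `|transfer_fun n x| <= n%:R * B.
Proof.
move=> gB; have B0 : 0 <= B by exact: le_trans (gB x).
rewrite normrM normfV normr_nat; case: n => [|n].
  by rewrite invr0 !mul0r.
rewrite ler_pdivrMl ?ltr0n//; apply: le_trans (ler_norm_sum _ _ _) _.
apply: (@le_trans _ _ (\sum_(i < n.+1) n.+1%:R * B)); last first.
  by rewrite sumr_const card_ord -[leLHS]mulr_natl.
apply: ler_sum => i _; apply: le_trans (normr_birkhoff_sum_le S _ _ gB) _.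
by rewrite ler_wpM2r// ler_nat ltnW.
Qed.

End Coboundary.

Section SmallAverages.
Context {d} {X : measurableType d} {R : realType} (mu : probability X R).
Variable S : X -> X.
Hypothesis mpS : measure_preserving mu S.

(* By Birkhoff's theorem the limit [e] has the same mean as
   [|birkhoff_average S g n|], and that mean tends to [0]. *)
Lemma ae_small_averages (g : X -> R) : bounded_measurable g ->
  {ae mu, forall x, (fun n => birkhoff_average S g n x) @ \oo --> 0} ->
  {ae mu, forall x (r : R), 0 < r -> exists n e, [/\ (0 < n)%N, 0 <= e, e < r &
    (fun N => N%:R^-1 * \sum_(k < N) `|birkhoff_average S g n (iter k S x)|) @ \oo --> e]}.
Proof.
move=> bg g0.
have bq n : bounded_measurable (fun x => `|birkhoff_average S g n.+1 x|).
  exact: bounded_measurable_norm (bounded_measurable_birkhoff_average mpS _ bg).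
have /choice[e he] n := birkhoff mpS (bq n).
have be n : bounded_measurable (e n) by case: (he n).
have [_ [B gB]] := bg.
have mq : (fun n => mean mu (fun x => `|birkhoff_average S g n.+1 x|)) @ \oo --> (0 : R).
  rewrite -[X in _ --> X](mean_cst mu).
  apply: (@mean_cvg _ _ _ mu _ _ B) => //.
  - exact: bounded_measurable_cst.
  - by move=> n x; rewrite normr_id; exact: normr_birkhoff_average_le.
  - apply: ae_mono g0 => x cx.
    have c1 : (fun n => birkhoff_average S g n.+1 x) @ \oo --> (0 : R).
      by have := cx; rewrite -cvg_shiftS.
    apply/cvgrPdist_le => r r0; move: c1 => /cvgrPdist_le/(_ r r0).
    by apply: filterS => n; rewrite !sub0r !normrN normr_id.
have ecvg n : {ae mu, forall x, (fun N => N%:R^-1 *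
    \sum_(k < N) `|birkhoff_average S g n.+1 (iter k S x)|) @ \oo --> e n x}.
  by case: (he n).
have invT : invariant_sets mu S setT.
  split => //; rewrite (_ : _ `+` _ = set0) ?measure0//.
  by apply/seteqP; split => x // -[[_ h]|[_ h]]; exact: h.
have me n : mean mu (e n) = mean mu (fun x => `|birkhoff_average S g n.+1 x|).
  have [_ _ _ /(_ _ invT)] := he n.
  have E (h : X -> R) : (fun x => h x * \1_setT x) = h.
    by apply/funext => x; rewrite indicE in_setT mulr1.
  by rewrite !E.
have e0 n : {ae mu, forall x, 0 <= e n x}.
  apply: ae_mono (ecvg n) => x cx; rewrite -(cvg_lim _ cx)//.
  apply: limr_ge; first exact: cvgP cx.
  by apply: nearW => N; rewrite mulr_ge0 ?invr_ge0// sumr_ge0.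
(* The points at which no [n] brings the limit below [1 / (k + 1)]. By Markov's inequality the
   measure is at most [k + 1] times a mean that tends to 0. The absolute value makes the inequality
   pointwise, although [e n >= 0] holds only almost everywhere. *)
pose A k : set X := \bigcap_n [set x | k.+1%:R^-1 <= `|e n x|].
have mA k : measurable (A k).
  apply: bigcap_measurable => // n _; rewrite -[X in measurable X]setTI.
  rewrite [X in _ `&` X](_ : _ = (fun x => `|e n x|) @^-1` `[k.+1%:R^-1, +oo[).
    have [mf _] := bounded_measurable_norm (be n).
    by apply: mf => //; exact: measurable_itv.
  by apply/seteqP; split => x /=; rewrite in_itv /= andbT.
have A0 k : mu (A k) = 0%E.
  have bA : bounded_measurable (\1_(A k) : X -> R) by exact: bounded_measurable_indic.
  have hA n : mean mu (\1_(A k) : X -> R) <=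
      k.+1%:R * mean mu (fun x => `|birkhoff_average S g n.+1 x|).
    rewrite -me; have -> : mean mu (e n) = mean mu (fun x => `|e n x|).
      apply: eq_mean_ae => //; first exact: bounded_measurable_norm.
      by apply: ae_mono (e0 n) => x ex; rewrite ger0_norm.
    rewrite -meanZ; last exact: bounded_measurable_norm.
    apply: mean_le => //.
      by apply: bounded_measurableZ; exact: bounded_measurable_norm.
    move=> x; rewrite indicE; have [xA|xA] := pselect (A k x); last first.
      by rewrite memNset// mulr_ge0.
    by rewrite mem_set// -ler_pdivrMl ?ltr0n// mulr1; exact: xA.
  have limA : (fun n => k.+1%:R * mean mu (fun x => `|birkhoff_average S g n.+1 x|))
      @ \oo --> k.+1%:R * (0 : R) by exact: cvgMr.
  rewrite mulr0 in limA.
  have le0 : mean mu (\1_(A k) : X -> R) <= 0.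
    rewrite -(cvg_lim _ limA)//; apply: limr_ge; first exact: cvgP limA.
    exact: nearW.
  have E0 : mean mu (\1_(A k) : X -> R) = 0.
    by apply/eqP; rewrite eq_le le0 mean_ge0// => x; rewrite indicE.
  by have := EFin_mean mu bA; rewrite E0 integral_indic// setIT => <-.
have aA : {ae mu, forall x k, ~ A k x}.
  apply: ae_foralln => k; exists (A k); split; [exact: mA|exact: A0|move=> x /= h].
  by apply: contrapT => nA; apply: h.
apply: ae_mono (aeI aA (aeI (ae_foralln ecvg) (ae_foralln e0))) => x [nA [cx ex]] r r0.
have [k hk] := inv_succ_lt r0.
have [n hn] : exists n, `|e n x| < k.+1%:R^-1.
  apply: contrapT => h; apply: (nA k) => n _ /=.
  by rewrite leNgt; apply/negP => hn; apply: h; exists n.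
exists n.+1, (e n x); split => //.
apply: lt_trans hk; apply: le_lt_trans hn; exact: ler_norm.
Qed.

End SmallAverages.

Section WeightedLimit.
Context {R : realType}.
Variables (a c : R).
Hypotheses (a_gt0 : 0 < a) (c_gt1 : 1 < c).
Variable w : nat -> bool.
Hypothesis gw : good a c w.
Context {d} {X : measurableType d} (mu : probability X R).
Variables (T S : X -> X).
Hypotheses (mpT : measure_preserving mu T) (mpS : measure_preserving mu S).
Hypothesis TS : forall x, T (S x) = S (T x).

Lemma good_mass_cvgy : mass a @ \oo --> +oo.
Proof. by have [A [K [C [aA _]]]] := gw; exact: (mass_cvgy a_gt0 aA). Qed.

Lemma ae_discrepancy_bounded (f g : X -> R) :
  bounded_measurable f -> bounded_measurable g ->
  {ae mu, forall x, (fun N => (mass a N)^-1 * \sum_(k < N)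
     ((w k)%:R - density a k) * (f (iter (hits w 0 k) T x) * g (iter k S x)))
     @ \oo --> 0}.
Proof.
move=> bf bg; have [A [K [C [aA hC]]]] := gw.
have norm (h : X -> R) : bounded_measurable h -> exists B : R, [/\ 0 < B,
    bounded_measurable (fun x => B^-1 * h x) & forall x, `|B^-1 * h x| <= 1].
  move=> bh; have [_ [B hB]] := bh; exists (`|B| + 1).
  have B0 : 0 < `|B| + 1 by rewrite ltr_wpDl.
  split => //; first exact: bounded_measurableZ.
  move=> x; rewrite normrM normfV (gtr0_norm B0) ler_pdivrMl// mulr1.
  by rewrite (le_trans (hB x))// (le_trans (ler_norm B))// lerDl.
have [B [B0 bf' f1]] := norm f bf; have [D [D0 bg' g1]] := norm g bg.
have := ae_discrepancy a_gt0 c_gt1 aA mpT mpS TS hC bf' f1 bg' g1.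
apply: ae_mono => x cx.
have cB : (fun N => (B * D) * ((mass a N)^-1 * \sum_(k < N)
   ((w k)%:R - density a k) * (B^-1 * f (iter (hits w 0 k) T x) *
   (D^-1 * g (iter k S x))))) @ \oo --> (B * D) * 0 by exact: cvgMr.
rewrite mulr0 in cB; move: cB; apply: cvg_trans; apply: near_eq_cvg; near=> N.
rewrite mulrCA; congr (_ * _); rewrite mulr_sumr; apply: eq_bigr => k _.
by field; rewrite !gt_eqF.
Unshelve. all: by end_near.
Qed.

(** The instance [f = g = 1]. The point [x] does not occur in the limit; the almost sure form lets
    it be combined with the other limits. *)
Lemma ae_hits_discrepancy : {ae mu, forall x : X, (fun N => (mass a N)^-1 *
  \sum_(k < N) ((w k)%:R - density a k)) @ \oo --> 0}.
Proof.
have b1 := @bounded_measurable_cst _ X R 1.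
apply: ae_mono (ae_discrepancy_bounded b1 b1) => x.
have E n : \sum_(k < n) ((w k)%:R - density a k) * (1 * 1) =
    \sum_(k < n) ((w k)%:R - density a k) by apply: eq_bigr => k _; rewrite !mulr1.
by under eq_fun do rewrite E.
Qed.

Lemma ae_weighted_limit (f g ft gt : X -> R) :
  bounded_measurable f -> bounded_measurable g -> bounded_measurable gt ->
  {ae mu, forall x, (fun n => birkhoff_average T f n x) @ \oo --> ft x} ->
  {ae mu, forall x, (fun n => birkhoff_average S g n x) @ \oo --> gt x} ->
  {ae mu, forall x, gt (S x) = gt x} ->
  {ae mu, forall x, (fun N => (mass a N)^-1 * \sum_(k < N)
     (w k)%:R * (f (iter (hits w 0 k).+1 T x) * g (iter k S x)))
     @ \oo --> ft x * gt x}.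
Proof.
move=> bf bg bgt cf cg gtS.
have mass_y := good_mass_cvgy.
pose g0 x := g x - gt x.
have bg0 : bounded_measurable g0 by exact: bounded_measurableB.
pose F0 x := f (T x).
have bF0 : bounded_measurable F0 by apply: bounded_measurable_comp bf; case: mpT.
have gtSn : {ae mu, forall x n, gt (iter n S x) = gt x}.
  apply: ae_mono (ae_iter mpS gtS) => x hx n.
  by elim: n => [//|n IH]; rewrite iterS hx.
have cg0 : {ae mu, forall x, (fun n => birkhoff_average S g0 n x) @ \oo --> 0}.
  apply: ae_mono (aeI cg gtSn) => x [cgx gx].
  have c1 : (fun n => birkhoff_average S g n x - gt x) @ \oo --> gt x - gt x.
    by apply: cvgB => //; exact: cvg_cst.
  rewrite subrr in c1; move: c1; apply: cvg_trans; apply: near_eq_cvg; near=> n.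
  rewrite /birkhoff_average /birkhoff_sum sumrB mulrBr; congr (_ - _).
  under eq_bigr do rewrite gx.
  rewrite sumr_const card_ord -[X in _ * X]mulr_natl mulKf// pnatr_eq0 -lt0n.
  by near: n; exact: nbhs_infty_gt.
have all := aeI (ae_discrepancy_bounded bF0 bg0) (aeI ae_hits_discrepancy
  (aeI cf (aeI gtSn (ae_small_averages mpS bg0 cg0)))).
apply: ae_mono all => x [h1 [h2 [h3 [h4 h5]]]].
pose F k := f (iter (hits w 0 k).+1 T x).
have [_ [B fB]] := bf; have [_ [C gC]] := bg0.
have FB k : `|F k| <= B by exact: fB.
have B0 : 0 <= B by exact: le_trans (FB 0%N).
have Fw k : w k = false -> F k.+1 = F k by move=> wk; rewrite /F hitsS wk addn0.
have t1 : (fun N => gt x * ((mass a N)^-1 * \sum_(k < N) (w k)%:R * F k)) @ \oo -->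
    gt x * ft x.
  apply: cvgMr.
  (* The hits below [N] use each of the times [1, ..., s_N] of [T] once, which gives a Birkhoff sum
     started at [T x]. *)
  have E N : \sum_(k < N) (w k)%:R * F k = birkhoff_sum T f (hits w 0 N) (T x).
    elim: N => [|N IH]; first by rewrite /hits big_geq// /birkhoff_sum !big_ord0.
    rewrite big_ord_recr /= IH hitsS; case: (w N); last by rewrite addn0 mul0r addr0.
    by rewrite addn1 mul1r /birkhoff_sum big_ord_recr /= /F iterSr.
  have cTx : (fun n => birkhoff_average T f n (T x)) @ \oo --> ft x.
    have c3 : (fun n => birkhoff_average T f n (T x) - birkhoff_average T f n x +
        birkhoff_average T f n x) @ \oo --> 0 + ft x.
      by apply: cvgD => //; exact: birkhoff_averageT_cvg.
    by rewrite add0r in c3; move: c3; under eq_fun do rewrite subrK.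
  have c4 : (fun N => (mass a N)^-1 * (hits w 0 N)%:R *
      birkhoff_average T f (hits w 0 N) (T x)) @ \oo --> 1 * ft x.
    apply: cvgM; first exact: hits_ratio_cvg1.
    exact: (cvg_comp _ _ (hits_cvgy mass_y h2) cTx).
  rewrite mul1r in c4; move: c4; apply: cvg_trans; apply: near_eq_cvg; near=> N.
  rewrite E /birkhoff_average -mulrA; congr (_ * _).
  rewrite mulrA divff ?mul1r// pnatr_eq0 -lt0n.
  by near: N; move: (hits_cvgy mass_y h2) => /cvgnyPge/(_ 1%N).
have t3 : (fun N => (mass a N)^-1 * \sum_(k < N) density a k * (F k * g0 (iter k S x)))
    @ \oo --> 0.
  apply/cvgrPdist_le => r r0.
  (* [B + 1] in place of [B] avoids a division by 0, and [B] times this is at most [r / 2]. *)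
  have rB : 0 < r / (2 * (B + 1)) by rewrite divr_gt0// mulr_gt0// ltr_wpDl.
  have [n [e [n0 e0 er ce]]] := h5 _ rB.
  pose h k := transfer_fun S g0 n (iter k S x).
  have hC k : `|h k| <= n%:R * C by exact: normr_transfer_fun_le.
  have l1 := weighted_coboundary_cvg0 a_gt0 mass_y h2 FB hC Fw.
  have l2 := @weighted_small_limsup _ a a_gt0 mass_y F
    (fun k => birkhoff_average S g0 n (iter k S x)) B e B0 e0 FB ce _ er.
  move: l1 => /cvgrPdist_le/(_ (r / 2)); rewrite divr_gt0// => /(_ isT) l1.
  near=> N.
  have h6 : `|0 - (mass a N)^-1 * \sum_(k < N) density a k * (F k * (h k - h k.+1))|
    <= r / 2 by near: N.
  have h7 : `|(mass a N)^-1 * \sum_(k < N) density a k *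
    (F k * birkhoff_average S g0 n (iter k S x))| <= B * (r / (2 * (B + 1))) by near: N.
  have -> : \sum_(k < N) density a k * (F k * g0 (iter k S x)) =
    \sum_(k < N) density a k * (F k * (h k - h k.+1)) +
    \sum_(k < N) density a k * (F k * birkhoff_average S g0 n (iter k S x)).
    rewrite -big_split; apply: eq_bigr => k _ /=.
    rewrite {1}(transfer_funE S g0 (iter k S x) n0) -/(h k).
    by rewrite /h iterS; ring.
  rewrite sub0r normrN mulrDr; rewrite sub0r normrN in h6.
  apply: le_trans (ler_normD _ _) _; apply: le_trans (lerD h6 h7) _.
  have : B * (r / (2 * (B + 1))) <= r / 2.
    rewrite -subr_ge0; have B1 : 0 < B + 1 by rewrite ltr_wpDl.
    have -> : r / 2 - B * (r / (2 * (B + 1))) = r / (2 * (B + 1)).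
      by field; rewrite gt_eqF.
    exact: ltW.
  by move: (B * _) => u hu; rewrite [leRHS]splitr lerD2l.
(* Here [g = gt + g0] with [gt] constant along the [S]-orbit, and the weight [w k] of [g0] is split
   as [(w k - density a k) + density a k]. *)
have lim0 : (fun N => gt x * ((mass a N)^-1 * \sum_(k < N) (w k)%:R * F k) +
   (mass a N)^-1 * \sum_(k < N) ((w k)%:R - density a k) *
      (F0 (iter (hits w 0 k) T x) * g0 (iter k S x)) +
   (mass a N)^-1 * \sum_(k < N) density a k * (F k * g0 (iter k S x))) @ \oo -->
   gt x * ft x + 0 + 0.
  by apply: cvgD => //; apply: cvgD.
rewrite !addr0 mulrC in lim0; move: lim0; apply: cvg_trans; apply: near_eq_cvg; near=> N.
rewrite mulrCA -!mulrDr; congr (_ * _); rewrite mulr_sumr -!big_split /=.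
by apply: eq_bigr => k _; rewrite /g0 h4 /F0 /F /=; ring.
Unshelve. all: by end_near.
Qed.

End WeightedLimit.

(** * The theorem *)

Section RealTheorem.
Context {R : realType}.
Variables (a c : R) (E : set nat).
Hypotheses (a_gt0 : 0 < a) (c_gt1 : 1 < c).
Hypothesis gE : good a c (fun k => k \in E).
Context {d} {X : measurableType d} (mu : probability X R).
Variables (T S : X -> X).
Hypotheses (mpT : measure_preserving mu T) (mpS : measure_preserving mu S).
Hypothesis TS : forall x, T (S x) = S (T x).

Lemma ae_real_averages (f g : X -> R) : f \in Lfun mu +oo%E -> g \in Lfun mu +oo%E ->
  {ae mu, forall x, (fun N => N%:R^-1 * \sum_(1 <= n < N.+1)
     f (iter n T x) * g (iter (increasing_enum E n) S x)) @ \oo -->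
   real_cond_exp mu f (invariant_sets mu T) x * real_cond_exp mu g (invariant_sets mu S) x}.
Proof.
move=> Lf Lg.
have mfun (h : X -> R) : h \in Lfun mu +oo%E -> measurable_fun setT h.
  by move=> /sub_Lfun_mfun; rewrite inE.
have [f' bf ff'] := Linfty_bounded_version Lf.
have [g' bg gg'] := Linfty_bounded_version Lg.
have [ft [bft cft ftT ftA]] := birkhoff mpT bf.
have [gt [bgt cgt gtS gtA]] := birkhoff mpS bg.
have rf := real_cond_exp_ae mpT (mfun _ Lf) bf ff' bft ftT ftA.
have rg := real_cond_exp_ae mpS (mfun _ Lg) bg gg' bgt gtS gtA.
have lim := ae_weighted_limit a_gt0 c_gt1 gE mpT mpS TS bf bg bgt cft cgt gtS.
have disc := ae_hits_discrepancy a_gt0 c_gt1 gE mpT mpS TS.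
(* The bounded versions are substituted along whole orbits, hence the almost sure equalities are
   taken at all iterates. *)
apply: ae_mono (aeI (ae_iter mpT ff') (aeI (ae_iter mpS gg') (aeI rf (aeI rg (aeI lim disc))))).
move=> x [fx [gx [-> [-> [limx discx]]]]].
pose Phi N := \sum_(1 <= n < N.+1) f' (iter n T x) * g' (iter (increasing_enum E n) S x).
have : (fun N => N%:R^-1 * Phi N) @ \oo --> ft x * gt x.
  apply: (cvg_along_hits (good_mass_cvgy a_gt0 gE) discx).
  move: limx; apply: cvg_trans; apply: near_eq_cvg; near=> N.
  congr (_ * _); rewrite /Phi.
  rewrite (sum_increasing_enum E (fun n k => f' (iter n T x) * g' (iter k S x))).
  by apply: eq_bigr => k _; case: ifP => _; rewrite ?mul1r ?mul0r.
apply: cvg_trans; apply: near_eq_cvg; near=> N.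
by congr (_ * _); apply: eq_bigr => n _; rewrite fx gx.
Unshelve. all: by end_near.
Qed.

End RealTheorem.

Section ComplexAverages.
Context {R : realType}.
Local Open Scope complex_scope.

Lemma cvg_complex (x y : nat -> R) (p q : R) : x @ \oo --> p -> y @ \oo --> q ->
  (fun n => x n +i* y n : R[i]^o) @ \oo --> (p +i* q : R[i]^o).
Proof.
move=> /cvgrPdist_le cx /cvgrPdist_le cy; apply/cvgrPdist_le => e.
(* Positivity in [R[i]] forces the imaginary part of [e] to be 0. *)
rewrite ltcE /= => /andP[/eqP e_im e_re].
have e2 : 0 < complex.Re e / 2 by rewrite divr_gt0.
near=> n.
have xn : `|p - x n| <= complex.Re e / 2 by near: n; exact: cx.
have yn : `|q - y n| <= complex.Re e / 2 by near: n; exact: cy.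
rewrite normc_def lecE /= e_im eqxx /=.
apply: (@le_trans _ _ (`|p - x n| + `|q - y n|)); last by rewrite [leRHS]splitr lerD.
rewrite -[leRHS]ger0_norm ?addr_ge0// -sqrtr_sqr ler_sqrt ?sqr_ge0//.
by rewrite [leRHS]sqrrD !real_normK ?num_real// -addrA lerD2l ler_wpDl.
Unshelve. all: by end_near.
Qed.

Lemma complex_average (u1 v1 u2 v2 : nat -> R) N :
  N%:R^-1 * \sum_(1 <= n < N.+1) (u1 n +i* v1 n) * (u2 n +i* v2 n) =
  (N%:R^-1 * \sum_(1 <= n < N.+1) u1 n * u2 n -
   N%:R^-1 * \sum_(1 <= n < N.+1) v1 n * v2 n) +i*
  (N%:R^-1 * \sum_(1 <= n < N.+1) u1 n * v2 n +
   N%:R^-1 * \sum_(1 <= n < N.+1) v1 n * u2 n).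
Proof.
have sumC (x y : nat -> R) : \sum_(1 <= n < N.+1) (x n +i* y n) =
    (\sum_(1 <= n < N.+1) x n) +i* (\sum_(1 <= n < N.+1) y n).
  by rewrite !unlock /reducebig /=; elim: (index_iota _ _) => //= n s ->.
rewrite -!mulrBr -!mulrDr -sumrB -big_split -(rmorph_nat (real_complex R)) -fmorphV.
rewrite (eq_bigr (fun n => (u1 n * u2 n - v1 n * v2 n) +i* (u1 n * v2 n + v1 n * u2 n)))//.
rewrite sumC; set x := \sum_(_ <= _ < _) _; set y := \sum_(_ <= _ < _) _.
by apply/eqP; rewrite eq_complex /= !mul0r subr0 addr0 !eqxx.
Qed.

End ComplexAverages.

Theorem corollary1p10 (R : realType) (a c : R)
    (a_gt0 : 0 < a) (a_lt : a < 1 / 14) (c_gt1 : 1 < c) :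
  {ae lebesgue_measure, forall y : R, y \in `[0, 1] ->
    forall (d : measure_display) (X : measurableType d) (mu : probability X R)
      (T1 T2 : X -> X),
      measure_preserving mu T1 -> measure_preserving mu T2 ->
      T1 \o T2 = T2 \o T1 ->
    forall f1 f2 : X -> R[i], Linfty mu f1 -> Linfty mu f2 ->
    {ae mu, forall x,
      (fun N : nat => N%:R^-1 *
         \sum_(1 <= n < N.+1)
           f1 (iter n T1 x) *
           f2 (iter (increasing_enum (hitting_times a c y) n) T2 x) : R[i]^o)
        @ \oo -->
      (cond_exp mu f1 (invariant_sets mu T1) x *
       cond_exp mu f2 (invariant_sets mu T2) x : R[i]^o)}}.
Proof.
apply: ae_mono (ae_good a_gt0 c_gt1 a_lt) => y hy yI.
move=> d X mu T1 T2 mp1 mp2 T12 f1 f2 [Lu1 Lv1] [Lu2 Lv2].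
have gy := hy yI; set E := hitting_times a c y in gy *.
have TS x : T1 (T2 x) = T2 (T1 x) by exact: (congr1 (fun h => h x) T12).
have avg := ae_real_averages a_gt0 c_gt1 gy mp1 mp2 TS.
(* With real parts [u] and imaginary parts [v], the product has real part [u1 u2 - v1 v2] and
   imaginary part [u1 v2 + v1 u2]: four real limits. *)
apply: ae_mono (aeI (aeI (avg _ _ Lu1 Lu2) (avg _ _ Lv1 Lv2))
  (aeI (avg _ _ Lu1 Lv2) (avg _ _ Lv1 Lu2))) => x [[huu hvv] [huv hvu]].
apply: cvg_trans (cvg_complex (cvgB huu hvv) (cvgD huv hvu)).
apply: near_eq_cvg; apply: nearW => N.
rewrite [RHS](_ : _ = N%:R^-1 * \sum_(1 <= n < N.+1)
  (complex.Re (f1 (iter n T1 x)) +i* complex.Im (f1 (iter n T1 x)))%C *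
  (complex.Re (f2 (iter (increasing_enum E n) T2 x)) +i*
   complex.Im (f2 (iter (increasing_enum E n) T2 x)))%C).
  by rewrite (complex_average (fun n => complex.Re (f1 (iter n T1 x)))
    (fun n => complex.Im (f1 (iter n T1 x)))
    (fun n => complex.Re (f2 (iter (increasing_enum E n) T2 x)))
    (fun n => complex.Im (f2 (iter (increasing_enum E n) T2 x)))).
by congr (_ * _); apply: eq_bigr => n _; case: (f1 _); case: (f2 _).
Qed.
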